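(* Let $R$ be a commutative ring, $q,Q_0,\dots,Q_{r-1}\in R^\times$, $\mathbf m\in\mathbb Z_{>0}^r$ and $\mu\in\Lambda_{n,r}(\mathbf m)$. Let $\widetilde{\mathcal I}^\mu$ be the right ideal of $\mathcal H_{n,r}$ generated by $\{T_i-q\mid s_i\in\mathfrak S_\mu\}$, and let $\mathcal I^\mu$ be the right ideal of $\mathcal H_{n,r}$ generated by $\{T_i-q\mid s_i\in\mathfrak S_\mu\}\cup\{L_j^{\langle c_j^\mu\rangle}\mid1\le j\le n\}$. (i) $\widetilde M^\mu\cong\mathcal H_{n,r}/\widetilde{\mathcal I}^\mu$ as right $\mathcal H_{n,r}$-modules. In particular, the set $\{T_i-q\mid s_i\in\mathfrak S_\mu\}$ gives defining relations of the cyclic right $\mathcal H_{n,r}$-module $\widetilde M^\mu=x_\mu\mathcal H_{n,r}$ (i.e. it generates the right ideal annihilating $x_\mu$). (ii) $M^\mu\cong\mathcal H_{n,r}/\mathcal I^\mu$ as right $\mathcal H_{n,r}$-modules. In particular, the set $\{T_i-q\mid s_i\in\mathfrak S_\mu\}\cup\{L_j^{\langle c_j^\mu\rangle}\mid1\le j\le n\}$ gives defining relations of the cyclic right $\mathcal H_{n,r}$-module $M^\mu=m_\mu\mathcal H_{n,r}$ (i.e. it generates the right ideal annihilating $m_\mu$).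
   Context: $\mathcal H_{n,r}$ is the Ariki-Koike algebra: the $R$-algebra generated by $T_0,\dots,T_{n-1}$ with relations $\prod_{k=0}^{r-1}(T_0-Q_k)=0$, $(T_i-q)(T_i+q^{-1})=0$ ($1\le i\le n-1$), $T_0T_1T_0T_1=T_1T_0T_1T_0$, $T_iT_{i+1}T_i=T_{i+1}T_iT_{i+1}$ ($1\le i\le n-2$), $T_iT_j=T_jT_i$ ($|i-j|>1$). For $1\le i\le n$, $1\le k\le r$: $L_i=T_{i-1}\cdots T_1T_0T_1\cdots T_{i-1}$ and $L_i^{\langle k\rangle}=T_{i-1}\cdots T_1(T_0-Q_0)(T_0-Q_1)\cdots(T_0-Q_{k-1})T_1\cdots T_{i-1}$. $\Lambda_{n,r}(\mathbf m)$ is the set of $\mu=(\mu^{(1)},\dots,\mu^{(r)})$ with $\mu^{(k)}\in\mathbb Z_{\ge0}^{m_k}$ and sum of all entries equal to $n$; by concatenation $\mu$ is regarded as a composition $(\mu_1,\dots,\mu_m)$ of $n$, $m=m_1+\dots+m_r$. $a_k^\mu=\sum_{j=1}^k|\mu^{(j)}|$ where $|\cdot|$ is the sum of entries, $a_0^\mu=0$; for $1\le j\le n$, $c_j^\mu=k$ if $a_{k-1}^\mu<j\le a_k^\mu$. $s_i=(i,i+1)$; $\mathfrak S_\mu\cong\mathfrak S_{\mu_1}\times\dots\times\mathfrak S_{\mu_m}$ is the Young subgroup of $\mathfrak S_n$; $T_w$ is the product of the $T_i$ along a reduced expression of $w\in\mathfrak S_n$ and $\ell$ is the length. $x_\mu=\sum_{w\in\mathfrak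 S_\mu}q^{\ell(w)}T_w$, $m_\mu=x_\mu\prod_{k=1}^{r-1}\prod_{i=1}^{a_k^\mu}(L_i-Q_k)$, $\widetilde M^\mu=x_\mu\mathcal H_{n,r}$, $M^\mu=m_\mu\mathcal H_{n,r}$. *)

(* Defs.v *)
From HB Require Import structures.
From mathcomp Require Import all_boot all_order all_fingroup all_algebra.
From mathcomp Require Import generic_quotient.
From mathcomp Require Import boolp classical_sets.

Set Implicit Arguments.
Unset Strict Implicit.
Unset Printing Implicit Defensive.

Import GRing.Theory.
Import ring_quotient.Quotient.
Local Open Scope ring_scope.
Local Open Scope quotient_scope.
Local Open Scope classical_set_scope.

(* A right A-module is a left module over the converse ring A^c; the right    *)
(* regular module is A^c^o, in which a acts by  a *: x = x * a (product in A). *)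

Definition right_ideal (A : pzRingType) (I : set A) : Prop :=
  [/\ I 0, forall x y, I x -> I y -> I (x + y) & forall x a, I x -> I (x * a)].

Record rideal (A : pzRingType) := RIdeal {
  rideal_set : set A;
  ridealP : right_ideal rideal_set
}.

Section RightModules.
Variables (A : pzRingType) (I : rideal A).

Definition rideal_pred : {pred A^c^o} := fun x => `[< rideal_set I x >].

Lemma rideal_pred_submod_closed : submod_closed rideal_pred.
Proof.
have [I0 ID IM] := ridealP I.
split=> [|a x y /asboolP Ix /asboolP Iy]; apply/asboolP => //.
by apply: ID => //; exact: IM.
Qed.

HB.instance Definition _ :=
  GRing.isSubmodClosed.Build A^c A^c^o rideal_pred rideal_pred_submod_closed.

Definition rideal_mod : Type := {x : A^c^o | x \in rideal_pred}.

HB.instance Definition _ := SubChoice.on rideal_mod.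
HB.instance Definition _ := [SubChoice_isSubLmodule of rideal_mod by <:].

Definition rquot : Type := {quot rideal_pred}.

HB.instance Definition _ := GRing.Zmodule.on rquot.
HB.instance Definition _ := EqQuotient.on rquot.

Definition rquot_scale (a : A^c) (u : rquot) : rquot :=
  \pi_rquot (a *: (repr u : A^c^o)).

Lemma pi_rquotE (x y : A^c^o) :
  \pi_rquot x = \pi_rquot y <-> (x - y) \in rideal_pred.
Proof.
by split=> [/eqP|?]; [|apply/eqP]; rewrite -idealrBE.
Qed.

Lemma rquot_scale_pi a (x : A^c^o) :
  rquot_scale a (\pi_rquot x) = \pi_rquot (a *: x).
Proof.
apply/pi_rquotE; rewrite -scalerBr rpredZ //.
by apply/pi_rquotE; rewrite reprK.
Qed.

Lemma pi_rquotD (x y : A^c^o) : \pi_rquot (x + y) = \pi_rquot x + \pi_rquot y.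
Proof. exact: pi_add. Qed.

Lemma rquot_scaleA a b v :
  rquot_scale a (rquot_scale b v) = rquot_scale (a * b) v.
Proof. by rewrite -[v]reprK !rquot_scale_pi ?reprK scalerA. Qed.

Lemma rquot_scale1 : left_id 1 rquot_scale.
Proof. by move=> v; rewrite -[v]reprK rquot_scale_pi scale1r. Qed.

Lemma rquot_scaleDr : right_distributive rquot_scale +%R.
Proof.
move=> a u v; rewrite -[u]reprK -[v]reprK -pi_rquotD !rquot_scale_pi.
by rewrite scalerDr pi_rquotD.
Qed.

Lemma rquot_scaleDl v : {morph rquot_scale^~ v : a b / a + b}.
Proof.
by move=> a b; rewrite -[v]reprK !rquot_scale_pi scalerDl pi_rquotD.
Qed.

HB.instance Definition _ := GRing.Zmodule_isLmodule.Build A^c rquot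
  rquot_scaleA rquot_scale1 rquot_scaleDr rquot_scaleDl.

End RightModules.

Lemma smallest_right_ideal (A : pzRingType) (G : set A) :
  right_ideal (smallest (@right_ideal A) G).
Proof.
split=> [J [[J0 _ _] _] //|x y Ix Iy J JG|x a Ix J JG].
- by case: (JG) => -[_ JD _] _; apply: JD; [exact: Ix | exact: Iy].
- by case: (JG) => -[_ _ JM] _; apply: JM; exact: Ix.
Qed.

Definition rideal_gen (A : pzRingType) (G : set A) : rideal A :=
  RIdeal (smallest_right_ideal G).

Lemma right_ideal_principal (A : pzRingType) (x : A) :
  right_ideal (range ( *%R x)).
Proof.
split=> [|_ _ [a _ <-] [b _ <-]|_ b [a _ <-]].
- by exists 0; rewrite ?mulr0.
- by exists (a + b); rewrite ?mulrDr.
- by exists (a * b); rewrite ?mulrA.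
Qed.

Definition rideal_principal (A : pzRingType) (x : A) : rideal A :=
  RIdeal (right_ideal_principal x).

(* The Ariki-Koike algebra with parameters q, Q_0, ..., Q_r.  The number of   *)
(* parameters Q_k is r.+1, so the level of the algebra is r.+1 (not r).       *)
(* It is built as the type of noncommutative polynomial expressions in the    *)
(* generators, modulo the congruence generated by the axioms of associative   *)
(* unital R-algebras and the defining relations.                              *)

Inductive ak_term (R : Type) (n : nat) : Type :=
| AKGen of 'I_n
| AKCst of R
| AKAdd of ak_term R n & ak_term R n
| AKMul of ak_term R n & ak_term R n.

Arguments AKGen {R n}.
Arguments AKCst {R n}.

HB.instance Definition _ R n := gen_eqMixin (ak_term R n).
HB.instance Definition _ R n := gen_choiceMixin (ak_term R n).

Declare Scope ak_scope.
Delimit Scope ak_scope with AK.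
Local Notation "x + y" := (AKAdd x y) : ak_scope.
Local Notation "x * y" := (AKMul x y) : ak_scope.
Local Notation "c %:K" := (AKCst c) (at level 1, format "c %:K") : ak_scope.

Section ArikiKoike.
Variables (R : comUnitRingType) (n r : nat) (q : R) (Q : 'I_r.+1 -> R).

Local Notation term := (ak_term R n).
Local Notation t := AKGen.
Implicit Types (x y z : term) (a b : R) (i j : 'I_n).

Inductive ak_rel : term -> term -> Prop :=
| AKcyclotomic i : i = 0%N :> nat ->
    ak_rel (\big[@AKMul R n/AKCst 1]_(k < r.+1) (t i + AKCst (- Q k)%R)%AK) (AKCst 0)
| AKquadratic i : (0 < i)%N ->
    ak_rel ((t i + AKCst (- q)%R) * (t i + AKCst q^-1%R))%AK (AKCst 0)
| AKbraid4 i j : i = 0%N :> nat -> j = 1%N :> nat ->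
    ak_rel (t i * (t j * (t i * t j)))%AK (t j * (t i * (t j * t i)))%AK
| AKbraid3 i j : (0 < i)%N -> j = i.+1 :> nat ->
    ak_rel (t i * (t j * t i))%AK (t j * (t i * t j))%AK
| AKcomm i j : (i.+1 < j)%N || (j.+1 < i)%N ->
    ak_rel (t i * t j)%AK (t j * t i)%AK.

Inductive ak_cong : term -> term -> Prop :=
| AKrel x y : ak_rel x y -> ak_cong x y
| AKrefl x : ak_cong x x
| AKsym x y : ak_cong x y -> ak_cong y x
| AKtrans x y z : ak_cong x y -> ak_cong y z -> ak_cong x z
| AKcongD x x' y y' :
    ak_cong x x' -> ak_cong y y' -> ak_cong (x + y)%AK (x' + y')%AK
| AKcongM x x' y y' :
    ak_cong x x' -> ak_cong y y' -> ak_cong (x * y)%AK (x' * y')%AK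
| AKaddA x y z : ak_cong (x + (y + z))%AK (x + y + z)%AK
| AKaddC x y : ak_cong (x + y)%AK (y + x)%AK
| AKadd0 x : ak_cong (0%:K + x)%AK x
| AKmulA x y z : ak_cong (x * (y * z))%AK (x * y * z)%AK
| AKmul1 x : ak_cong (1%:K * x)%AK x
| AKmul0 x : ak_cong (0%:K * x)%AK 0%:K%AK
| AKmulDl x y z : ak_cong ((x + y) * z)%AK (x * z + y * z)%AK
| AKmulDr x y z : ak_cong (x * (y + z))%AK (x * y + x * z)%AK
| AKcstD a b : ak_cong (AKCst (a + b)) (a%:K + b%:K)%AK
| AKcstM a b : ak_cong (AKCst (a * b)) (a%:K * b%:K)%AK
| AKcstC a x : ak_cong (a%:K * x)%AK (x * a%:K)%AK.

Definition ak_congb : rel term := fun x y => `[< ak_cong x y >].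

Lemma ak_congb_equiv : equiv_class_of ak_congb.
Proof.
split=> [x|x y|y x z]; first exact/asboolP/AKrefl.
  by apply/asboolP/asboolP; exact: AKsym.
by move=> /asboolP xy /asboolP yz; apply/asboolP; exact: AKtrans xy yz.
Qed.

Canonical ak_congb_rel := EquivRelPack ak_congb_equiv.
Canonical ak_congb_enc := defaultEncModRel ak_congb.

Definition ariki_koike : Type := {eq_quot ak_congb}.

HB.instance Definition _ : EqQuotient term ak_congb ariki_koike :=
  EqQuotient.on ariki_koike.
HB.instance Definition _ := Choice.on ariki_koike.

Local Notation H := ariki_koike.
Local Notation cl x := (\pi_H x).

Lemma ak_clP x y : cl x = cl y <-> ak_cong x y.
Proof. by split=> [/eqquotP/asboolP|h]; [|apply/eqquotP/asboolP]. Qed.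

Lemma ak_repr x : ak_cong (repr (cl x)) x.
Proof. by apply/ak_clP; rewrite reprK. Qed.

Definition ak_add (u v : H) : H := cl (repr u + repr v)%AK.
Definition ak_mul (u v : H) : H := cl (repr u * repr v)%AK.
Definition ak_opp (u : H) : H := cl (AKCst (-1)%R * repr u)%AK.
Definition ak_scale (a : R) (u : H) : H := cl (a%:K * repr u)%AK.

Lemma ak_addE x y : ak_add (cl x) (cl y) = cl (x + y)%AK.
Proof. by apply/ak_clP/AKcongD; exact: ak_repr. Qed.
Lemma ak_mulE x y : ak_mul (cl x) (cl y) = cl (x * y)%AK.
Proof. by apply/ak_clP/AKcongM; exact: ak_repr. Qed.
Lemma ak_oppE x : ak_opp (cl x) = cl (AKCst (-1)%R * x)%AK.
Proof. by apply/ak_clP/AKcongM; [exact: AKrefl | exact: ak_repr]. Qed.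
Lemma ak_scaleE a x : ak_scale a (cl x) = cl (a%:K * x)%AK.
Proof. by apply/ak_clP/AKcongM; [exact: AKrefl | exact: ak_repr]. Qed.
Let E := (ak_addE, ak_mulE, ak_oppE, ak_scaleE).

Lemma ak_addA : associative ak_add.
Proof.
move=> u v w; rewrite -[u]reprK -[v]reprK -[w]reprK !E ?reprK.
exact/ak_clP/AKaddA.
Qed.
Lemma ak_addC : commutative ak_add.
Proof. by move=> u v; rewrite -[u]reprK -[v]reprK !E ?reprK; exact/ak_clP/AKaddC. Qed.
Lemma ak_add0 : left_id (cl (AKCst 0)) ak_add.
Proof. by move=> u; rewrite -[u]reprK !E; exact/ak_clP/AKadd0. Qed.
Lemma ak_mulA : associative ak_mul.
Proof.
move=> u v w; rewrite -[u]reprK -[v]reprK -[w]reprK !E ?reprK.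
exact/ak_clP/AKmulA.
Qed.
Lemma ak_mul1l : left_id (cl (AKCst 1)) ak_mul.
Proof. by move=> u; rewrite -[u]reprK !E; exact/ak_clP/AKmul1. Qed.
Lemma ak_mul1r : right_id (cl (AKCst 1)) ak_mul.
Proof.
move=> u; rewrite -[u]reprK !E; apply/ak_clP.
by apply: AKtrans (AKmul1 _); apply: AKsym; exact: AKcstC.
Qed.
Lemma ak_mulDl : left_distributive ak_mul ak_add.
Proof.
move=> u v w; rewrite -[u]reprK -[v]reprK -[w]reprK !E ?reprK.
exact/ak_clP/AKmulDl.
Qed.
Lemma ak_mulDr : right_distributive ak_mul ak_add.
Proof.
move=> u v w; rewrite -[u]reprK -[v]reprK -[w]reprK !E ?reprK.
exact/ak_clP/AKmulDr.
Qed.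

Lemma ak_addN : left_inverse (cl (AKCst 0)) ak_opp ak_add.
Proof.
move=> u; rewrite -[u]reprK; set x := repr u; rewrite ak_oppE ak_addE; apply/ak_clP.
apply: AKtrans (AKmul0 x); rewrite -(addNr (1 : R)).
apply: AKsym; apply: (AKtrans (AKcongM (AKcstD _ _) (AKrefl x))).
apply: (AKtrans (AKmulDl _ _ _)).
by apply: AKcongD; [exact: AKrefl | exact: AKmul1].
Qed.

HB.instance Definition _ :=
  GRing.isZmodule.Build H ak_addA ak_addC ak_add0 ak_addN.

Definition ak_eval (A : algType R) (g : 'I_n -> A) : term -> A :=
  fix ev x := match x with
  | AKGen i => g i
  | AKCst a => a%:A
  | AKAdd x y => ev x + ev y
  | AKMul x y => ev x * ev y
  end.

Definition ak_relations (A : algType R) (g : 'I_n -> A) : Prop :=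
  [/\ forall i, i = 0%N :> nat -> \prod_(k < r.+1) (g i - (Q k)%:A) = 0,
      forall i, (0 < i)%N -> (g i - q%:A) * (g i + q^-1%:A) = 0,
      forall i j, i = 0%N :> nat -> j = 1%N :> nat ->
        g i * g j * g i * g j = g j * g i * g j * g i,
      forall i j, (0 < i)%N -> j = i.+1 :> nat ->
        g i * g j * g i = g j * g i * g j
    & forall i j, (i.+1 < j)%N || (j.+1 < i)%N -> g i * g j = g j * g i].

Lemma ak_eval_cong (A : algType R) (g : 'I_n -> A) :
  ak_relations g -> forall x y, ak_cong x y -> ak_eval g x = ak_eval g y.
Proof.
case=> Hc Hq H4 H3 H2 x y; elim=> {x y}.
- move=> x y [i i0|i i0|i j i0 j1|i j i0 ij|i j ij] /=.
  + rewrite (big_morph (ak_eval g) (id1 := 1) (op1 := *%R)) //=;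
      last by rewrite scale1r.
    rewrite scale0r -(Hc i i0); apply: eq_bigr => k _.
    by rewrite scaleNr.
  + by rewrite scale0r scaleNr Hq.
  + by rewrite !mulrA H4.
  + by rewrite !mulrA (H3 i j).
  + exact: H2.
- by [].
- by move=> x y _ ->.
- by move=> x y z _ -> _ ->.
- by move=> x x' y y' /= _ -> _ ->.
- by move=> x x' y y' /= _ -> _ ->.
- by move=> x y z /=; rewrite addrA.
- by move=> x y /=; rewrite addrC.
- by move=> x /=; rewrite scale0r add0r.
- by move=> x y z /=; rewrite mulrA.
- by move=> x /=; rewrite scale1r mul1r.
- by move=> x /=; rewrite scale0r mul0r.
- by move=> x y z /=; rewrite mulrDl.
- by move=> x y z /=; rewrite mulrDr.
- by move=> a b /=; rewrite scalerDl.
- by move=> a b /=; rewrite -scalerAl mul1r scalerA.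
- by move=> a x /=; rewrite -scalerAl -scalerAr mul1r mulr1.
Qed.

(* The character T_0 |-> Q_0, T_i |-> q (i > 0) shows that the algebra is not *)
(* the zero ring, as required by algType.                                     *)
Lemma ak_oner_neq0 : cl (AKCst 1) != 0 :> H.
Proof.
apply/eqP => /ak_clP.
pose g i : R^o := if i == 0%N :> nat then Q ord0 else q.
have hg : ak_relations g.
  split=> [i i0|i i0|i j i0 j1|i j i0 ij|i j _]; rewrite /g.
  - by rewrite big_ord_recl i0 /= -[_ *: 1]/(_ * 1) mulr1 subrr mul0r.
  - by rewrite gtn_eqF // -[q *: 1]/(_ * 1) mulr1 subrr mul0r.
  - rewrite i0 j1 /=; set a : R := Q ord0.
    by rewrite -[_ * _ * _]mulrA -mulrA mulrC !mulrA.
  - by rewrite ij gtn_eqF.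
  - exact: (@mulrC R).
move/(ak_eval_cong hg) => /= /eqP; rewrite scale1r scale0r.
by apply/negP; exact: oner_neq0.
Qed.

HB.instance Definition _ := GRing.Zmodule_isNzRing.Build H
  ak_mulA ak_mul1l ak_mul1r ak_mulDl ak_mulDr ak_oner_neq0.

Lemma ak_scaleA a b u : ak_scale a (ak_scale b u) = ak_scale (a * b) u.
Proof.
rewrite -[u]reprK !E ?reprK; apply/ak_clP/(AKtrans (AKmulA _ _ _))/AKcongM.
  by apply: AKsym; exact: AKcstM.
exact: AKrefl.
Qed.
Lemma ak_scale1 : left_id 1 ak_scale.
Proof. by move=> u; rewrite -[u]reprK !E; exact/ak_clP/AKmul1. Qed.
Lemma ak_scaleDr : right_distributive ak_scale ak_add.
Proof.
by move=> a u v; rewrite -[u]reprK -[v]reprK !E ?reprK; exact/ak_clP/AKmulDr.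
Qed.
Lemma ak_scaleDl u : {morph ak_scale^~ u : a b / a + b >-> ak_add a b}.
Proof.
move=> a b; rewrite -[u]reprK !E ?reprK; apply/ak_clP.
exact: AKtrans (AKcongM (AKcstD a b) (AKrefl _)) (AKmulDl _ _ _).
Qed.

HB.instance Definition _ := GRing.Zmodule_isLmodule.Build R H
  ak_scaleA ak_scale1 ak_scaleDr ak_scaleDl.

Lemma ak_scaleAl a (u v : H) :
  ak_scale a (ak_mul u v) = ak_mul (ak_scale a u) v.
Proof. by rewrite -[u]reprK -[v]reprK !E ?reprK; exact/ak_clP/AKmulA. Qed.
Lemma ak_scaleAr a (u v : H) :
  ak_scale a (ak_mul u v) = ak_mul u (ak_scale a v).
Proof.
rewrite -[u]reprK -[v]reprK !E ?reprK; apply/ak_clP.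
apply: (AKtrans (AKmulA _ _ _)).
apply: (AKtrans (AKcongM (AKcstC _ _) (AKrefl _))).
by apply: AKsym; exact: AKmulA.
Qed.

HB.instance Definition _ := GRing.Lmodule_isLalgebra.Build R H ak_scaleAl.
HB.instance Definition _ := GRing.Lalgebra_isAlgebra.Build R H ak_scaleAr.

Definition ak_gen (i : 'I_n) : H := cl (AKGen i).

Lemma ak_clE x : cl x = ak_eval ak_gen x.
Proof.
elim: x => [i //|a|x IHx y IHy|x IHx y IHy] /=.
- rewrite -[_ *: _]/(ak_scale _ (cl _)) !E ?reprK; apply/ak_clP.
  by have := AKcstM a 1; rewrite mulr1.
- by rewrite -IHx -IHy -[RHS]/(ak_add _ _) !E ?reprK.
- by rewrite -IHx -IHy -[RHS]/(ak_mul _ _) !E ?reprK.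
Qed.

Lemma ak_gen_relations : ak_relations ak_gen.
Proof.
have eqH x y : ak_rel x y -> ak_eval ak_gen x = ak_eval ak_gen y.
  by move=> xy; rewrite -!ak_clE; exact/ak_clP/AKrel.
split.
- move=> i /AKcyclotomic/eqH /=; rewrite scale0r => <-.
  rewrite (big_morph (ak_eval ak_gen) (id1 := 1) (op1 := *%R)) //=;
    last by rewrite scale1r.
  by apply: eq_bigr => k _; rewrite scaleNr.
- by move=> i /AKquadratic/eqH /=; rewrite scale0r scaleNr.
- by move=> i j i0 /(AKbraid4 i0)/eqH /=; rewrite !mulrA.
- by move=> i j i0 /(AKbraid3 i0)/eqH /=; rewrite !mulrA.
- by move=> i j /AKcomm/eqH.
Qed.

Lemma ak_universal (A : algType R) (g : 'I_n -> A) : ak_relations g ->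
  exists f : {lrmorphism H -> A}, forall i, f (ak_gen i) = g i.
Proof.
move=> hg; pose f (u : H) : A := ak_eval g (repr u).
have fE x : f (cl x) = ak_eval g x by apply: ak_eval_cong => //; exact: ak_repr.
have f_lin : linear f.
  move=> a u v; rewrite -[u]reprK -[v]reprK.
  rewrite -[_ *: _]/(ak_scale _ _) -[_ + _]/(ak_add _ _) !E ?reprK !fE /=.
  by rewrite -scalerAl mul1r.
have f_mul : monoid_morphism f.
  split=> [|u v]; first by rewrite -[1]/(cl (AKCst 1)) fE /= scale1r.
  by rewrite -[u]reprK -[v]reprK -[_ * _]/(ak_mul _ _) !E ?reprK !fE.
pose fL := GRing.isLinear.Build R H A *:%R f f_lin.
pose fM := GRing.isMonoidMorphism.Build H A f f_mul.
pose F : {lrmorphism H -> A} := HB.pack f fL fM.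
by exists F => i; rewrite /= /F /= fE.
Qed.

Lemma ak_universal_unique (A : algType R) (f f' : {lrmorphism H -> A}) :
  (forall i, f (ak_gen i) = f' (ak_gen i)) -> f =1 f'.
Proof.
move=> ff' u; rewrite -[u]reprK ak_clE.
elim: (repr u) => [i|a|x IHx y IHy|x IHx y IHy] /=.
- exact: ff'.
- by rewrite !linearZ /= !rmorph1.
- by rewrite !rmorphD /= IHx IHy.
- by rewrite !rmorphM /= IHx IHy.
Qed.

(* T_i for a natural index; only the indices i < n are meaningful. *)
Definition akT (i : nat) : H := oapp ak_gen 0 (insub i).

(* L_i, with i numbered from 1 to n as usual.                                 *)
Definition akL (i : nat) : H :=
  \prod_(j <- rev (index_iota 1 i)) akT j * akT 0 * \prod_(1 <= j < i) akT j.

(* L_i^<k>, with 1 <= i <= n and 1 <= k <= r.+1; it involves Q_0, ..., Q_{k-1}. *)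
Definition akLk (i k : nat) : H :=
  \prod_(j <- rev (index_iota 1 i)) akT j
  * \prod_(l < r.+1 | (l < k)%N) (akT 0 - (Q l)%:A)
  * \prod_(1 <= j < i) akT j.

End ArikiKoike.

Section Symmetric.
Variable n : nat.

(* For 0 < i < n, the transposition of the 1-based points i and i+1, i.e.     *)
(* of the 0-based points i-1 and i.  (For i = 0 the value is irrelevant.)     *)
Definition simple_refl (i : 'I_n) : 'S_n := tperm (ord_pred i) i.

Definition expression (w : 'S_n) (s : seq 'I_n) : bool :=
  all (fun i : 'I_n => (0 < i)%N) s && (\prod_(i <- s) simple_refl i == w)%g.

Definition reduced (w : 'S_n) (s : seq 'I_n) : Prop :=
  expression w s /\ forall s', expression w s' -> (size s <= size s')%N.

Definition reduced_word (w : 'S_n) : seq 'I_n := xget [::] [set s | reduced w s].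

Definition perm_length (w : 'S_n) : nat := size (reduced_word w).

Lemma expressionM (v w : 'S_n) s s' :
  expression v s -> expression w s' -> expression (v * w) (s ++ s').
Proof.
rewrite /expression all_cat big_cat /= => /andP[-> /eqP->] /andP[-> /eqP->].
exact: eqxx.
Qed.

Lemma expression_tperm (x y : 'I_n) :
  (x < y)%N -> exists s, expression (tperm x y) s.
Proof.
case: y => y yn /=; elim: y yn => // y IHy yn.
set yy := Ordinal yn; have yn' : (y < n)%N by exact: ltnW.
have hy : expression (simple_refl yy) [:: yy].
  by rewrite /expression /= big_seq1 eqxx.
have py : ord_pred yy = Ordinal yn'.
  by apply: val_inj; rewrite /= modnDr modn_small.
rewrite ltnS leq_eqVlt => /orP[/eqP xy|xy].
  exists [:: yy]; suff -> : x = ord_pred yy by [].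
  by rewrite py; exact: val_inj.
have [s hs] := IHy yn' xy.
exists ([:: yy] ++ s ++ [:: yy]).
suff -> : tperm x yy = (simple_refl yy * (tperm x (Ordinal yn') * simple_refl yy))%g.
  by do 2?apply: expressionM.
rewrite /simple_refl py -{1}(tpermV (Ordinal yn') yy) -conjgE tpermJ tpermL tpermD //.
  by rewrite -val_eqE /= gtn_eqF.
by rewrite -val_eqE /= gtn_eqF // ltnS ltnW.
Qed.

Lemma expression_exists (w : 'S_n) : exists s, expression w s.
Proof.
have [ts -> _] := prod_tpermP w; elim: ts => [|[x y] ts [s hs]].
  by exists [::]; rewrite /expression !big_nil eqxx.
suff [s' hs'] : exists s', expression (tperm x y) s'.
  by exists (s' ++ s); rewrite big_cons; exact: expressionM.
have [xy|yx|/val_inj->] := ltngtP x y; first exact: expression_tperm.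
  by rewrite tpermC; exact: expression_tperm.
by exists [::]; rewrite /expression big_nil tperm1 eqxx.
Qed.

Lemma reduced_wordP (w : 'S_n) : reduced w (reduced_word w).
Proof.
suff [s hs] : exists s, reduced w s by exact: (xgetI _ hs).
have /ex_minnP[k /asboolP[s hs ks] kmin] :
    exists k, `[< exists2 s, expression w s & size s = k >].
  by have [s hs] := expression_exists w; exists (size s); apply/asboolP; exists s.
exists s; split=> // s' hs'; rewrite ks; apply: kmin.
by apply/asboolP; exists s'.
Qed.

End Symmetric.

(* The components of mu are numbered from 0: mu k stands for mu^(k+1).        *)
Section Multicompositions.
Variables (n r : nat) (m : 'I_r -> nat) (mu : forall k : 'I_r, (m k).-tuple nat).

Definition is_multicomposition : Prop := (\sum_(k < r) sumn (mu k))%N = n.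

Definition mc_concat : seq nat := flatten [seq tval (mu k) | k <- enum 'I_r].

Definition mc_a (k : nat) : nat := (\sum_(j < r | (j < k)%N) sumn (mu j))%N.

(* For 1 <= j <= n, the unique k with a_{k-1} < j <= a_k (see mc_cP).         *)
Definition mc_c (j : nat) : nat :=
  find (fun k => (mc_a k.-1 < j)%N && (j <= mc_a k)%N) (iota 0 r.+1).

Lemma mc_cP (j k : nat) : is_multicomposition -> (1 <= j <= n)%N ->
  mc_c j = k <-> [/\ (1 <= k <= r)%N, (mc_a k.-1 < j)%N & (j <= mc_a k)%N].
Proof.
move=> hmu /andP[j0 jn].
have amono : {homo mc_a : k1 k2 / (k1 <= k2)%N}.
  move=> k1 k2 k12; rewrite /mc_a big_mkcond [leqRHS]big_mkcond leq_sum // => i _.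
  by case: ifP => // /leq_trans/(_ k12)->.
have ar : mc_a r = n by rewrite -hmu; apply: eq_bigl => i; rewrite ltn_ord.
pose P k := (mc_a k.-1 < j)%N && (j <= mc_a k)%N.
have P0 : P 0%N = false by rewrite /P /= ltnNge andbC andbN.
have Puniq k1 k2 : P k1 -> P k2 -> k1 = k2.
  wlog k12 : k1 k2 / (k1 <= k2)%N.
    by move=> wl; have [/wl|/ltnW/wl h /[swap]/h/[apply]] := leqP k1 k2.
  move=> /andP[_ h1] /andP[h2 _]; apply/eqP; rewrite eqn_leq k12 leqNgt.
  apply/negP => k12'; move: h2; rewrite ltnNge (leq_trans h1) // amono //.
  by case: k2 k12' {k12}.
have Pex : exists k, (k <= r)%N && P k.
  have [|k0 jk0 k0min] := @ex_minnP (fun k => j <= mc_a k)%N.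
    by exists r; rewrite ar.
  exists k0; rewrite /P jk0 andbT k0min ?ar //=.
  case: k0 jk0 k0min => [|k0 _ k0min] /=; last first.
    by rewrite ltnNge; apply/negP => /k0min; rewrite ltnn.
  by rewrite /mc_a big_pred0 // leqn0 => /eqP j00; rewrite j00 in j0.
have hP : has P (iota 0 r.+1).
  by have [k0 /andP[k0r Pk0]] := Pex; apply/hasP; exists k0; rewrite ?mem_iota.
have := hP; rewrite has_find size_iota -/(mc_c j) => cr.
have Pc : P (mc_c j) by have := nth_find 0%N hP; rewrite nth_iota.
split=> [<-|[_ h1 h2]]; last by apply: Puniq => //; rewrite /P h1.
by case/andP: (Pc) => -> ->; split=> //; case: (mc_c j) Pc cr; rewrite ?P0.
Qed.

(* The symmetric group acts on {0, ..., n-1} instead of {1, ..., n}.          *)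
(* reshape_index sh p is the index of the block containing position p when    *)
(* 0, 1, 2, ... are cut into consecutive blocks of sizes given by sh.         *)
Definition young : {set 'S_n} :=
  [set w : 'S_n | [forall p : 'I_n,
     reshape_index mc_concat (w p) == reshape_index mc_concat p]].

End Multicompositions.

Section PermutationModules.
Variables (R : comUnitRingType) (n r : nat) (q : R) (Q : 'I_r.+1 -> R).
Variables (m : 'I_r.+1 -> nat) (mu : forall k : 'I_r.+1, (m k).-tuple nat).

Local Notation H := (ariki_koike n q Q).
Local Notation T := (akT n q Q).
Local Notation L := (akL n q Q).

Definition ak_Tw (w : 'S_n) : H := \prod_(i <- reduced_word w) T i.

Definition ak_x : H :=
  \sum_(w in young n mu) q ^+ perm_length w *: ak_Tw w.

Definition ak_m : H :=
  ak_x * \prod_(k < r.+1 | (0 < k)%N)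
           \prod_(1 <= i < (mc_a mu k).+1) (L i - (Q k)%:A).

(* T_i - q for the indices 1 <= i <= n-1 such that s_i lies in S_mu. *)
Definition young_relators : set H :=
  [set h | exists i : 'I_n,
     [/\ (0 < i)%N, simple_refl i \in young n mu & h = T i - q%:A]].

Definition jucys_murphy_relators : set H :=
  [set akLk n q Q j (mc_c mu j) | j in [set j | (1 <= j <= n)%N]].

End PermutationModules.

Arguments ak_Tw {R} n {r} q Q w.
Arguments ak_x {R} n {r} q Q {m} mu.
Arguments ak_m {R} n {r} q Q {m} mu.
Arguments young_relators {R} n {r} q Q {m} mu _.
Arguments jucys_murphy_relators {R} n {r} q Q {m} mu _.

(* Main.v *)
Require Import Defs.
From HB Require Import structures.
From mathcomp Require Import all_boot all_order all_fingroup all_algebra.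
From mathcomp Require Import generic_quotient.
From mathcomp Require Import boolp classical_sets.
From mathcomp Require Import zify ring.

Set Implicit Arguments.
Unset Strict Implicit.
Unset Printing Implicit Defensive.

Import GRing.Theory.
Local Open Scope ring_scope.
Local Open Scope classical_set_scope.

(** The annihilators in (i) and (ii) are instances of one theorem,
    [annihilator_parabolic].  Let c_1 <= ... <= c_n be bounds between 1 and the level
    r.+1 which are constant on the blocks of mu, and let u be the product of the
    L_j - Q_k over all j, k with c_j <= k.  Then the right ideal annihilating x_mu u is
    generated by the T_i - q with s_i in the Young subgroup and by the elements
    L_j^<c_j>.  If all c_j equal the level then u = 1 and L_j^<c_j> = 0 by the
    cyclotomic relation, which gives (i); the bounds c_j^mu give (ii).  The
    isomorphisms follow, as a cyclic right module is the quotient of the algebra by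
    the annihilator of its generator ([rquot_annihilator_iso]).

    The generators annihilate x_mu u since T_i commutes with polynomials symmetric in
    L_i, L_(i+1), and since u contains the factors completing the polynomial in T_0
    inside L_j^<c_j> to the cyclotomic relation.  For the converse, let J be the right
    ideal that they generate.

    Spanning ([rideal_LTmon]).  Modulo J the algebra is spanned by the L^f T_d with
    f_j < c_j and d the shortest element of its coset of the Young subgroup.  The bounds
    on f come from the fact that the two-sided ideal generated by
    p = (T_0 - Q_0) ... (T_0 - Q_(k-1)) in the subalgebra on T_0, ..., T_(m-1) is, as a
    right ideal, generated by the T_(j-1) ... T_1 p with j <= m ([Kgen_mull]).
    Moving T_i through a monomial in the L_j permutes exponents and creates only
    monomials in the same box ([T_Lmon]), so letters of the Young subgroup on the left
    of T_w can be replaced by q.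

    Independence ([rebuild_hact]).  The algebra acts from the left on the polynomials
    in X_1, ..., X_n with all exponents at most r, with coefficients in the regular
    representation of the finite Hecke algebra: T_i acts by a Demazure-Lusztig operator
    for i > 0, and T_0 by multiplication by X_1 modulo the polynomial with roots Q_k.
    The one relation that is not inherited from the affine Hecke algebra is the braid
    relation of length four ([opT_braid4]).  As L_j acts by X_j until an exponent
    overflows, L^f T_d maps the vacuum vector to the monomial X^f at d.

    Conclusion.  Let h' be a combination of these L^f T_d with x_mu u h' = 0, and G its
    value at the vacuum vector.  On G no exponent overflows under u, so that u acts as
    the product of the X_j - Q_k.  These are injective on power series because the
    Q_k are invertible.  Finally x_mu is injective on series supported on the
    elements d: if w0 is the longest element of the Young subgroup, then the coefficient
    of x_mu F at w0 d is a power of q times a coefficient of F at d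
    ([parabolic_sum_inj]).  Hence G = 0, and h' = 0. *)

(** * Reduced words of permutations *)

Section Words.
Variable n : nat.
Implicit Types (w u v : 'S_n) (i j x y : 'I_n) (s t : seq 'I_n).

Lemma ord_predE i : (0 < i)%N -> ord_pred i = i.-1 :> nat.
Proof.
case: i => [[|i] // lt_in] _ /=.
by rewrite modnDr modn_small // ltnW.
Qed.

Lemma ord_pred_neq i : (0 < i)%N -> ord_pred i != i.
Proof. by move=> i0; apply/eqP => /(congr1 (@nat_of_ord n)); rewrite ord_predE //; lia. Qed.

Lemma simple_reflE i x : (0 < i)%N ->
  simple_refl i x = (if x == i.-1 :> nat then i : nat
                     else if x == i :> nat then i.-1 else x) :> nat.
Proof.
move=> i0; rewrite /simple_refl -(ord_predE i0) !val_eqE.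
case: eqP => [->|/eqP xp]; first by rewrite tpermL.
case: eqP => [->|/eqP xi]; first by rewrite tpermR.
by rewrite tpermD // eq_sym.
Qed.

Lemma simple_refl_pred i : simple_refl i (ord_pred i) = i.
Proof. exact: tpermL. Qed.

Lemma simple_refl_self i : simple_refl i i = ord_pred i.
Proof. exact: tpermR. Qed.

Lemma simple_reflK i : (simple_refl i * simple_refl i = 1)%g.
Proof. exact: tperm2. Qed.

Lemma mul_simple_reflK i w : (simple_refl i * (simple_refl i * w) = w)%g.
Proof. by rewrite mulgA simple_reflK mul1g. Qed.

Lemma expression_cons i s w :
  expression (simple_refl i * w) (i :: s) = (0 < i)%N && expression w s.
Proof.
rewrite /expression /= big_cons -andbA; congr (_ && (_ && _)).
by apply/eqP/eqP => [/mulgI|->].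
Qed.

(** Strong exchange: follow the positions [x < y] through the letters; the
    letter at which their order is reversed is the reflection in disguise. *)
Lemma exchange s w x y : expression w s -> (x < y)%N -> (w y < w x)%N ->
  exists2 s', expression (tperm x y * w) s' & size s = (size s').+1.
Proof.
elim: s w x y => [|i s IHs] w x y.
  by move=> /andP[_ /eqP <-] xy; rewrite big_nil !perm1; lia.
have [w' {w}->] : exists w', w = (simple_refl i * w')%g.
  by exists (simple_refl i * w)%g; rewrite mul_simple_reflK.
rewrite expression_cons => /andP[i0 ws] xy; rewrite !permM.
have [ixy|] := ltnP (simple_refl i x) (simple_refl i y).
  move=> /(IHs _ _ _ ws ixy)[s' ws' sE]; exists (i :: s'); last by rewrite /= sE.
  by rewrite mulgA (conjgC (tperm x y)) tpermJ -mulgA expression_cons i0.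
rewrite leq_eqVlt => /orP[/eqP/val_inj/perm_inj yx|yx _].
  by rewrite yx ltnn in xy.
have [xE yE] : x = ord_pred i /\ y = i.
  by split; apply: ord_inj; move: yx xy; rewrite ?ord_predE // !simple_reflE //;
    do ![case: eqP => //=]; lia.
by exists s => //; rewrite xE yE -/(simple_refl i) mul_simple_reflK.
Qed.

Lemma perm_length_le w s : expression w s -> (perm_length w <= size s)%N.
Proof. by move=> ws; have [_] := reduced_wordP w; apply. Qed.

Lemma reducedE w s : reduced w s <-> expression w s /\ size s = perm_length w.
Proof.
split=> [[ws smin]|[ws sz]]; split=> //.
  apply/eqP; rewrite eqn_leq perm_length_le // andbT.
  by apply: smin; have [] := reduced_wordP w.
by move=> s' /perm_length_le; rewrite sz.
Qed.

Definition left_descent w i := (w i < w (ord_pred i))%N.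

Lemma left_descent_mul w i : (0 < i)%N ->
  left_descent (simple_refl i * w) i = ~~ left_descent w i.
Proof.
move=> i0; rewrite /left_descent !permM simple_refl_pred simple_refl_self.
by rewrite -leqNgt [RHS]leq_eqVlt (inj_eq (@ord_inj _)) (inj_eq perm_inj) (negPf (ord_pred_neq i0)).
Qed.

Lemma perm_length_descent w i : (0 < i)%N -> left_descent w i ->
  perm_length w = (perm_length (simple_refl i * w)).+1.
Proof.
move=> i0 wi; have /reducedE[ws sz] := reduced_wordP w.
have [s' ws' ssz] : exists2 s', expression (simple_refl i * w) s' &
    size (reduced_word w) = (size s').+1.
  by apply: exchange ws _ wi; rewrite ord_predE //; lia.
apply/eqP; rewrite eqn_leq -{2}sz; apply/andP; split.
  have /reducedE[us usz] := reduced_wordP (simple_refl i * w).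
  rewrite -usz -[in X in (X <= _)%N](mul_simple_reflK i w).
  by rewrite (@perm_length_le _ (i :: _)) // expression_cons i0.
by rewrite ssz ltnS perm_length_le.
Qed.

Lemma perm_length_ascent w i : (0 < i)%N -> ~~ left_descent w i ->
  perm_length (simple_refl i * w) = (perm_length w).+1.
Proof.
move=> i0; rewrite -left_descent_mul // => /(perm_length_descent i0) ->.
by rewrite mul_simple_reflK.
Qed.

Lemma reduced_cons w i s : reduced w (i :: s) <->
  [/\ (0 < i)%N, left_descent w i & reduced (simple_refl i * w) s].
Proof.
rewrite reducedE -{1}(mul_simple_reflK i w) expression_cons /=.
split=> [[/andP[i0 ws] sz]|[i0 wi /reducedE[-> ->]]]; last first.
  by rewrite i0 -(perm_length_descent i0 wi).
case: (boolP (left_descent w i)) => wi.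
  split=> //; apply/reducedE; split=> //.
  by move: sz; rewrite (perm_length_descent i0 wi) => -[].
have := perm_length_le ws; rewrite perm_length_ascent //; lia.
Qed.

Lemma reduced_length0 w s : reduced w s -> perm_length w = 0%N -> s = [::].
Proof. by move/reducedE=> [_ <-] /size0nil. Qed.

Lemma perm_length1 : perm_length (1 : 'S_n) = 0%N.
Proof.
by apply/eqP; rewrite -leqn0 (@perm_length_le _ [::]) // /expression big_nil /=.
Qed.

Lemma reduced_nil : reduced (1 : 'S_n) [::].
Proof. by apply/reducedE; rewrite perm_length1 /expression big_nil eqxx. Qed.

Lemma perm_length_eq0 w : perm_length w = 0%N -> w = 1%g.
Proof.
move=> w0; have := reduced_wordP w => wr.
by have [/andP[_ /eqP<-] _] := wr; rewrite (reduced_length0 wr w0) big_nil.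
Qed.

Lemma left_descent_exists w : w != 1%g ->
  exists2 i : 'I_n, (0 < i)%N & left_descent w i.
Proof.
have := reduced_wordP w; case: (reduced_word w) => [[/andP[_ /eqP <-] _]|i s].
  by rewrite big_nil eqxx.
by move=> /reduced_cons[i0 wi _] _; exists i.
Qed.

Lemma simple_refl_braid i j : (0 < i)%N -> j = i.+1 :> nat ->
  (simple_refl i * simple_refl j * simple_refl i =
   simple_refl j * simple_refl i * simple_refl j)%g.
Proof.
move=> i0 ij; have j0 : (0 < j)%N by rewrite ij.
apply/permP => x; apply: ord_inj; rewrite !permM !simple_reflE //.
by do ![case: eqP => //=]; lia.
Qed.

Lemma simple_refl_comm i j : (0 < i)%N -> (i.+1 < j)%N ->
  (simple_refl i * simple_refl j = simple_refl j * simple_refl i)%g.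
Proof.
move=> i0 ij; have j0 : (0 < j)%N by lia.
apply/permP => x; apply: ord_inj; rewrite !permM !simple_reflE //.
by do ![case: eqP => //=]; lia.
Qed.

(** Whether or not s_i and s_j commute, [w] has a reduced word that starts with
    the longest element of the subgroup generated by s_i and s_j.  Both given words
    are compared with it, by [IH] below their first letters and by one braid
    relation. *)
Lemma reduced_prod_two_letters (A : pzSemiRingType) (T : 'I_n -> A) k w i j s t :
    (forall i j, (0 < i)%N -> j = i.+1 :> nat -> T i * T j * T i = T j * T i * T j) ->
    (forall i j, (i.+1 < j)%N || (j.+1 < i)%N -> T i * T j = T j * T i) ->
    (forall s w, (size s <= k)%N -> forall t, reduced w s -> reduced w t ->
       \prod_(i <- s) T i = \prod_(i <- t) T i) ->
    (i < j)%N -> (size s <= k)%N -> (size t <= k)%N ->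
    reduced w (i :: s) -> reduced w (j :: t) ->
  T i * \prod_(l <- s) T l = T j * \prod_(l <- t) T l.
Proof.
move=> T3 T2 IH ij sk tk /reduced_cons[i0 wi rs] /reduced_cons[j0 wj rt].
have [ji|ji] := eqVneq (j : nat) i.+1.
  have jpE : ord_pred j = i by apply: ord_inj; rewrite ord_predE // ji.
  have sij : simple_refl i j = j.
    by apply: ord_inj; rewrite simple_reflE //; do ![case: eqP => //=]; lia.
  have sjp : simple_refl j (ord_pred i) = ord_pred i.
    by apply: ord_inj; rewrite simple_reflE // ord_predE //; do ![case: eqP => //=]; lia.
  have sji : simple_refl j i = j by rewrite -jpE simple_refl_pred.
  have sjj : simple_refl j j = i by rewrite simple_refl_self.
  have E : (simple_refl i * (simple_refl j * (simple_refl i * w)) =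
            simple_refl j * (simple_refl i * (simple_refl j * w)))%g.
    by rewrite !mulgA; congr (_ * _)%g; rewrite simple_refl_braid.
  set z := reduced_word (simple_refl i * (simple_refl j * (simple_refl i * w))).
  have rz := reduced_wordP (simple_refl i * (simple_refl j * (simple_refl i * w))).
  rewrite /left_descent jpE in wj; rewrite /left_descent in wi.
  have rs' : reduced (simple_refl i * w) [:: j, i & z].
    apply/reduced_cons; split=> //.
      by rewrite /left_descent !permM jpE sij simple_refl_self (ltn_trans wj).
    apply/reduced_cons; split=> //.
    by rewrite /left_descent !permM sji sij sjp simple_refl_pred.
  have rt' : reduced (simple_refl j * w) [:: i, j & z].
    apply/reduced_cons; split=> //.
      by rewrite /left_descent !permM sji sjp (ltn_trans wj).
    apply/reduced_cons; split; rewrite -?E //.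
    by rewrite /left_descent !permM jpE sij sjj simple_refl_self sjp.
  rewrite (IH _ _ sk _ rs rs') (IH _ _ tk _ rt rt') !big_cons !mulrA.
  by rewrite (T3 i j).
have ij' : (i.+1 < j)%N by rewrite ltn_neqAle eq_sym ji.
have [sij sijp] : simple_refl i j = j /\ simple_refl i (ord_pred j) = ord_pred j.
  by split; apply: ord_inj; rewrite simple_reflE ?ord_predE //;
    do ![case: eqP => //=]; lia.
have [sji sjip] : simple_refl j i = i /\ simple_refl j (ord_pred i) = ord_pred i.
  by split; apply: ord_inj; rewrite simple_reflE ?ord_predE //;
    do ![case: eqP => //=]; lia.
set z := reduced_word (simple_refl i * (simple_refl j * w)).
have rz := reduced_wordP (simple_refl i * (simple_refl j * w)).
have E : (simple_refl j * (simple_refl i * w) =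
          simple_refl i * (simple_refl j * w))%g.
  by rewrite !mulgA; congr (_ * _)%g; rewrite (@simple_refl_comm i j).
have rs' : reduced (simple_refl i * w) (j :: z).
  apply/reduced_cons; split; rewrite ?E //.
  by rewrite /left_descent !permM sij sijp.
have rt' : reduced (simple_refl j * w) (i :: z).
  apply/reduced_cons; split=> //.
  by rewrite /left_descent !permM sji sjip.
rewrite (IH _ _ sk _ rs rs') (IH _ _ tk _ rt rt') !big_cons !mulrA.
by rewrite (T2 i j) // ij'.
Qed.

(** Matsumoto's theorem, by induction on the length: equal first letters cancel,
    and different ones are treated by [reduced_prod_two_letters]. *)
Lemma reduced_prod_uniq (A : pzSemiRingType) (T : 'I_n -> A) :
    (forall i j, (0 < i)%N -> j = i.+1 :> nat -> T i * T j * T i = T j * T i * T j) ->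
    (forall i j, (i.+1 < j)%N || (j.+1 < i)%N -> T i * T j = T j * T i) ->
  forall w s t, reduced w s -> reduced w t ->
    \prod_(i <- s) T i = \prod_(i <- t) T i.
Proof.
move=> T3 T2 w s; move: {2}(size s) (leqnn (size s)) => k.
elim: k s w => [|k IHk] s w sk t ws wt.
  move: sk; rewrite leqn0 => /eqP sk; move: (ws); rewrite reducedE => -[_ sz].
  by rewrite (reduced_length0 wt) ?(size0nil sk) // -sz.
case: s sk ws => [_ ws|i s sk].
  by move: (ws); rewrite reducedE => -[_ /esym/(reduced_length0 wt) ->].
case: t wt => [wt ws|j t wt ws].
  by move: (wt); rewrite reducedE => -[_ /esym/(reduced_length0 ws)].
rewrite !big_cons; move: (wt) (ws) => /reduced_cons[j0 wj wt'] /reduced_cons[i0 wi ws'].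
have tk : (size t <= k)%N.
  by move: ws wt sk => /reducedE[_ /= sz] /reducedE[_ /=]; lia.
have [ij|ij|/ord_inj ij] := ltngtP i j.
- exact: (reduced_prod_two_letters T3 T2 IHk ij sk tk ws wt).
- exact/esym/(reduced_prod_two_letters T3 T2 IHk ij tk sk wt ws).
- by rewrite -ij in wt' *; congr (_ * _); apply: IHk ws' wt'.
Qed.

End Words.

(** * Spans, and the Bernstein relation for monomials *)

Section Span.
Variables (R : pzRingType) (V : lmodType R).
Implicit Types (B : set V) (v : V).

Inductive lspan B : V -> Prop :=
| lspan0 : lspan B 0
| lspan_cons a b v : B b -> lspan B v -> lspan B (a *: b + v).

Lemma lspan_gen B b : B b -> lspan B b.
Proof. by move=> Bb; rewrite -[b]scale1r -[_ *: b]addr0; constructor; [|constructor]. Qed.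

Lemma lspanD B u v : lspan B u -> lspan B v -> lspan B (u + v).
Proof.
move=> Bu Bv; elim: Bu => [|a b w Bb _ IH]; first by rewrite add0r.
by rewrite -addrA; constructor.
Qed.

Lemma lspanZ B a v : lspan B v -> lspan B (a *: v).
Proof.
elim=> [|a' b w Bb _ IH]; first by rewrite scaler0; constructor.
by rewrite scalerDr scalerA; constructor.
Qed.

Lemma lspanN B v : lspan B v -> lspan B (- v).
Proof. by rewrite -scaleN1r; exact: lspanZ. Qed.

Lemma lspanB B u v : lspan B u -> lspan B v -> lspan B (u - v).
Proof. by move=> Bu Bv; apply: lspanD => //; exact: lspanN. Qed.

Lemma lspan_trans B B' v :
  (forall b, B b -> lspan B' b) -> lspan B v -> lspan B' v.
Proof.
move=> BB'; elim=> [|a b w Bb _ IH]; first by constructor.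
by apply: lspanD => //; apply/lspanZ/BB'.
Qed.

Lemma lspanS B B' v : B `<=` B' -> lspan B v -> lspan B' v.
Proof. by move=> BB'; apply: lspan_trans => b /BB' ?; exact: lspan_gen. Qed.

Lemma lspanU B B' v : lspan (B `|` B') v ->
  exists u w, [/\ lspan B u, lspan B' w & v = u + w].
Proof.
elim=> [|a b w [] Bb _ [x [y [Bx By ->]]]].
- by exists 0, 0; rewrite addr0; split=> //; constructor.
- by exists (a *: b + x), y; rewrite addrA; split=> //; constructor.
- by exists x, (a *: b + y); rewrite addrCA; split=> //; constructor.
Qed.

End Span.

Section SpanAlg.
Variables (R : comNzRingType) (A : algType R).
Implicit Types (B : set A) (x v : A).

Lemma lspan_mull B B' x v : (forall b, B b -> lspan B' (x * b)) ->
  lspan B v -> lspan B' (x * v).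
Proof.
move=> BB'; elim=> [|a b w Bb _ IH]; first by rewrite mulr0; constructor.
by rewrite mulrDr -scalerAr; apply: lspanD => //; apply/lspanZ/BB'.
Qed.

Lemma lspan_mulr B B' x v : (forall b, B b -> lspan B' (b * x)) ->
  lspan B v -> lspan B' (v * x).
Proof.
move=> BB'; elim=> [|a b w Bb _ IH]; first by rewrite mul0r; constructor.
by rewrite mulrDl -scalerAl; apply: lspanD => //; apply/lspanZ/BB'.
Qed.

Section Intertwine.
Variables (c : R) (x y t : A).
Hypotheses (xy : x * y = y * x).
Hypotheses (tx : t * x = y * t - c *: y) (ty : t * y = x * t + c *: y).

Definition monomials_le m : set A :=
  [set z | exists k l, [/\ (k <= m)%N, (l <= m)%N & z = x ^+ k * y ^+ l]].

Let yxX k l : y ^+ l * x ^+ k = x ^+ k * y ^+ l.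
Proof. by apply/esym/commrX/commr_sym/commrX. Qed.

Let mon_gen m k l : (k <= m)%N -> (l <= m)%N ->
  lspan (monomials_le m) (x ^+ k * y ^+ l).
Proof. by move=> km lm; apply: lspan_gen; exists k, l. Qed.

Let intertwine_x a : lspan (monomials_le a) (t * x ^+ a - y ^+ a * t).
Proof.
elim: a => [|a IHa]; first by rewrite !expr0 mulr1 mul1r subrr; constructor.
rewrite !exprS mulrA tx mulrBl -scalerAl addrAC -!mulrA -mulrBr.
apply: lspanB; last first.
  by apply: lspanZ; rewrite -[X in X * _](expr1 y) yxX; exact: mon_gen.
apply: lspan_mull IHa => _ [k [l [kb lb ->]]].
by rewrite mulrA -[X in X * _ * _](expr1 y) yxX -mulrA -exprD; apply: mon_gen; lia.
Qed.

Let intertwine_y b : lspan (monomials_le b) (t * y ^+ b - x ^+ b * t).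
Proof.
elim: b => [|b IHb]; first by rewrite !expr0 mulr1 mul1r subrr; constructor.
rewrite !exprS mulrA ty mulrDl -scalerAl addrAC -!mulrA -mulrBr.
apply: lspanD; last first.
  by apply: lspanZ; rewrite -exprS -[_ ^+ _]mul1r -(expr0 x); exact: mon_gen.
apply: lspan_mull IHb => _ [k [l [kb lb ->]]].
by rewrite mulrA -exprS; apply: mon_gen; lia.
Qed.

(** The Bernstein relation for monomials.  Since [x * y] commutes with [t], only
    pure powers need to be considered. *)
Lemma intertwine_monomial a b : lspan (monomials_le (maxn a b))
  (t * (x ^+ a * y ^+ b) - x ^+ b * y ^+ a * t).
Proof.
have txy : t * (x * y) = x * y * t.
  by rewrite mulrA tx mulrBl -(mulrA y t) ty mulrDr -scalerAl -scalerAr addrK xy mulrA.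
have mE k l : x ^+ k.+1 * y ^+ l.+1 = x * y * (x ^+ k * y ^+ l).
  have := yxX k 1; rewrite expr1 => yx.
  by rewrite !exprS -!mulrA (mulrA y) yx -!mulrA.
elim: a b => [|a IHa] [|b].
- by rewrite !expr0 !mulr1 mul1r subrr; constructor.
- by rewrite max0n expr0 mul1r mulr1; exact: intertwine_y.
- by rewrite maxn0 expr0 mulr1 mul1r; exact: intertwine_x.
rewrite maxnSS !mE mulrA txy -!(mulrA (x * y)) -mulrBr.
apply: lspan_mull (IHa b) => _ [k [l [kb lb ->]]].
by rewrite -mE; apply: mon_gen.
Qed.

End Intertwine.
End SpanAlg.

(** * Jucys-Murphy elements *)

Section JucysMurphy.
Variables (R : comUnitRingType) (n r : nat) (q : R) (Q : 'I_r.+1 -> R).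

Local Notation H := (ariki_koike n q Q).
Local Notation T := (akT n q Q).
Local Notation L := (akL n q Q).
Local Notation comm := GRing.comm.
Let c : R := q - q^-1.

Lemma akT_gen (i : 'I_n) : T i = ak_gen q Q i.
Proof. by rewrite /akT valK. Qed.

Lemma akT_out i : (n <= i)%N -> T i = 0.
Proof. by move=> ni; rewrite /akT insubF // ltnNge ni. Qed.

Lemma akT_comm i j : (i.+1 < j)%N -> comm (T i) (T j).
Proof.
move=> ij; have [lt_jn|/akT_out->] := ltnP j n; last exact: commr0.
have lt_in : (i < n)%N by lia.
have [_ _ _ _ H2] := ak_gen_relations n q Q.
by have := H2 (Ordinal lt_in) (Ordinal lt_jn); rewrite -!akT_gen /= ij => /(_ isT).
Qed.

Lemma akT_braid3 i : (0 < i)%N -> T i * T i.+1 * T i = T i.+1 * T i * T i.+1.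
Proof.
move=> i0; have [lt_jn|/akT_out->] := ltnP i.+1 n; last by rewrite !(mul0r, mulr0).
have lt_in : (i < n)%N by lia.
have [_ _ _ H3 _] := ak_gen_relations n q Q.
by have := H3 (Ordinal lt_in) (Ordinal lt_jn); rewrite -!akT_gen /= => ->.
Qed.

Lemma akT_braid4 : T 0 * T 1 * T 0 * T 1 = T 1 * T 0 * T 1 * T 0.
Proof.
have [lt_jn|/akT_out->] := ltnP 1 n; last by rewrite !(mul0r, mulr0).
have lt_in : (0 < n)%N by lia.
have [_ _ H4 _ _] := ak_gen_relations n q Q.
by have := H4 (Ordinal lt_in) (Ordinal lt_jn); rewrite -!akT_gen /= => ->.
Qed.

Lemma akT_cyclotomic : (0 < n)%N -> \prod_(k < r.+1) (T 0 - (Q k)%:A) = 0.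
Proof.
move=> lt_in; have [H0 _ _ _ _] := ak_gen_relations n q Q.
by have := H0 (Ordinal lt_in) (erefl _); rewrite -!akT_gen /= => ->.
Qed.

Definition Tdown j : H := \prod_(l <- rev (index_iota 1 j)) T l.
Definition Tup j : H := \prod_(1 <= l < j) T l.

Lemma Tdown1 : Tdown 1 = 1. Proof. by rewrite /Tdown big_nil. Qed.
Lemma Tup1 : Tup 1 = 1. Proof. by rewrite /Tup big_nil. Qed.

Lemma TdownS j : (0 < j)%N -> Tdown j.+1 = T j * Tdown j.
Proof.
case: j => // j _; rewrite /Tdown (_ : index_iota 1 j.+2 = rcons (index_iota 1 j.+1) j.+1).
  by rewrite rev_rcons big_cons.
by rewrite /index_iota !subn1 !succnK -[in iota _ j.+1](addn1 j) iotaD cats1.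
Qed.

Lemma TupS j : (0 < j)%N -> Tup j.+1 = Tup j * T j.
Proof. by move=> j0; rewrite /Tup big_nat_recr. Qed.

Lemma akLE i : L i = Tdown i * T 0 * Tup i. Proof. by []. Qed.

Lemma akL1 : L 1 = T 0.
Proof. by rewrite akLE Tdown1 Tup1 mul1r mulr1. Qed.

Lemma akLS i : (0 < i)%N -> L i.+1 = T i * L i * T i.
Proof.
by move=> i0; rewrite !akLE TdownS // TupS // !mulrA.
Qed.

Lemma comm_T_L i j : (0 < i)%N -> (0 < j)%N -> i != j -> i.+1 != j ->
  comm (T i) (L j).
Proof.
move=> i0; have [ij|ij] := ltnP i j; last first.
  case: j ij => // j ij _ neq_ij _; have {neq_ij}ij: (j.+1 < i)%N by lia.
  elim: j ij => [|j IHj] ij; first by rewrite akL1; exact/commr_sym/akT_comm.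
  have TiTj : comm (T i) (T j.+1) by exact/commr_sym/akT_comm.
  by rewrite akLS //; apply: commrM => //; apply: commrM => //; apply: IHj; lia.
move=> _ _ neq_ij; have {neq_ij ij}[k ->] : exists k, j = (i + k.+2)%N.
  by exists (j - i.+2)%N; lia.
elim: k => [|k IHk]; last first.
  have TiTj : comm (T i) (T (i + k.+2)) by apply: akT_comm; lia.
  by rewrite addnS akLS ?addnS //; do 2?apply: commrM; rewrite -?addnS.
have LT : L i * T i.+1 = T i.+1 * L i.
  case: i i0 => // i _; elim: i {-1}i.+2 (ltnSn i.+1) => [|i IHi] k ik.
    by rewrite akL1; exact: akT_comm.
  have TT : comm (T i.+1) (T k) by apply: akT_comm; lia.
  apply/commr_sym; rewrite akLS //.
  by do 2?apply: commrM; try exact/commr_sym; apply/commr_sym/IHi; lia.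
rewrite addn2 !akLS // /comm.
have {LT} := LT; have {i0} := akT_braid3 i0; move: (T i) (T i.+1) (L i) => a b l ba lb.
transitivity (a * b * a * l * a * b); first by rewrite !mulrA.
rewrite ba -(mulrA (b * a)) -lb; transitivity (b * a * l * (b * a * b)).
  by rewrite !mulrA.
by rewrite -ba !mulrA.
Qed.

Lemma comm_T0_L j : (0 < j)%N -> comm (T 0) (L j).
Proof.
case: j => // -[|j] _; first by rewrite akL1.
elim: j => [|j IHj]; first by rewrite akLS // akL1 /comm !mulrA akT_braid4.
have TT : comm (T 0) (T j.+2) by exact: akT_comm.
by rewrite akLS //; do 2?apply: commrM.
Qed.

Lemma comm_L i j : (0 < i)%N -> (0 < j)%N -> comm (L i) (L j).
Proof.
wlog ij : i j / (i < j)%N.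
  move=> wl i0 j0; have [ij|ij|->//] := ltngtP i j; first exact: wl.
  exact/commr_sym/wl.
move=> + j0; case: i ij => // i ij _; elim: i ij => [|i IHi] ij.
  by rewrite akL1; exact: comm_T0_L.
have TL : comm (T i.+1) (L j) by apply: comm_T_L; lia.
apply/commr_sym; rewrite akLS //.
by do 2?apply: commrM; try exact/commr_sym; apply/commr_sym/IHi/ltnW.
Qed.

Definition Lmon m (f : nat -> nat) : H := \prod_(j < m) L j.+1 ^+ f j.

(** Since [Lmon] attaches the exponent [f j] to L_(j+1), the positions [i.-1] and
    [i] are those of L_i and L_(i+1). *)
Definition upd (f : nat -> nat) i a b := fun k =>
  if k == i.-1 then a else if k == i then b else f k.

Lemma upd_id f i : upd f i (f i.-1) (f i) = f.
Proof. by apply/funext => k; rewrite /upd; do 2?case: eqP => [->|]. Qed.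

Lemma Lmon_updE m i f : (0 < i < m)%N -> exists2 x, comm (T i) x &
  forall a b, Lmon m (upd f i a b) = x * (L i ^+ a * L i.+1 ^+ b).
Proof.
case: i => // i /= im.
pose x1 := \prod_(0 <= j < i) L j.+1 ^+ f j.
pose x2 := \prod_(i.+2 <= j < m) L j.+1 ^+ f j.
exists (x1 * x2).
  by apply: commrM; rewrite /x1 /x2 big_nat;
    apply: commr_prod => j jb; apply/commrX/comm_T_L; lia.
move=> a b; rewrite /Lmon -(big_mkord xpredT (fun j => L j.+1 ^+ upd f i.+1 a b j)).
rewrite (@big_cat_nat _ _ _ i) //=; last lia.
rewrite (@big_cat_nat _ _ _ i.+2 i) //=; last lia.
rewrite [\prod_(i <= _ < i.+2) _]big_ltn // big_nat1 (_ : \prod_(0 <= _ < i) _ = x1); last first.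
  by apply: eq_big_nat => j jb; rewrite /upd /= !ifF //; lia.
rewrite (_ : \prod_(i.+2 <= _ < m) _ = x2); last first.
  by apply: eq_big_nat => j jb; rewrite /upd /= !ifF //; lia.
have -> : upd f i.+1 a b i = a by rewrite /upd eqxx.
have -> : upd f i.+1 a b i.+1 = b by rewrite /upd eqxx ifF //; lia.
rewrite -[RHS]mulrA; congr (_ * _).
change (comm (L i.+1 ^+ a * L i.+2 ^+ b) x2).
rewrite /x2 big_nat; apply: commr_prod => j jb; apply/commrX/commr_sym.
by apply: commrM; apply/commrX/comm_L; lia.
Qed.

Hypothesis q_unit : q \is a GRing.unit.

Lemma akT_quad i : (0 < i < n)%N -> T i * T i = 1 + c *: T i.
Proof.
move=> /andP[i0 lt_in]; have [_ Hq _ _ _] := ak_gen_relations n q Q.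
have := Hq (Ordinal lt_in) i0; rewrite -akT_gen /= => /eqP.
rewrite mulrDr mulrBl mulrBl -!scalerAl -!scalerAr !mul1r mulr1 scalerA.
rewrite divrr // scale1r addr_eq0 subr_eq opprB => /eqP ->.
by rewrite /c scalerBl -addrA (addrC (- _)).
Qed.

Lemma T_L_self i : (0 < i < n)%N -> T i * L i = L i.+1 * T i - c *: L i.+1.
Proof.
move=> i0n; have /andP[i0 _] := i0n; rewrite akLS // -mulrA akT_quad //.
by rewrite mulrDr mulr1 -scalerAr addrK.
Qed.

Lemma T_L_succ i : (0 < i < n)%N -> T i * L i.+1 = L i * T i + c *: L i.+1.
Proof.
move=> i0n; have /andP[i0 _] := i0n; rewrite akLS // !mulrA akT_quad //.
by rewrite !mulrDl mul1r -!scalerAl.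
Qed.

(** Moving [T i] through a monomial exchanges two exponents, up to monomials
    whose exponents do not exceed the larger one: this is why boxes of exponents
    are stable. *)
Lemma T_Lmon m i f : (0 < i < m)%N -> (m <= n)%N ->
  lspan [set z | exists a b, [/\ (a <= maxn (f i.-1) (f i))%N,
      (b <= maxn (f i.-1) (f i))%N & z = Lmon m (upd f i a b)]]
    (T i * Lmon m f - Lmon m (upd f i (f i) (f i.-1)) * T i).
Proof.
move=> i0m mn; have [x Tx xE] := Lmon_updE f i0m.
have i0n : (0 < i < n)%N by lia.
have := xE (f i.-1) (f i); rewrite upd_id => ->.
rewrite xE (mulrA (T i)) Tx -!(mulrA x) -mulrBr.
have LL : L i * L i.+1 = L i.+1 * L i by apply: comm_L; lia.
have := intertwine_monomial LL (T_L_self i0n) (T_L_succ i0n) (f i.-1) (f i).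
apply: lspan_mull => _ [k [l [kb lb ->]]].
by apply: lspan_gen; exists k, l; rewrite xE.
Qed.

End JucysMurphy.

(** * Spanning the algebra modulo a right ideal *)

Section Spanning.
Variables (R : comUnitRingType) (n r : nat) (q : R) (Q : 'I_r.+1 -> R).

Local Notation H := (ariki_koike n q Q).
Local Notation T := (akT n q Q).
Local Notation L := (akL n q Q).
Local Notation Tdown := (Tdown n q Q).
Local Notation Tup := (Tup n q Q).
Local Notation Lmon := (Lmon n q Q).
Local Notation comm := GRing.comm.

Definition pQ k : H := \prod_(l < r.+1 | (l < k)%N) (T 0 - (Q l)%:A).

Lemma akLkE j k : akLk n q Q j k = Tdown j * pQ k * Tup j.
Proof. by []. Qed.

Lemma comm_pQ k x : comm x (T 0) -> comm x (pQ k).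
Proof.
move=> xT; apply: commr_prod => l _; apply: commrB => //.
by rewrite /comm -scalerAl -scalerAr mul1r mulr1.
Qed.

Lemma pQS k (lt_kr : (k < r.+1)%N) :
  pQ k.+1 = pQ k * (T 0 - (Q (Ordinal lt_kr))%:A).
Proof.
pose F l := T 0 - (oapp Q 0 (insub l))%:A : H.
have pE j : (j <= r.+1)%N -> pQ j = \prod_(l < j) F l.
  move=> jr; rewrite (big_ord_widen _ F jr); apply: eq_bigr => l _.
  by rewrite /F valK.
by rewrite !pE ?(ltnW lt_kr) // big_ord_recr /= {2}/F insubT.
Qed.

Lemma pQ0 : pQ 0 = 1.
Proof. by apply: big1. Qed.

Lemma pQ_dvd k k' : (k <= k' <= r.+1)%N -> exists x, pQ k' = pQ k * x.
Proof.
move=> /andP[]; elim: k' => [|k' IHk].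
  by rewrite leqn0 => /eqP-> _; exists 1; rewrite mulr1.
rewrite leq_eqVlt => /orP[/eqP->|]; first by exists 1; rewrite mulr1.
rewrite ltnS => kk' k'r; have [x E] := IHk kk' (ltnW k'r).
by exists (x * (T 0 - (Q (Ordinal k'r))%:A)); rewrite mulrA -E pQS.
Qed.

Lemma pQ_top : (0 < n)%N -> pQ r.+1 = 0.
Proof.
move=> n0; rewrite -(akT_cyclotomic q Q n0); apply: eq_bigl => l.
by rewrite ltn_ord.
Qed.

Lemma pQ_lead k : (k <= r.+1)%N ->
  lspan [set z | exists2 l, (l < k)%N & z = T 0 ^+ l] (T 0 ^+ k - pQ k).
Proof.
elim: k => [|k IHk] kr; first by rewrite pQ0 subrr; constructor.
have {IHk}IH := IHk (ltnW kr).
rewrite exprSr pQS mulrBr opprB addrCA -mulrBl addrC.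
apply: lspanD.
  by apply: lspan_mulr IH => _ [l lk ->]; apply: lspan_gen; exists l.+1; rewrite -?exprSr.
rewrite -scalerAr mulr1; apply: lspanZ.
rewrite -[pQ k](subKr (T 0 ^+ k)); apply: lspanB.
  by apply: lspan_gen; exists k.
by apply: lspanS IH => _ [l lk ->]; exists l => //; exact: ltnW.
Qed.

Lemma T_Tdown_gt i j : (0 < j < i)%N -> comm (T i) (Tdown j).
Proof.
case: j => // j /=; elim: j => [|j IHj] ji.
  by rewrite (_ : Tdown 1 = 1) ?Tdown1 //; exact: commr1.
rewrite TdownS //; apply: commrM; last by apply: IHj; exact: ltnW.
exact/commr_sym/akT_comm.
Qed.

Lemma T_Tdown_lt i j : (0 < i)%N -> (i.+1 < j)%N ->
  T i * Tdown j = Tdown j * T i.+1.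
Proof.
move=> i0 ij; have {ij}[k ->] : exists k, j = (i + k.+2)%N.
  by exists (j - i.+2)%N; lia.
elim: k => [|k IHk].
  rewrite addn2 !TdownS // !mulrA akT_braid3 // -[LHS]mulrA -[RHS]mulrA.
  by congr (_ * _); apply: T_Tdown_gt; rewrite i0 /=.
rewrite (addnS i) TdownS; last lia.
have TT : comm (T i) (T (i + k.+2)) by apply: akT_comm; lia.
by rewrite mulrA TT -!mulrA IHk.
Qed.

Lemma Tdown_factor j : (1 < j)%N -> exists2 x, comm x (T 0) & Tdown j = x * T 1.
Proof.
case: j => // -[|j] // _; elim: j => [|j [x x0 xE]].
  by exists 1; [exact/commr_sym/commr1 | rewrite TdownS // Tdown1 mulr1 mul1r].
exists (T j.+2 * x); last by rewrite TdownS // xE mulrA.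
by apply/commr_sym/commrM; [exact: akT_comm | exact: commr_sym].
Qed.

(** Generators of the right ideal that the relation of degree [k] in T_0 produces
    inside the subalgebra on [T 0], ..., [T m.-1]; see [Kgen_mull]. *)
Definition Kgen m k : set H :=
  [set z | exists j h, (0 < j <= m)%N /\ z = Tdown j * pQ k * h].

Hypothesis q_unit : q \is a GRing.unit.
Let c : R := q - q^-1.

(** The two-sided ideal of the subalgebra on [T 0], ..., [T m.-1] generated by
    [pQ k] is already generated as a right ideal by the [Tdown j * pQ k].  The
    letters T_i with i positive are handled by the braid and quadratic relations,
    and T_0 by
      T_0 T_1 p = T_1 p L_2 - c L_2 p
    since L_2 commutes with T_0, hence with the polynomial p in T_0. *)
Lemma Kgen_mull m k i z : (i < m)%N -> (m <= n)%N -> Kgen m k z ->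
  lspan (Kgen m k) (T i * z).
Proof.
move=> im mn [j [h [jm ->]]].
have Kg j' x : (0 < j' <= m)%N -> lspan (Kgen m k) (Tdown j' * pQ k * x).
  by move=> j'm; apply: lspan_gen; exists j', x.
have [i0|i0] := posnP i; last first.
  have [ij|ij|ij] := ltngtP i j; last first.
  - by rewrite ij !mulrA -TdownS; [apply: Kg; lia | lia].
  - rewrite !mulrA T_Tdown_gt; last lia.
    rewrite -(mulrA (Tdown j)) comm_pQ; last by apply/commr_sym/akT_comm; lia.
    by rewrite mulrA -mulrA; exact: Kg.
  have [ji|ji] := eqVneq j i.+1.
    rewrite ji TdownS // !mulrA akT_quad //; last lia.
    rewrite !mulrDl mul1r -!scalerAl -TdownS //.
    by apply: lspanD; [apply: Kg; lia | apply/lspanZ/Kg; lia].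
  rewrite !mulrA T_Tdown_lt; try lia.
  rewrite -(mulrA (Tdown j)) comm_pQ; last by apply/commr_sym/akT_comm; lia.
  by rewrite mulrA -mulrA; exact: Kg.
rewrite i0; have [j1|j1] := leqP j 1.
  have -> : j = 1%N by lia.
  rewrite Tdown1 mul1r mulrA (comm_pQ _ (commr_refl _)) -mulrA.
  by have := @Kg 1%N (T 0 * h); rewrite Tdown1 mul1r; apply; lia.
have [x x0 xE] := Tdown_factor j1.
have L2 : comm (L 2) (pQ k) by apply/comm_pQ/commr_sym/comm_T0_L.
have L2E : L 2 = T 1 * T 0 * T 1 by rewrite akLS // akL1.
have E : T 0 * T 1 * pQ k = T 1 * pQ k * L 2 - c *: (L 2 * pQ k).
  rewrite -(mulrA (T 1)) -L2 (mulrA (T 1)) {1}L2E !mulrA akT_quad //; last lia.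
  by rewrite !mulrDl mul1r -!scalerAl L2E addrK.
move: (L 2) L2 E {L2E} => l2 L2 E.
have -> : T 0 * (Tdown j * pQ k * h) =
    Tdown j * pQ k * (l2 * h) - c *: (Tdown 1 * pQ k * (x * l2 * h)).
  have -> : T 0 * (Tdown j * pQ k * h) = x * (T 0 * T 1 * pQ k) * h.
    by rewrite xE !mulrA x0.
  rewrite E mulrBr mulrBl -scalerAr -scalerAl xE Tdown1 mul1r !mulrA.
  by rewrite -(mulrA x l2) L2 mulrA (comm_pQ k x0).
by apply: lspanB; [exact: Kg | apply/lspanZ/Kg; lia].
Qed.

Definition Mon m (g : nat -> nat) : set H :=
  [set z | exists f s, [/\ forall j, (j < m)%N -> (f j < g j)%N,
     all (fun i => 0 < i < m)%N s & z = Lmon m f * \prod_(i <- s) T i]].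

Lemma T0X_Lmon m f k : (0 < m)%N ->
  T 0 ^+ k * Lmon m f = Lmon m (fun j => if j == 0%N then (k + f 0)%N else f j).
Proof.
case: m => // m _; rewrite /Lmon !big_ord_recl /= akL1 mulrA -exprD.
by congr (_ * _); apply: eq_bigr => j _.
Qed.

(** The span is stable under left multiplication: T_0 raises the exponent of L_1,
    and [pQ k] reduces T_0^k to lower powers; T_i for positive i exchanges two
    exponents, which is harmless as the bound [k] is the same for all of them. *)
Lemma word_Kgen_Mon m k s : (m <= n)%N -> (0 < k <= r.+1)%N ->
  all (fun i => i < m)%N s ->
  lspan (Kgen m k `|` Mon m (fun=> k)) (\prod_(i <- s) T i).
Proof.
move=> mn /andP[k0 kr]; elim: s => [_|i s IHs /= /andP[im sm]].
  apply: lspan_gen; right; exists (fun=> 0%N), [::]; split=> //.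
  by rewrite !big_nil mulr1 /Lmon big1 // => j _.
rewrite big_cons; apply: lspan_mull (IHs sm) => b [Kb|[f [t [fk tm ->{b}]]]].
  by apply: lspanS (Kgen_mull im mn Kb); exact: subsetUl.
have [i0|i0] := posnP i.
  have m0 : (0 < m)%N by lia.
  rewrite i0 mulrA -[T 0]expr1 T0X_Lmon // add1n.
  have [fk'|kf] := ltnP (f 0%N).+1 k.
    apply: lspan_gen; right; exists (fun j => if j == 0%N then (f 0%N).+1 else f j), t.
    by split=> // j jm; case: eqP => // _; exact: fk.
  have <- : k = (f 0%N).+1 by have := fk _ m0; lia.
  pose f0 j := if j == 0%N then 0%N else f j.
  have -> : Lmon m (fun j => if j == 0%N then k else f j) = T 0 ^+ k * Lmon m f0.
    rewrite T0X_Lmon //; congr (Lmon m _).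
    by apply/funext => -[|j] //=; rewrite /f0 addn0.
  rewrite -mulrA; set X := _ * \prod_(_ <- t) _.
  rewrite -[T 0 ^+ k](subrK (pQ k)) mulrDl; apply: lspanD; last first.
    by apply: lspan_gen; left; exists 1%N, X; rewrite Tdown1 mul1r m0.
  apply: lspan_mulr (pQ_lead kr) => _ [l lk ->].
  rewrite /X mulrA T0X_Lmon //; apply: lspan_gen; right.
  exists (fun j => if j == 0%N then (l + f0 0%N)%N else f0 j), t; split=> //.
  by case=> [|j] jm; rewrite /f0 /= ?addn0 //; exact: fk.
have i0m : (0 < i < m)%N by lia.
have box a b : (a <= maxn (f i.-1) (f i))%N -> (b <= maxn (f i.-1) (f i))%N ->
    forall j, (j < m)%N -> (upd f i a b j < k)%N.
  have := fk i im; have := fk i.-1 ltac:(lia).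
  move=> f1 f2 ak bk j jm; rewrite /upd; have := fk _ jm.
  by do 2?case: eqP => _; lia.
rewrite mulrA -[T i * _](subrK (Lmon m (upd f i (f i) (f i.-1)) * T i)) mulrDl.
apply: lspanD; last first.
  apply: lspan_gen; right; exists (upd f i (f i) (f i.-1)), (i :: t); split.
  - by apply: box; lia.
  - by rewrite /= i0m.
  - by rewrite big_cons mulrA.
apply: lspan_mulr (T_Lmon _ q_unit f i0m mn) => _ [a [b [ab bb ->]]].
by apply: lspan_gen; right; exists (upd f i a b), t; split=> //; exact: box.
Qed.

Definition words m : set H :=
  [set z | exists2 s, all (fun i => i < m)%N s & z = \prod_(i <- s) T i].

Lemma words_mul m x y : words m x -> words m y -> words m (x * y).
Proof.
by move=> [s sm ->] [t tm ->]; exists (s ++ t); rewrite ?all_cat ?sm ?big_cat.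
Qed.

Lemma words_L m j : (0 < j <= m)%N -> words m (L j).
Proof.
have wT i : (i < m)%N -> words m (T i).
  by move=> im; exists [:: i]; rewrite /= ?im ?big_seq1.
case: j => // j /=; elim: j => [|j IHj] jm; first by rewrite akL1; exact: wT.
by rewrite akLS //; do 2?apply: words_mul; try exact: wT; apply/IHj/ltnW.
Qed.

Lemma words_Lmon m f : words m (Lmon m f).
Proof.
apply: (big_ind (words m)); [by exists [::]; rewrite ?big_nil|exact: words_mul|].
move=> j _; elim: (f j) => [|k IHk]; first by exists [::]; rewrite ?big_nil.
by rewrite exprS; apply: words_mul => //; apply: words_L; rewrite ltn_ord.
Qed.

Lemma words_span h : lspan (words n) h.
Proof.
rewrite -[h]reprK ak_clE; elim: (repr h) => [i|a|x IHx y IHy|x IHx y IHy] /=.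
- by apply: lspan_gen; exists [:: val i]; rewrite /= ?ltn_ord ?big_seq1 ?akT_gen.
- by apply/lspanZ/lspan_gen; exists [::]; rewrite ?big_nil.
- exact: lspanD.
- apply: lspan_mull IHy => b wb; apply: lspan_mulr IHx => a wa.
  by apply: lspan_gen; exact: words_mul.
Qed.

Lemma Tup_inv j : (0 < j <= n)%N -> exists x, Tup j * x = 1.
Proof.
case: j => // j /=; elim: j => [|j IHj] jn; first by exists 1; rewrite Tup1 mulr1.
have [x E] := IHj (ltnW jn); exists ((T j.+1 - c%:A) * x).
have TT : T j.+1 * (T j.+1 - c%:A) = 1.
  by rewrite mulrBr akT_quad // -scalerAr mulr1 addrK.
by rewrite TupS // mulrA -(mulrA _ (T j.+1)) TT mulr1.
Qed.

Section RightIdeal.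
Variable J : set H.
Hypothesis J_rideal : right_ideal J.
Let J0 : J 0. Proof. by have [] := J_rideal. Qed.
Let JD x y : J x -> J y -> J (x + y). Proof. by have [_ + _] := J_rideal; apply. Qed.
Let JM x a : J x -> J (x * a). Proof. by have [_ _] := J_rideal; apply. Qed.

Lemma lspan_rideal x : lspan J x -> J x.
Proof.
elim=> // a b v Jb _ Jv; apply: JD => //.
by rewrite -[b]mulr1 scalerAr; exact: JM.
Qed.

Variable g : nat -> nat.
Hypothesis g_mono : forall i j, (i <= j)%N -> (j < n)%N -> (g i <= g j)%N.
Hypothesis g_bnd : forall j, (j < n)%N -> (0 < g j <= r.+1)%N.
Hypothesis J_L : forall j, (j < n)%N -> J (akLk n q Q j.+1 (g j)).

(** The factor [Tup j.+1] of the relator [akLk j.+1 (g j)] is invertible, so the right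
    ideal contains [Tdown j.+1 * pQ (g j)], and [pQ (g m)] is a multiple of
    [pQ (g j)]. *)
Lemma Kgen_rideal m z : (m < n)%N -> Kgen m.+1 (g m) z -> J z.
Proof.
move=> mn [[|j] [h [// jm ->]]]; apply: JM.
have [/= _ gm] := andP (g_bnd mn).
have [x ->] : exists x, pQ (g m) = pQ (g j) * x by apply: pQ_dvd; rewrite g_mono.
rewrite mulrA; apply: JM.
have [|y E] := @Tup_inv j.+1; first lia.
rewrite -[X in J X]mulr1 -E mulrA; apply/JM; rewrite -akLkE; apply: J_L; lia.
Qed.

(** The exponents are bounded one at a time: [word_Kgen_Mon] bounds all of them by
    [g m], which is the right bound for the last one, and the monomial in the other
    Jucys-Murphy elements is itself a combination of words in [T 0], ..., [T m.-1].
    This works because [L m.+1] commutes with the words so obtained. *)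
Lemma word_rideal_Mon m z : (m <= n)%N -> words m z -> lspan (J `|` Mon m g) z.
Proof.
elim: m z => [|m IHm] z mn [s sm ->].
  case: s sm => // _; apply: lspan_gen; right; exists (fun=> 0%N), [::].
  by split=> //; rewrite !big_nil mulr1 /Lmon big_ord0.
apply: lspan_trans (word_Kgen_Mon mn (g_bnd mn) sm) => b [Kb|].
  by apply: lspan_gen; left; exact: Kgen_rideal Kb.
move=> [f [t [fg tm ->]]]; rewrite /Lmon big_ord_recr /= -/(Lmon m f) -mulrA.
apply: lspan_mulr (IHm _ (ltnW mn) (words_Lmon m f)) => b' [Jb|].
  by apply: lspan_gen; left; exact: JM.
move=> [f' [t' [fg' tm' ->]]].
have cL : GRing.comm (L m.+1 ^+ f m) (\prod_(i <- t') T i).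
  rewrite big_seq; apply: commr_prod => i /(allP tm') im.
  by apply/commr_sym/commrX/comm_T_L; lia.
apply: lspan_gen; right.
exists (fun j => if j == m then f m else f' j), (t' ++ t); split.
- move=> j; rewrite ltnS leq_eqVlt; case: eqP => [-> _|_ /= jm]; last exact: fg'.
  exact: fg.
- rewrite all_cat tm andbT; apply: sub_all tm' => i; lia.
rewrite /Lmon big_ord_recr /= eqxx big_cat /= !mulrA -(mulrA _ _ (_ ^+ _)) -cL.
rewrite mulrA; congr (_ * _ * _ * _); apply: eq_bigr => j _.
by rewrite ltn_eqF.
Qed.

Lemma rideal_Mon h : lspan (J `|` Mon n g) h.
Proof. by apply: lspan_trans (words_span h) => b; exact: word_rideal_Mon. Qed.

End RightIdeal.

End Spanning.

Section StandardBasis.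
Variables (R : comUnitRingType) (n r : nat) (q : R) (Q : 'I_r.+1 -> R).

Local Notation H := (ariki_koike n q Q).
Local Notation T := (akT n q Q).
Local Notation L := (akL n q Q).
Local Notation Lmon := (Lmon n q Q).
Local Notation Tw := (ak_Tw n q Q).
Let c : R := q - q^-1.

Lemma ak_Tw_reduced w s : reduced w s -> Tw w = \prod_(i <- s) T i.
Proof.
move=> ws; apply: (@reduced_prod_uniq n H (fun i => T i)) ws => [i j i0 ->|i j ij|].
- exact: akT_braid3.
- by case/orP: ij => ij; [|apply/esym]; exact: akT_comm.
- exact: reduced_wordP.
Qed.

Lemma ak_Tw1 : Tw 1%g = 1.
Proof. by rewrite (ak_Tw_reduced (reduced_nil n)) big_nil. Qed.

Lemma ak_Tw_descent w (i : 'I_n) : (0 < i)%N -> left_descent w i ->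
  Tw w = T i * Tw (simple_refl i * w)%g.
Proof.
move=> i0 wi; have wr := reduced_wordP (simple_refl i * w)%g.
rewrite (@ak_Tw_reduced w (i :: reduced_word (simple_refl i * w)%g)).
  by rewrite big_cons.
by apply/reduced_cons.
Qed.

Hypothesis q_unit : q \is a GRing.unit.

Lemma akT_mul_Tw w (i : 'I_n) : (0 < i)%N ->
  T i * Tw w = Tw (simple_refl i * w)%g + (if left_descent w i then c else 0) *: Tw w.
Proof.
move=> i0; case: ifP => wi.
  rewrite (ak_Tw_descent i0 wi) mulrA akT_quad ?i0 ?ltn_ord //.
  by rewrite mulrDl mul1r -scalerAl.
rewrite scale0r addr0 (@ak_Tw_descent (simple_refl i * w)%g i) ?mul_simple_reflK //.
by rewrite left_descent_mul // wi.
Qed.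

Lemma word_span_Tw (s : seq nat) : all (fun i => 0 < i < n)%N s ->
  lspan (range Tw) (\prod_(i <- s) T i).
Proof.
elim: s => [_|i s IHs /= /andP[/andP[i0 lt_in] sn]].
  by rewrite big_nil -ak_Tw1; apply: lspan_gen; exists 1%g.
rewrite big_cons; apply: lspan_mull (IHs sn) => _ [w _ <-].
have := @akT_mul_Tw w (Ordinal lt_in) i0 => /= ->.
by apply: lspanD; last apply: lspanZ; apply: lspan_gen; eexists.
Qed.

Variable J : set H.
Hypothesis J_rideal : right_ideal J.
Variable P : pred 'I_n.
Hypothesis P_gt0 : forall i, P i -> (0 < i)%N.
Hypothesis J_T : forall i, P i -> J (T i - q%:A).
Variable g : nat -> nat.
Hypothesis g_mono : forall i j, (i <= j)%N -> (j < n)%N -> (g i <= g j)%N.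
Hypothesis g_bnd : forall j, (j < n)%N -> (0 < g j <= r.+1)%N.
Hypothesis J_L : forall j, (j < n)%N -> J (akLk n q Q j.+1 (g j)).
Hypothesis P_g : forall i, P i -> g i.-1 = g i.

Definition LTmon : set H := [set z | exists f d,
  [/\ forall j, (j < n)%N -> (f j < g j)%N,
      forall i, P i -> ~~ left_descent d i & z = Lmon n f * Tw d]].

(** Modulo the right ideal, a letter of the parabolic subgroup on the left of
    [Tw w] can be moved through the monomial and replaced by [q]. *)
Lemma rideal_LTmon h : lspan (J `|` LTmon) h.
Proof.
have JM x a : J x -> J (x * a) by case: J_rideal => _ _; apply.
apply: lspan_trans (rideal_Mon q_unit J_rideal g_mono g_bnd J_L h) => b [Jb|].
  by apply: lspan_gen; left.
move=> [f [s [fg sn ->{b}]]]; apply: lspan_mull (word_span_Tw sn) => _ [w _ <-].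
elim: {w}(perm_length w) {-2}w f fg (erefl (perm_length w)) => [|k IHk] w f fg wk.
  apply: lspan_gen; right; exists f, w; split=> // i Pi.
  by rewrite (perm_length_eq0 wk) /left_descent !perm1 ord_predE ?P_gt0 // -leqNgt leq_pred.
have [/forallP wD|/forallPn[i]] := boolP [forall i, P i ==> ~~ left_descent w i].
  by apply: lspan_gen; right; exists f, w; split=> // i; exact/implyP/wD.
rewrite negb_imply negbK => /andP[Pi wi]; have i0 := P_gt0 Pi.
have box a b' : (a <= maxn (f i.-1) (f i))%N -> (b' <= maxn (f i.-1) (f i))%N ->
    forall j, (j < n)%N -> (upd f i a b' j < g j)%N.
  have := fg i (ltn_ord i); have := fg i.-1 (leq_ltn_trans (leq_pred i) (ltn_ord i)).
  move=> f1 f2 ak bk j jm; rewrite /upd; have := fg _ jm; have := P_g Pi.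
  by do 2?case: eqP => [->|_]; lia.
have wk' : perm_length (simple_refl i * w)%g = k.
  by move: wk; rewrite (perm_length_descent i0 wi) => -[].
rewrite (ak_Tw_descent i0 wi) mulrA; set f' := upd f i (f i) (f i.-1).
have -> : Lmon n f * T i =
    (T i - q%:A) * Lmon n f' + q *: Lmon n f' - (T i * Lmon n f' - Lmon n f * T i).
  by rewrite mulrBl -scalerAl mul1r subrK subKr.
rewrite mulrBl mulrDl; apply: lspanB; first apply: lspanD.
- by apply: lspan_gen; left; rewrite -mulrA; apply/JM/J_T.
- by rewrite -scalerAl; apply/lspanZ/IHk => //; apply: box; lia.
have i0n : (0 < i < n)%N by rewrite i0 ltn_ord.
have := T_Lmon Q q_unit f' i0n (leqnn n).
have f'1 : f' i.-1 = f i by rewrite /f' /upd eqxx.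
have f'2 : f' i = f i.-1 by rewrite /f' /upd eqxx ifF //; lia.
have updf' a b' : upd f' i a b' = upd f i a b'.
  by apply/funext => j; rewrite /f' /upd; do 2?case: eqP.
rewrite f'1 f'2 updf' upd_id => E.
apply: lspan_mulr E => _ [a [b' [ab bb ->]]].
by apply: IHk => //; rewrite updf'; apply: box; lia.
Qed.

End StandardBasis.

(** * Demazure-Lusztig operators on power series *)

Section TwoVariables.
Variable R : pzRingType.
Implicit Types (G : nat -> nat -> R) (x y : nat).

(** The coefficient of X1^x X2^y in X2 (G - G') / (X2 - X1), where G' is G with
    its variables exchanged. *)
Definition demazure2 G x y : R :=
  \sum_(k < minn x.+1 y) (G k (x + y - k)%N - G (x + y - k)%N k).

Definition shift1 G x y : R := if x is x'.+1 then G x' y else 0.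
Definition shift2 G x y : R := if y is y'.+1 then G x y' else 0.

(** This identity and the next are the Bernstein relations between the Demazure
    operator and the multiplications by the two variables. *)
Lemma demazure2_shift1 G x y :
  demazure2 (shift1 G) x y = shift2 (demazure2 G) x y - shift2 G x y.
Proof.
case: y => [|y]; first by rewrite /demazure2 minn0 big_ord0 subr0.
rewrite /demazure2 minnSS !sumrB big_ord_recl /= add0r.
have -> : \sum_(k < minn x y) shift1 G (bump 0 k) (x + y.+1 - bump 0 k) =
    \sum_(k < minn x y) G k (x + y - k)%N.
  by apply: eq_bigr => k _; rewrite /bump /= add1n addnS subSS.
have -> : \sum_(k < (minn x y).+1) shift1 G (x + y.+1 - k) k =
    \sum_(k < (minn x y).+1) G (x + y - k)%N k.
  apply: eq_bigr => k _; rewrite addnS subSn //; have := ltn_ord k; lia.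
have [xy|yx] := ltnP x y.
  by rewrite (minn_idPl xy) sumrB [X in _ = X - _ - _]big_ord_recr /= addKn [RHS]addrAC addrK.
by rewrite (minn_idPr (leqW yx)) sumrB big_ord_recr /= addnK opprD addrA.
Qed.

Lemma demazure2_shift2 G x y :
  demazure2 (shift2 G) x y = shift1 (demazure2 G) x y + shift2 G x y.
Proof.
case: y => [|y].
  by rewrite /demazure2 minn0 big_ord0 addr0; case: x => // x; rewrite /= minn0 big_ord0.
rewrite /demazure2 minnSS !sumrB.
have -> : \sum_(k < (minn x y).+1) shift2 G k (x + y.+1 - k) =
    \sum_(k < (minn x y).+1) G k (x + y - k)%N.
  apply: eq_bigr => k _; rewrite addnS subSn //; have := ltn_ord k; lia.
rewrite [X in _ - X]big_ord_recl /= add0r.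
have -> : \sum_(k < minn x y) shift2 G (x + y.+1 - bump 0 k) (bump 0 k) =
    \sum_(k < minn x y) G (x + y - k)%N k.
  by apply: eq_bigr => k _; rewrite /bump /= add1n addnS subSS.
case: x => [|x].
  by rewrite min0n !big_ord0 big_ord_recr big_ord0 /= subr0 subn0.
rewrite /= /demazure2 minnSS sumrB addnS -addSn; have [xy|yx] := ltnP x y.
  by rewrite (minn_idPl xy) big_ord_recr /= addKn addrAC.
rewrite (minn_idPr (leqW yx)) [X in _ = _ - X + _]big_ord_recr /= addnK.
by rewrite opprD addrA subrK.
Qed.

End TwoVariables.

Section Operators.
Variables (R : comUnitRingType) (n : nat) (c : R).
Implicit Types (i j z : 'I_n) (w u : 'S_n) (f : 'I_n -> nat).

(** Formal power series in variables X_j with coefficients in the functions on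
    ['S_n], i.e. the regular representation of the finite Hecke algebra. *)
Record series : Type := Series { coef :> ('I_n -> nat) -> 'S_n -> R }.
Implicit Types F G : series.

Arguments coef : simpl never.
HB.instance Definition _ := gen_eqMixin series.
HB.instance Definition _ := gen_choiceMixin series.

Lemma seriesP F G : (forall f w, F f w = G f w) <-> F = G.
Proof.
split=> [|-> //]; case: F => F; case: G => G /= FG; congr Series.
by apply/funext => f; apply/funext => w.
Qed.

Let zero := Series (fun _ _ => 0).
Let opp F := Series (fun f w => - F f w).
Let add F G := Series (fun f w => F f w + G f w).
Let scale a F := Series (fun f w => a * F f w).

Fact series_addA : associative add.
Proof. by move=> F G K; apply/seriesP => f w; exact: addrA. Qed.
Fact series_addC : commutative add.
Proof. by move=> F G; apply/seriesP => f w; exact: addrC. Qed.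
Fact series_add0 : left_id zero add.
Proof. by move=> F; apply/seriesP => f w; exact: add0r. Qed.
Fact series_addN : left_inverse zero opp add.
Proof. by move=> F; apply/seriesP => f w; exact: addNr. Qed.
HB.instance Definition _ :=
  GRing.isZmodule.Build series series_addA series_addC series_add0 series_addN.

Fact series_scaleA a b F : scale a (scale b F) = scale (a * b) F.
Proof. by apply/seriesP => f w; exact: mulrA. Qed.
Fact series_scale1 : left_id 1 scale.
Proof. by move=> F; apply/seriesP => f w; exact: mul1r. Qed.
Fact series_scaleDr : right_distributive scale +%R.
Proof. by move=> a F G; apply/seriesP => f w; exact: mulrDr. Qed.
Fact series_scaleDl F : {morph scale^~ F : a b / a + b}.
Proof. by move=> a b; apply/seriesP => f w; exact: mulrDl. Qed.
HB.instance Definition _ := GRing.Zmodule_isLmodule.Build R series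
  series_scaleA series_scale1 series_scaleDr series_scaleDl.

Lemma series_addE F G f w : (F + G) f w = F f w + G f w. Proof. by []. Qed.
Lemma series_oppE F f w : (- F) f w = - F f w. Proof. by []. Qed.
Lemma series_scaleE a F f w : (a *: F) f w = a * F f w. Proof. by []. Qed.
Lemma series_0E f w : (0 : series) f w = 0. Proof. by []. Qed.
Definition seriesE := (series_addE, series_oppE, series_scaleE, series_0E).

Lemma series_sumE (I : Type) (s : seq I) (P : pred I) (F : I -> series) f w :
  (\sum_(i <- s | P i) F i) f w = \sum_(i <- s | P i) F i f w.
Proof. by elim/big_rec2: _ => // x1 x2 y1 _ <-. Qed.

Definition setx f j a : 'I_n -> nat := fun k => if k == j then a else f k.
Definition upd2 f i a b : 'I_n -> nat :=
  fun k => if k == ord_pred i then a else if k == i then b else f k.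
Definition swapx f i : 'I_n -> nat := fun k => f (simple_refl i k).

Lemma setxx f j a : setx f j a j = a.
Proof. by rewrite /setx eqxx. Qed.
Lemma setx_neq f j a k : k != j -> setx f j a k = f k.
Proof. by rewrite /setx => /negPf ->. Qed.
Lemma setx_id f j : setx f j (f j) = f.
Proof. by apply/funext => k; rewrite /setx; case: eqP => [->|]. Qed.
Lemma setx_setx f j a b : setx (setx f j a) j b = setx f j b.
Proof. by apply/funext => k; rewrite /setx; case: eqP. Qed.
Lemma setxC f j k a b : j != k -> setx (setx f j a) k b = setx (setx f k b) j a.
Proof.
move=> jk; apply/funext => l; rewrite /setx.
by case: eqP => // ->; case: eqP => // kj; rewrite -kj eqxx in jk.
Qed.

(** The common form of the operators that act on the variable X_j only.  They
    commute for different variables, and with [opT i] if s_i fixes X_j. *)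
Definition opZ j (phi : nat -> R) (psi : nat -> nat) F : series :=
  Series (fun f w => phi (f j) * F (setx f j (psi (f j))) w).

Lemma opZE j phi psi F f w :
  opZ j phi psi F f w = phi (f j) * F (setx f j (psi (f j))) w.
Proof. by []. Qed.

Fact opZ_linear j phi psi : linear (opZ j phi psi).
Proof. by move=> a F G; apply/seriesP => f w; rewrite !seriesE !opZE !seriesE; ring. Qed.
HB.instance Definition _ j phi psi :=
  GRing.isLinear.Build R series series *:%R (opZ j phi psi) (opZ_linear j phi psi).

Lemma opZC j k phi psi phi' psi' F : j != k ->
  opZ j phi psi (opZ k phi' psi' F) = opZ k phi' psi' (opZ j phi psi F).
Proof.
move=> jk; apply/seriesP => f w; rewrite !opZE setx_neq 1?eq_sym // setx_neq //.
by rewrite mulrCA setxC.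
Qed.

Definition opX j := opZ j (fun a => (0 < a)%:R) predn.

HB.instance Definition _ j := GRing.Linear.on (opX j).
Arguments opX : simpl never.

Lemma opX0 j F f w : f j = 0%N -> opX j F f w = 0.
Proof. by rewrite /opX opZE => ->; rewrite mul0r. Qed.

Lemma opXS j F f w a : f j = a.+1 -> opX j F f w = F (setx f j a) w.
Proof. by rewrite /opX opZE => ->; rewrite mul1r. Qed.

(** Left multiplication by T_i in the regular representation, combined with the
    permutation of the variables by s_i. *)
Definition opS i F : series := Series (fun f w =>
  F (swapx f i) (simple_refl i * w)%g +
  (if left_descent w i then c else 0) * F (swapx f i) w).

Lemma opSE i F f w : opS i F f w = F (swapx f i) (simple_refl i * w)%g +
  (if left_descent w i then c else 0) * F (swapx f i) w.
Proof. by []. Qed.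

Definition opD i F : series := Series (fun f w =>
  demazure2 (fun a b => F (upd2 f i a b) w) (f (ord_pred i)) (f i)).

Lemma opDE i F f w : opD i F f w =
  demazure2 (fun a b => F (upd2 f i a b) w) (f (ord_pred i)) (f i).
Proof. by []. Qed.

Fact opT_key : unit. Proof. exact: tt. Qed.
(** The Demazure-Lusztig operator by which T_i acts on the polynomial representation
    of the affine Hecke algebra.  The lock hides its sum from the additivity lemmas. *)
Definition opT := locked_with opT_key (fun i F => opS i F + c *: opD i F).

Lemma opTE i F : opT i F = opS i F + c *: opD i F.
Proof. by rewrite /opT unlock. Qed.
Opaque opT.

Fact opS_linear i : linear (opS i).
Proof. by move=> a F G; apply/seriesP => f w; rewrite !(seriesE, opSE); ring. Qed.
HB.instance Definition _ i :=
  GRing.isLinear.Build R series series *:%R (opS i) (opS_linear i).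

Fact opD_linear i : linear (opD i).
Proof.
move=> a F G; apply/seriesP => f w; rewrite !(seriesE, opDE) /demazure2.
by rewrite mulr_sumr -big_split; apply: eq_bigr => k _; rewrite !seriesE /=; ring.
Qed.
HB.instance Definition _ i :=
  GRing.isLinear.Build R series series *:%R (opD i) (opD_linear i).

Fact opT_linear i : linear (opT i).
Proof.
by move=> a F G; apply/seriesP => f w; rewrite !opTE !linearP !seriesE; ring.
Qed.
HB.instance Definition _ i :=
  GRing.isLinear.Build R series series *:%R (opT i) (opT_linear i).

Lemma opTD i F G : opT i (F + G) = opT i F + opT i G. Proof. exact: linearD. Qed.
Lemma opTN i F : opT i (- F) = - opT i F. Proof. exact: linearN. Qed.
Lemma opTZ i a F : opT i (a *: F) = a *: opT i F. Proof. exact: linearZZ. Qed.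
Lemma opXD i F G : opX i (F + G) = opX i F + opX i G. Proof. exact: linearD. Qed.
Lemma opXN i F : opX i (- F) = - opX i F. Proof. exact: linearN. Qed.
Lemma opXZ i a F : opX i (a *: F) = a *: opX i F. Proof. exact: linearZZ. Qed.
Definition op_linE := (opTD, opTN, opTZ, opXD, opXN, opXZ).

Lemma swapx_pred f i : swapx f i (ord_pred i) = f i.
Proof. by rewrite /swapx simple_refl_pred. Qed.
Lemma swapx_self f i : swapx f i i = f (ord_pred i).
Proof. by rewrite /swapx simple_refl_self. Qed.
Lemma simple_refl_other i j : j != ord_pred i -> j != i -> simple_refl i j = j.
Proof. by move=> ji jp; rewrite /simple_refl tpermD // eq_sym. Qed.
Lemma swapx_setx f i j a : swapx (setx f j a) i = setx (swapx f i) (simple_refl i j) a.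
Proof.
apply/funext => k; rewrite /swapx /setx; congr (if _ then _ else _).
by rewrite -{1}[j](tpermK (ord_pred i) i) (inj_eq perm_inj).
Qed.

Lemma opT_opZ i j phi psi F : j != ord_pred i -> j != i ->
  opT i (opZ j phi psi F) = opZ j phi psi (opT i F).
Proof.
move=> jp ji; have sj := simple_refl_other jp ji.
have swj f : swapx f i j = f j by rewrite /swapx sj.
apply/seriesP => f w; rewrite !opTE opZE !seriesE mulrDr; congr (_ + _).
  by rewrite !opSE !opZE !swj swapx_setx sj; ring.
rewrite mulrCA; congr (_ * _); rewrite !opDE !setx_neq 1?eq_sym // mulr_sumr.
have uj a b : upd2 f i a b j = f j by rewrite /upd2 (negPf jp) (negPf ji).
have us a b d : upd2 (setx f j d) i a b = setx (upd2 f i a b) j d.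
  apply/funext => k; rewrite /upd2 /setx.
  case: eqP => [->|_]; first by rewrite eq_sym (negPf jp).
  by case: eqP => [->|_] //; rewrite eq_sym (negPf ji).
by apply: eq_bigr => k _; rewrite !opZE !uj !us mulrBr.
Qed.

Section Bernstein.
Variable i : 'I_n.
Hypothesis i_gt0 : (0 < i)%N.
Let p := ord_pred i.
Let pi : p != i := ord_pred_neq i_gt0.

Let upd2_p f a b : upd2 f i a b p = a.
Proof. by rewrite /upd2 eqxx. Qed.
Let upd2_i f a b : upd2 f i a b i = b.
Proof. by rewrite /upd2 eqxx eq_sym (negPf pi). Qed.
Let setx_upd2_p f a b d : setx (upd2 f i a b) p d = upd2 f i d b.
Proof. by apply/funext => k; rewrite /upd2 /setx; case: eqP. Qed.
Let setx_upd2_i f a b d : setx (upd2 f i a b) i d = upd2 f i a d.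
Proof.
apply/funext => k; rewrite /upd2 /setx; case: eqP => // ->.
by rewrite eq_sym (negPf pi).
Qed.
Let upd2_setx_p f a b d : upd2 (setx f p d) i a b = upd2 f i a b.
Proof. by apply/funext => k; rewrite /upd2 /setx -/p; case: eqP. Qed.
Let upd2_setx_i f a b d : upd2 (setx f i d) i a b = upd2 f i a b.
Proof. by apply/funext => k; rewrite /upd2 /setx; do 2?case: eqP. Qed.
Let upd2_id f : upd2 f i (f p) (f i) = f.
Proof. by apply/funext => k; rewrite /upd2 -/p; do 2?case: eqP => [->|_]. Qed.

Let opX_p_upd2 F f w : (fun a b => opX p F (upd2 f i a b) w) =
  shift1 (fun a b => F (upd2 f i a b) w).
Proof.
apply/funext => a; apply/funext => b; case: a => [|a].
  by rewrite opX0 ?upd2_p.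
by rewrite (@opXS _ _ _ _ a) ?setx_upd2_p.
Qed.

Let opX_i_upd2 F f w : (fun a b => opX i F (upd2 f i a b) w) =
  shift2 (fun a b => F (upd2 f i a b) w).
Proof.
apply/funext => a; apply/funext => b; case: b => [|b].
  by rewrite opX0 ?upd2_i.
by rewrite (@opXS _ _ _ _ b) ?setx_upd2_i.
Qed.

Let shift2E F f w :
  shift2 (fun a b => F (upd2 f i a b) w) (f p) (f i) = opX i F f w.
Proof. by rewrite -opX_i_upd2 upd2_id. Qed.

Let opD_p F f w : shift1 (demazure2 (fun a b => F (upd2 f i a b) w)) (f p) (f i) =
  opX p (opD i F) f w.
Proof.
case E : (f p) => [|a]; first by rewrite opX0.
rewrite (opXS _ _ E) opDE -/p setxx setx_neq 1?eq_sym //.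
by congr demazure2; apply/funext => a'; apply/funext => b; rewrite upd2_setx_p.
Qed.
Let opD_i F f w : shift2 (demazure2 (fun a b => F (upd2 f i a b) w)) (f p) (f i) =
  opX i (opD i F) f w.
Proof.
case E : (f i) => [|b]; first by rewrite opX0.
rewrite (opXS _ _ E) opDE -/p setxx setx_neq //=.
by congr demazure2; apply/funext => a'; apply/funext => b'; rewrite upd2_setx_i.
Qed.

Let opS_X F j f w :
  opS i (opX j F) f w = opX (simple_refl i j) (opS i F) f w.
Proof.
have E : swapx f i j = f (simple_refl i j) by [].
case E' : (f (simple_refl i j)) => [|a].
  by rewrite opSE !opX0 ?E //; ring.
rewrite (opXS _ _ E') !opSE !(@opXS j _ _ _ a) ?E // swapx_setx.
by rewrite /simple_refl tpermK.
Qed.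

Lemma opT_X_pred F : opT i (opX p F) = opX i (opT i F) - c *: opX i F.
Proof.
apply/seriesP => f w; rewrite !opTE linearD linearZ /= !seriesE.
rewrite opS_X simple_refl_pred [in X in X = _]opDE opX_p_upd2 demazure2_shift1 shift2E opD_i.
by ring.
Qed.

Lemma opT_X_self F : opT i (opX i F) = opX p (opT i F) + c *: opX i F.
Proof.
apply/seriesP => f w; rewrite !opTE linearD linearZ /= !seriesE.
rewrite opS_X simple_refl_self [in X in X = _]opDE opX_i_upd2 demazure2_shift2 shift2E opD_p.
by ring.
Qed.

End Bernstein.

Lemma opT_X_other i j F : j != ord_pred i -> j != i ->
  opT i (opX j F) = opX j (opT i F).
Proof. exact: opT_opZ. Qed.

Definition ltdeg j b F := forall f w, (b <= f j)%N -> F f w = 0.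

Lemma split_var j F : F = opZ j (fun a => (a == 0%N)%:R) id F +
  opX j (opZ j (fun=> 1) succn F).
Proof.
apply/seriesP => f w; rewrite seriesE opZE; case E : (f j) => [|a].
  by rewrite opX0 // addr0 eqxx mul1r -[X in setx f j X]E setx_id.
by rewrite (opXS _ _ E) opZE setxx setx_setx -E setx_id E mul0r add0r mul1r.
Qed.

(** An operator that permutes the variables is determined by its values on
    constants: each series is the sum of one that is constant in X_j and a multiple
    of X_j ([split_var]), and dividing by X_j lowers the total degree of the
    coefficient under consideration.  This reduces the relations between the
    operators [opT] to those of the regular representation. *)
Lemma intertwiner_eq0 (Phi : series -> series) (sg : 'I_n -> 'I_n) :
    (forall F G, Phi (F + G) = Phi F + Phi G) ->
    (forall j F, Phi (opX j F) = opX (sg j) (Phi F)) ->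
    (forall F, (forall j, ltdeg j 1 F) -> Phi F = 0) ->
  forall F, Phi F = 0.
Proof.
move=> PhiD PhiX Phi0 F; apply/seriesP => f w.
have [d] := ubnP (\sum_j f j); elim: d => // d IHd in F f w *; rewrite ltnS => fd.
have [s] : exists s : seq 'I_n, forall j, j \notin s -> ltdeg j 1 F.
  by exists (enum 'I_n) => j; rewrite mem_enum.
elim: s => [|j s IHs] in F * => Fs; first by rewrite Phi0 // => j; exact: Fs.
rewrite (split_var j F) PhiD PhiX seriesE IHs ?add0r => [|k ks f' w' f'k].
  case E : (f (sg j)) => [|a]; first by rewrite opX0.
  rewrite (opXS _ _ E) IHd //; apply: leq_trans fd.
  rewrite (bigD1 (sg j)) //= setxx [X in (_ < X)%N](bigD1 (sg j)) //= E addSn ltnS.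
  by rewrite leq_add2l leq_sum // => k kj; rewrite setx_neq.
rewrite opZE; have [kj|kj] := eqVneq k j.
  by rewrite -kj gtn_eqF // mul0r.
by rewrite (Fs k) ?mulr0 ?inE ?negb_or ?kj // setx_neq.
Qed.

Lemma opT_const i F : (0 < i)%N -> (forall j, ltdeg j 1 F) ->
  opT i F = opS i F /\ forall j, ltdeg j 1 (opT i F).
Proof.
move=> i0 F0; have D0 : opD i F = 0.
  apply/seriesP => f w; rewrite opDE /demazure2 big1 // => k _.
  have ki : (k < f i)%N by have := ltn_ord k; lia.
  rewrite (F0 i) ?(F0 (ord_pred i)) ?subrr // /upd2 ?eqxx; first lia.
  by rewrite eq_sym (negPf (ord_pred_neq i0)); have := ltn_ord k; lia.
rewrite !opTE D0 scaler0 addr0; split=> // j f w fj.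
have Fsw w' : F (swapx f i) w' = 0 by apply: (F0 (simple_refl i j)); rewrite /swapx tpermK.
by rewrite opSE !Fsw mulr0 addr0.
Qed.

Lemma swapx_const i F f : (forall j, ltdeg j 1 F) -> F (swapx f i) = F f.
Proof.
move=> F0; have [/existsP[j fj]|/existsPn f0] := boolP [exists j, 0 < f j]%N.
  apply/funext => w; rewrite (F0 j f w fj) (F0 (simple_refl i j)) //.
  by rewrite /swapx tpermK.
congr (F _); apply/funext => j; rewrite /swapx.
by have := f0 j; have := f0 (simple_refl i j); rewrite -!eqn0Ngt => /eqP-> /eqP->.
Qed.

Lemma opT_constE i F f w : (0 < i)%N -> (forall j, ltdeg j 1 F) ->
  opT i F f w = F f (simple_refl i * w)%g + (if left_descent w i then c else 0) * F f w.
Proof. by move=> i0 F0; have [-> _] := opT_const i0 F0; rewrite opSE swapx_const. Qed.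

Lemma opT_const_deg i F : (0 < i)%N -> (forall j, ltdeg j 1 F) ->
  forall j, ltdeg j 1 (opT i F).
Proof. by move=> i0 F0; have [] := opT_const i0 F0. Qed.

Lemma opT_quad i F : (0 < i)%N -> opT i (opT i F) = F + c *: opT i F.
Proof.
move=> i0; pose Phi F := opT i (opT i F) - F - c *: opT i F.
suff : Phi F = 0 by move/eqP; rewrite /Phi -addrA -opprD subr_eq0 => /eqP.
apply: (@intertwiner_eq0 Phi id) => {F} [F G|j F|F F0]; rewrite /Phi.
- by rewrite !op_linE; apply/seriesP => f w; rewrite !seriesE; ring.
- rewrite !op_linE.
  have [->|ji] := eqVneq j i.
    rewrite opT_X_self // !op_linE ?opT_X_pred // !opT_X_self //.
    by apply/seriesP => f w; rewrite !seriesE; ring.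
  have [->|jp] := eqVneq j (ord_pred i).
    rewrite opT_X_pred // !op_linE ?opT_X_pred // !opT_X_self //.
    by apply/seriesP => f w; rewrite !seriesE; ring.
  by rewrite !opT_X_other // !op_linE.
apply/seriesP => f w; have T0 := opT_const_deg i0 F0.
rewrite !seriesE opT_constE // !opT_constE // left_descent_mul // mul_simple_reflK.
by case: left_descent => /=; ring.
Qed.

Lemma ord_inj_neq i j : (i : nat) <> j -> i != j.
Proof. by move=> ij; apply/eqP => E; apply: ij; rewrite E. Qed.

Lemma opT_comm i j F : (0 < i)%N -> (i.+1 < j)%N ->
  opT i (opT j F) = opT j (opT i F).
Proof.
move=> i0 ij; have j0 : (0 < j)%N by lia.
pose Phi F := opT i (opT j F) - opT j (opT i F).
suff : Phi F = 0 by move/eqP; rewrite /Phi subr_eq0 => /eqP.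
have [ip jp] := (ord_predE i0, ord_predE j0).
have neq : [/\ i != j, i != ord_pred j, ord_pred i != j & ord_pred i != ord_pred j].
  by split; apply: ord_inj_neq; lia.
have [n1 n2 n3 n4] := neq.
have [n1' n2'] : j != i /\ j != ord_pred i by rewrite eq_sym n1 eq_sym n3.
have [n3' n4'] : ord_pred j != i /\ ord_pred j != ord_pred i.
  by rewrite eq_sym n2 eq_sym n4.
pose sg k := simple_refl j (simple_refl i k).
apply: (@intertwiner_eq0 Phi sg) => {F} [F G|k F|F F0]; rewrite /Phi.
- by rewrite !op_linE; apply/seriesP => f w; rewrite !seriesE; ring.
- rewrite /sg; have [->|ki] := eqVneq k i.
    rewrite simple_refl_self (simple_refl_other n4 n3) opT_X_other // opT_X_self //.
    rewrite opT_X_self // !op_linE !(@opT_X_other j) //.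
    by apply/seriesP => f w; rewrite !seriesE; ring.
  have [->|kp] := eqVneq k (ord_pred i).
    rewrite simple_refl_pred (simple_refl_other n2 n1) opT_X_other // opT_X_pred //.
    rewrite opT_X_pred // !op_linE !(@opT_X_other j) //.
    by apply/seriesP => f w; rewrite !seriesE; ring.
  rewrite (simple_refl_other kp ki); have [->|kj] := eqVneq k j.
    rewrite simple_refl_self (@opT_X_other i) // !opT_X_self //.
    rewrite !op_linE !(@opT_X_other i) //.
    by apply/seriesP => f w; rewrite !seriesE; ring.
  have [->|kq] := eqVneq k (ord_pred j).
    rewrite simple_refl_pred (@opT_X_other i) // !opT_X_pred //.
    rewrite !op_linE !(@opT_X_other i) //.
    by apply/seriesP => f w; rewrite !seriesE; ring.
  by rewrite simple_refl_other // !opT_X_other // op_linE opXN.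
apply/seriesP => f w.
have Ti := opT_const_deg i0 F0; have Tj := opT_const_deg j0 F0.
rewrite !seriesE !opT_constE // !mulgA (simple_refl_comm i0 ij).
have -> : left_descent (simple_refl i * w)%g j = left_descent w j.
  by rewrite /left_descent !permM !simple_refl_other.
have -> : left_descent (simple_refl j * w)%g i = left_descent w i.
  by rewrite /left_descent !permM !simple_refl_other.
by do 2?case: left_descent; ring.
Qed.

Lemma opT_braid3 i j F : (0 < i)%N -> j = i.+1 :> nat ->
  opT i (opT j (opT i F)) = opT j (opT i (opT j F)).
Proof.
move=> i0 ji; have j0 : (0 < j)%N by lia.
pose Phi F := opT i (opT j (opT i F)) - opT j (opT i (opT j F)).
suff : Phi F = 0 by move/eqP; rewrite /Phi subr_eq0 => /eqP.
have ip := ord_predE i0; have jp : ord_pred j = i.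
  by apply: ord_inj; rewrite ord_predE // ji.
have pj : ord_pred i != j by apply: ord_inj_neq; lia.
have jpi : j != ord_pred i by rewrite eq_sym.
have neq_ij : i != j by apply: ord_inj_neq; lia.
have neq_ji : j != i by rewrite eq_sym.
have neq_pi := ord_pred_neq i0.
have neq_ip : i != ord_pred i by rewrite eq_sym.
have sij : simple_refl i j = j by exact: simple_refl_other.
have sji : simple_refl j i = j by rewrite -jp simple_refl_pred.
have sjj : simple_refl j j = i by rewrite simple_refl_self.
have sjp : simple_refl j (ord_pred i) = ord_pred i by rewrite simple_refl_other // jp.
have Xji G : opT j (opX i G) = opX j (opT j G) - c *: opX j G.
  by rewrite -jp opT_X_pred.
have Xjj G : opT j (opX j G) = opX i (opT j G) + c *: opX j G.
  by rewrite opT_X_self // jp.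
have Xjp G : opT j (opX (ord_pred i) G) = opX (ord_pred i) (opT j G).
  by rewrite opT_X_other // jp.
have Xip G : opT i (opX (ord_pred i) G) = opX i (opT i G) - c *: opX i G.
  exact: opT_X_pred.
have Xii G : opT i (opX i G) = opX (ord_pred i) (opT i G) + c *: opX i G.
  exact: opT_X_self.
have Xij G : opT i (opX j G) = opX j (opT i G) by exact: opT_X_other.
pose XT := (Xji, Xjj, Xjp, Xip, Xii, Xij).
pose sg k := simple_refl i (simple_refl j (simple_refl i k)).
apply: (@intertwiner_eq0 Phi sg) => {F} [F G|k F|F F0]; rewrite /Phi.
- by rewrite !op_linE; apply/seriesP => f w; rewrite !seriesE; ring.
- rewrite /sg; have [->|ki] := eqVneq k i.
    rewrite simple_refl_self sjp simple_refl_pred.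
    rewrite !(op_linE, XT).
    by apply/seriesP => f w; rewrite !seriesE; ring.
  have [->|kp] := eqVneq k (ord_pred i).
    rewrite simple_refl_pred sji sij.
    rewrite !(op_linE, XT).
    rewrite !opT_quad //.
    rewrite !(op_linE, XT).
    by apply/seriesP => f w; rewrite !seriesE; ring.
  rewrite (simple_refl_other kp ki); have [->|kj] := eqVneq k j.
    rewrite sjj simple_refl_self.
    rewrite !(op_linE, XT).
    rewrite !opT_quad //.
    rewrite !(op_linE, XT).
    by apply/seriesP => f w; rewrite !seriesE; ring.
  by rewrite !simple_refl_other ?jp // !opT_X_other ?jp // op_linE opXN.
apply/seriesP => f w.
have Ti := opT_const_deg i0 F0; have Tj := opT_const_deg j0 F0.
have Tij := opT_const_deg i0 Tj; have Tji := opT_const_deg j0 Ti.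
rewrite !seriesE !opT_constE //.
rewrite /left_descent !permM jp sij simple_refl_self simple_refl_pred sji sjj sjp.
rewrite sij simple_refl_pred !mulgA (simple_refl_braid i0 ji) !simple_reflK !mul1g.
have : w (ord_pred i) != w i :> nat by rewrite (inj_eq (@ord_inj _)) (inj_eq perm_inj).
have : w (ord_pred i) != w j :> nat by rewrite (inj_eq (@ord_inj _)) (inj_eq perm_inj).
have : w i != w j :> nat by rewrite (inj_eq (@ord_inj _)) (inj_eq perm_inj).
case: (ltngtP (w i) (w j)) => // a _; case: (ltngtP (w (ord_pred i)) (w j)) => // b _;
  case: (ltngtP (w (ord_pred i)) (w i)) => // d _; try (by exfalso; lia); ring.
Qed.

End Operators.

#[global] Arguments coef : simpl never.

(** * The operator of T_0 and the braid relation of length four *)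

Section Degrees.
Variables (R : comUnitRingType) (n : nat) (c : R).
Implicit Types (i j z : 'I_n) (F G : series R n) (f : 'I_n -> nat).
Local Notation opT := (opT c).
Local Notation series := (series R n).

Lemma ltdegD j b F G : ltdeg j b F -> ltdeg j b G -> ltdeg j b (F + G).
Proof. by move=> FE GE f w fj; rewrite seriesE FE // GE // addr0. Qed.

Lemma ltdegZ j b a F : ltdeg j b F -> ltdeg j b (a *: F).
Proof. by move=> FE f w fj; rewrite seriesE FE // mulr0. Qed.

Lemma ltdegN j b F : ltdeg j b F -> ltdeg j b (- F).
Proof. by move=> FE f w fj; rewrite seriesE FE // oppr0. Qed.

Lemma ltdeg_leq j b b' F : (b <= b')%N -> ltdeg j b F -> ltdeg j b' F.
Proof. by move=> bb FE f w fj; rewrite FE // (leq_trans bb). Qed.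

Lemma ltdeg_opZ j k phi psi b F : j != k -> ltdeg j b F -> ltdeg j b (opZ k phi psi F).
Proof. by move=> jk FE f w fj; rewrite opZE FE ?mulr0 // setx_neq. Qed.

Lemma ltdeg_opX j b F : ltdeg j b F -> ltdeg j b.+1 (opX j F).
Proof.
move=> FE f w; case E : (f j) => [//|a] ba.
by rewrite (opXS _ _ E) FE // setxx.
Qed.

Lemma ltdeg_opX_neq j k b F : j != k -> ltdeg j b F -> ltdeg j b (opX k F).
Proof. exact: ltdeg_opZ. Qed.

Lemma ltdeg_opT_other i j b F : j != ord_pred i -> j != i ->
  ltdeg j b F -> ltdeg j b (opT i F).
Proof.
move=> jp ji FE f w fj; rewrite opTE !seriesE opSE opDE /demazure2.
have Fs u : F (swapx f i) u = 0 by apply: FE; rewrite /swapx simple_refl_other.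
have Fu a a' u : F (upd2 f i a a') u = 0.
  by apply: FE; rewrite /upd2 (negPf jp) (negPf ji).
rewrite !Fs big1 => [|k _]; last by rewrite !Fu subrr.
by rewrite !mulr0 !addr0.
Qed.

(** The bound for the first variable improves by one, because every term of
    [demazure2 G x y] involves an exponent larger than [x].  This margin lets the
    Jucys-Murphy elements act by shifts up to the largest possible exponent. *)
Lemma ltdeg_opT_pred i b F : (0 < i)%N -> ltdeg (ord_pred i) b.+1 F ->
  ltdeg i b F -> ltdeg (ord_pred i) b (opT i F).
Proof.
move=> i0 FEp FEi f w fp; rewrite opTE !seriesE opSE opDE /demazure2.
have Fs u : F (swapx f i) u = 0 by apply: FEi; rewrite swapx_self.
rewrite !Fs big1 => [|k _]; first by rewrite !mulr0 !addr0.
have := ltn_ord k; rewrite ltn_min => /andP[kp ki].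
rewrite FEi ?FEp ?subrr // /upd2 ?eqxx; first lia.
by rewrite eq_sym (negPf (ord_pred_neq i0)); lia.
Qed.

Lemma ltdeg_opT_self i b F : (0 < i)%N -> ltdeg (ord_pred i) b F ->
  ltdeg i b F -> ltdeg i b (opT i F).
Proof.
move=> i0 FEp FEi f w fi; rewrite opTE !seriesE opSE opDE /demazure2.
have Fs u : F (swapx f i) u = 0 by apply: FEp; rewrite swapx_pred.
rewrite !Fs big1 => [|k _]; first by rewrite !mulr0 !addr0.
have := ltn_ord k; rewrite ltn_min => /andP[kp ki].
rewrite FEi ?FEp ?subrr // /upd2 ?eqxx; first lia.
by rewrite eq_sym (negPf (ord_pred_neq i0)); lia.
Qed.

End Degrees.

Section CyclotomicOperator.
Variables (R : comUnitRingType) (n r : nat) (q : R) (Q : 'I_r.+1 -> R).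
Let c : R := q - q^-1.
Implicit Types (i j z : 'I_n) (F G : series R n) (f : 'I_n -> nat).
Local Notation opT := (opT c).
Local Notation series := (series R n).

Definition cyclotomic_poly : {poly R} := \prod_(k < r.+1) ('X - (Q k)%:P).
Local Notation P := cyclotomic_poly.

Lemma cyclotomic_poly_lead : P`_r.+1 = 1.
Proof.
have /monicP := monic_prod_XsubC (index_enum 'I_r.+1) xpredT Q.
by rewrite lead_coefE size_prod_XsubC -sum1_size sum1_card card_ord.
Qed.

Fact opT0_key : unit. Proof. exact: tt. Qed.
(** Multiplication by X_z modulo the cyclotomic polynomial in X_z. *)
Definition opT0 := locked_with opT0_key (fun z F =>
  opZ z (fun a => (0 < a <= r)%N%:R) predn F -
  opZ z (fun a => (a <= r)%N%:R * P`_a) (fun=> r) F).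

Lemma opT0E z F : opT0 z F = opZ z (fun a => (0 < a <= r)%N%:R) predn F -
  opZ z (fun a => (a <= r)%N%:R * P`_a) (fun=> r) F.
Proof. by rewrite /opT0 unlock. Qed.
Opaque opT0.

Fact opT0_linear z : linear (opT0 z).
Proof.
by move=> a F G; apply/seriesP => f w; rewrite !opT0E !linearP !seriesE; ring.
Qed.
HB.instance Definition _ z :=
  GRing.isLinear.Build R series series *:%R (opT0 z) (opT0_linear z).

Lemma opT0D z F G : opT0 z (F + G) = opT0 z F + opT0 z G. Proof. exact: linearD. Qed.
Lemma opT0N z F : opT0 z (- F) = - opT0 z F. Proof. exact: linearN. Qed.
Lemma opT0Z z a F : opT0 z (a *: F) = a *: opT0 z F. Proof. exact: linearZZ. Qed.

Lemma opT0_ltdeg z F : ltdeg z r F -> opT0 z F = opX z F.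
Proof.
move=> FE; apply/seriesP => f w; rewrite opT0E !seriesE !opZE.
rewrite (FE (setx f z r)) ?setxx // mulr0 subr0.
case E : (f z) => [|a]; first by rewrite !mul0r.
have [//|ra] := leqP a.+1 r.
by rewrite FE ?mulr0 // setxx.
Qed.

Lemma ltdeg_opT0_self z F : ltdeg z r.+1 (opT0 z F).
Proof.
by move=> f w rf; rewrite opT0E !seriesE !opZE [(f z <= r)%N]leqNgt rf andbF !mul0r subrr.
Qed.

Lemma ltdeg_opT0 z j b F : j != z -> ltdeg j b F -> ltdeg j b (opT0 z F).
Proof.
by move=> jz FE; rewrite opT0E; apply: ltdegD; last apply: ltdegN; apply: ltdeg_opZ.
Qed.

(** Representatives modulo the cyclotomic polynomials in the n variables: the space
    on which the algebra acts. *)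
Definition reduced_series F := forall j, ltdeg j r.+1 F.

Lemma reduced_opT0 z F : reduced_series F -> reduced_series (opT0 z F).
Proof.
move=> FM j; have [->|jz] := eqVneq j z; first exact: ltdeg_opT0_self.
exact: ltdeg_opT0.
Qed.

Lemma reduced_opT i F : (0 < i)%N -> reduced_series F -> reduced_series (opT i F).
Proof.
move=> i0 FM j; have [->|ji] := eqVneq j i; first exact: ltdeg_opT_self.
have [->|jp] := eqVneq j (ord_pred i); last exact: ltdeg_opT_other.
by apply: ltdeg_opT_pred => //; exact: ltdeg_leq (FM _).
Qed.

Lemma opT0_opZ z j phi psi F : j != z -> opT0 z (opZ j phi psi F) = opZ j phi psi (opT0 z F).
Proof.
by move=> jz; rewrite !opT0E linearB /=; congr (_ - _); apply: opZC; rewrite eq_sym.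
Qed.

Lemma opT_opT0 i z F : z != ord_pred i -> z != i -> opT i (opT0 z F) = opT0 z (opT i F).
Proof. by move=> zp zi; rewrite !opT0E linearB /= !opT_opZ. Qed.

Lemma iter_opT0 z k F : (k <= r)%N -> ltdeg z 1 F ->
  iter k (opT0 z) F = opZ z (fun a => (a == k)%:R) (fun=> 0%N) F.
Proof.
move=> kr F1; elim: k kr => [|k IHk] kr /=.
  apply/seriesP => f w; rewrite opZE; case: eqP => [<-|/eqP fz].
    by rewrite setx_id mul1r.
  by rewrite F1 ?mul0r // lt0n.
rewrite IHk ?(ltnW kr) // opT0_ltdeg => [|f w rf]; last first.
  by rewrite opZE gtn_eqF ?mul0r // (leq_trans kr).
apply/seriesP => f w; rewrite [RHS]opZE; case E : (f z) => [|a].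
  by rewrite opX0 // mul0r.
by rewrite (opXS _ _ E) opZE setxx setx_setx eqSS.
Qed.

Definition opT0_eval z F := \sum_(k < r.+2) P`_k *: iter k (opT0 z) F.

Lemma iter_opT0D z k F G :
  iter k (opT0 z) (F + G) = iter k (opT0 z) F + iter k (opT0 z) G.
Proof. by elim: k => //= k ->; rewrite opT0D. Qed.

Lemma opT0_evalD z F G : opT0_eval z (F + G) = opT0_eval z F + opT0_eval z G.
Proof.
by rewrite -big_split; apply: eq_bigr => k _; rewrite iter_opT0D scalerDr.
Qed.

Lemma opT0_eval_mul z F : opT0_eval z (opT0 z F) = opT0 z (opT0_eval z F).
Proof.
rewrite /opT0_eval linear_sum; apply: eq_bigr => k _.
by rewrite /= opT0Z -iterSr.
Qed.

Lemma opT0_eval0 z : opT0_eval z 0 = 0.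
Proof. by apply: (addrI (opT0_eval z 0)); rewrite -opT0_evalD !addr0. Qed.

(** Cayley-Hamilton for the companion operator: the constants in X_z generate
    everything under [opT0 z], and for them the identity is the definition. *)
Lemma opT0_Cayley_Hamilton z F : ltdeg z r.+1 F -> opT0_eval z F = 0.
Proof.
have CH1 G : ltdeg z 1 G -> opT0_eval z G = 0.
  move=> G1; rewrite /opT0_eval big_ord_recr /= iter_opT0 // cyclotomic_poly_lead scale1r.
  apply/seriesP => f w; rewrite seriesE series_sumE.
  under eq_bigr => k _ do rewrite seriesE (iter_opT0 (ltn_ord k)) // opZE.
  rewrite opT0E !seriesE !opZE !setxx !setx_setx eqxx mul1r.
  have [fr|rf] := leqP (f z) r; last first.
    rewrite andbF !mul0r subrr addr0 big1 // => k _.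
    by rewrite gtn_eqF ?mul0r ?mulr0 // (leq_trans (ltn_ord k)).
  rewrite andbT mul1r (bigD1 (Ordinal (fr : f z < r.+1)%N)) //= eqxx mul1r.
  rewrite big1 => [|k kf]; last first.
    rewrite (_ : (f z == k) = false) ?mul0r ?mulr0 //.
    by apply/negbTE; apply: contra kf => /eqP fk; apply/eqP/ord_inj.
  rewrite addr0 [X in X - _](_ : _ = 0) ?sub0r ?subrr //.
  case: (f z) fr => [|a] ar; first by rewrite mul0r.
  by rewrite /= ltn_eqF ?mul0r ?mulr0.
move=> FE; pose Fa a := opZ z (fun b => (b == 0%N)%:R) (fun=> a) F.
have Fa1 a : ltdeg z 1 (Fa a) by move=> f w fz; rewrite opZE gtn_eqF ?mul0r.
have -> : F = \sum_(a < r.+1) iter a (opT0 z) (Fa a).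
  apply/seriesP => f w; rewrite series_sumE.
  under eq_bigr => a _ do rewrite (iter_opT0 (ltn_ord a)) // !opZE setxx setx_setx eqxx mul1r.
  have [fr|rf] := ltnP (f z) r.+1; last first.
    by rewrite FE // big1 // => a _; rewrite gtn_eqF ?mul0r // (leq_trans (ltn_ord a)).
  rewrite (bigD1 (Ordinal fr)) //= eqxx mul1r setx_id big1 ?addr0 // => a af.
  rewrite (_ : (f z == a) = false) ?mul0r //.
  by apply/negbTE; apply: contra af => /eqP fa; apply/eqP/ord_inj.
elim/big_ind: _ => [|G K G0 K0|a _]; first exact: opT0_eval0.
  by rewrite opT0_evalD G0 K0 addr0.
have := CH1 _ (Fa1 a); move: (Fa a) => G G0.
elim: (a : nat) => [//|k IHk]; rewrite iterS opT0_eval_mul IHk.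
exact: linear0.
Qed.

Lemma foldr_opT0 (s : seq R) z F :
  foldr (fun a G => opT0 z G - a *: G) F s =
  \sum_(k < (size s).+1) (\prod_(a <- s) ('X - a%:P))`_k *: iter k (opT0 z) F.
Proof.
elim: s => [|a s IHs] /=.
  by rewrite big_ord_recl big_ord0 big_nil coef1 scale1r addr0.
rewrite IHs big_cons; set g := \prod_(_ <- s) _.
have gs : g`_(size s).+1 = 0 by rewrite nth_default // size_prod_XsubC.
under [RHS]eq_bigr => k _ do rewrite mulrBl coefB coefXM mul_polyC coefZ scalerBl.
rewrite sumrB [X in _ = X - _]big_ord_recl scale0r add0r; congr (_ - _).
  by rewrite linear_sum; apply: eq_bigr => k _; rewrite /= opT0Z.
rewrite [RHS]big_ord_recr /= gs mulr0 scale0r addr0 scaler_sumr.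
by apply: eq_bigr => k _; rewrite scalerA.
Qed.

Lemma opT0_cyclotomic z F : reduced_series F ->
  foldr (fun k G => opT0 z G - Q k *: G) F (index_enum 'I_r.+1) = 0.
Proof.
move=> FM; have := foldr_opT0 (map Q (index_enum 'I_r.+1)) z F.
rewrite foldr_map size_map big_map -[size _]sum1_size sum1_card card_ord => ->.
exact: opT0_Cayley_Hamilton.
Qed.

Section Braid4.
Variable i : 'I_n.
Hypothesis i_gt0 : (0 < i)%N.
Let z := ord_pred i.
Let T := opT i.
Let T0 := opT0 z.
Let zi : z != i := ord_pred_neq i_gt0.
Let iz : i != z. Proof. by rewrite eq_sym zi. Qed.

(** The relation X_i = T_i X_z T_i of the affine Hecke algebra.  Only the values
    of [A] on series of degree less than [r] in X_z enter, so it applies to operators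
    that agree with X_z as long as no exponent overflows. *)
Lemma opT_conj_X (A : series -> series) F :
    (forall G, ltdeg z r G -> reduced_series G -> A G = opX z G) ->
  reduced_series F -> ltdeg i r F -> opT i (A (opT i F)) = opX i F.
Proof.
move=> AX FM Fi; rewrite AX; last exact: reduced_opT; last first.
  exact: ltdeg_opT_pred.
rewrite opT_X_pred // opT_quad //.
by apply/seriesP => f w; rewrite !op_linE !seriesE; ring.
Qed.

(** The operator of L_2 when X_z is the first variable.  The braid relation says that
    its commutator with the operator of T_0 vanishes. *)
Let Y F := T (T0 (T F)).
Let Delta F := T0 (Y F) - Y (T0 F).

Let linE := (@opTD R n c, @opTN R n c, @opTZ R n c, opT0D, opT0N, opT0Z).

Let Delta_T F : Delta (T F) = c *: Delta F - T (Delta F).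
Proof.
rewrite /Delta /Y /T /T0 opT_quad // !linE opT_quad //.
by apply/seriesP => f w; rewrite !seriesE; ring.
Qed.

Let YD F G : Y (F + G) = Y F + Y G.
Proof. by rewrite /Y /T /T0 !linE. Qed.

Let DeltaD F G : Delta (F + G) = Delta F + Delta G.
Proof. by rewrite /Delta YD /T0 !opT0D YD opprD addrACA. Qed.

Let reduced_Y F : reduced_series F -> reduced_series (Y F).
Proof. by move=> FM; apply/reduced_opT/reduced_opT0/reduced_opT. Qed.

Let Y_X F : reduced_series F -> ltdeg i r F -> Y F = opX i F.
Proof. by apply: opT_conj_X => G Gz _; exact: opT0_ltdeg. Qed.

Let Delta_good F : reduced_series F -> ltdeg i r F -> Delta F = 0.
Proof.
move=> FM Fi; rewrite /Delta Y_X // Y_X; first by rewrite /T0 /opX opT0_opZ ?subrr.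
  exact: reduced_opT0.
exact: ltdeg_opT0.
Qed.

Let DeltaZ a F : Delta (a *: F) = a *: Delta F.
Proof. by rewrite /Delta /Y /T /T0 !linE scalerBr. Qed.

Let upd2_id f : upd2 f i (f z) (f i) = f.
Proof. by apply/funext => k; rewrite /upd2 -/z; do 2?case: eqP => [->|_]. Qed.

(** If F has degree [r] in X_i but smaller degree in X_z, then [T F] equals
    [c *: F] up to smaller degree in X_i, so that [Delta_T] forces
    [T (Delta F) = 0]; and T is injective by its quadratic relation. *)
Let Delta_top F : reduced_series F -> ltdeg z r F ->
  (forall f w, f i != r -> F f w = 0) -> Delta F = 0.
Proof.
move=> FM Fz Fi; have TF : Delta (T F - c *: F) = 0.
  apply: Delta_good => [j|].
    by apply: ltdegD; [exact: reduced_opT | apply/ltdegN/ltdegZ].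
  move=> f w rf; rewrite !seriesE; have [fr|rf'] := leqP (f i) r; last first.
    by rewrite (@reduced_opT _ _ i_gt0 FM i) // (FM i) // mulr0 subrr.
  have fE : f i = r by apply/eqP; rewrite eqn_leq fr.
  rewrite /T opTE !seriesE opSE !(Fz (swapx f i)); try by rewrite swapx_pred.
  rewrite mulr0 !add0r opDE /demazure2 -/z -mulrBr.
  rewrite (_ : \sum_(_ < _) _ = F f w) ?subrr ?mulr0 //.
  have upd_i a b : upd2 f i a b i = b.
    by rewrite /upd2 eqxx eq_sym (negPf (ord_pred_neq i_gt0)).
  have term (k : nat) : (k < minn (f z).+1 (f i))%N -> (k != f z)%N ->
      F (upd2 f i k (f z + f i - k)) w - F (upd2 f i (f z + f i - k) k) w = 0.
    by rewrite leq_min => /andP[kz ki] kf; rewrite !Fi ?subrr // upd_i; lia.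
  have [zr|rz] := ltnP (f z) r; last first.
    rewrite (Fz f) // big1 // => k _; apply: term => //.
    by have := ltn_ord k; rewrite ltn_min => /andP[_]; lia.
  have zm : (f z < minn (f z).+1 (f i))%N by rewrite fE; lia.
  rewrite (bigD1 (Ordinal zm)) //= addKn upd2_id (Fi (upd2 _ _ _ _)); last first.
    by rewrite upd_i; lia.
  rewrite subr0 big1 ?addr0 // => k kz; apply: term => //.
have TDF : T (Delta F) = 0.
  have := Delta_T F; rewrite -[T F in LHS](subrK (c *: F)) DeltaD TF add0r DeltaZ.
  by move/eqP; rewrite -subr_eq0 subKr => /eqP.
have := opT_quad c (Delta F) i_gt0; rewrite [opT i (Delta F)]TDF scaler0 addr0 => <-.
exact: linear0.
Qed.

Let reduced_opZ j (phi : nat -> R) F : reduced_series F ->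
  reduced_series (opZ j phi id F).
Proof. by move=> FM k f w fk; rewrite opZE setx_id (FM k) ?mulr0. Qed.

Let Delta_z F : reduced_series F -> ltdeg z r F -> Delta F = 0.
Proof.
move=> FM Fz.
have -> : F = opZ i (fun a => (a < r)%N%:R) id F + opZ i (fun a => (a == r)%:R) id F.
  apply/seriesP => f w; rewrite seriesE !opZE setx_id -mulrDl.
  have [fr|fr|fr] := ltngtP (f i) r; rewrite ?addr0 ?add0r ?mul1r //.
  by rewrite (FM i) ?mulr0.
rewrite DeltaD Delta_good ?Delta_top ?addr0 //; try exact: reduced_opZ.
- by apply: ltdeg_opZ.
- by move=> f w fr; rewrite opZE (negPf fr) mul0r.
- by move=> f w fr; rewrite opZE ltnNge fr mul0r.
Qed.

(** Commutation of [opT0 z] with [Y].  The part of top degree in X_z is an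
    [r]-th power of [opT0 z] applied to a series constant in X_z; there [Y]
    commutes with the lower powers, and the Cayley-Hamilton identity expresses the
    power of exponent r.+1 in terms of them. *)
Lemma opT_braid4 F : reduced_series F ->
  opT0 z (opT i (opT0 z (opT i F))) = opT i (opT0 z (opT i (opT0 z F))).
Proof.
move=> FM; suff : Delta F = 0 by move/eqP; rewrite subr_eq0 => /eqP.
pose F0 := opZ z (fun a => (a == 0%N)%:R) (fun=> r) F.
have F01 : ltdeg z 1 F0 by move=> f w fz; rewrite opZE gtn_eqF ?mul0r.
have F0M : reduced_series F0.
  move=> j; have [->|jz] := eqVneq j z; last exact: ltdeg_opZ.
  exact: ltdeg_leq F01.
have iterM k G : reduced_series G -> reduced_series (iter k T0 G).
  by move=> GM; elim: k => //= k; exact: reduced_opT0.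
have -> : F = opZ z (fun a => (a < r)%N%:R) id F + iter r T0 F0.
  apply/seriesP => f w; rewrite seriesE iter_opT0 // !opZE setxx setx_setx eqxx mul1r.
  rewrite setx_id; have [fr|fr|fr] := ltngtP (f z) r; rewrite ?mul1r ?mul0r ?addr0 ?add0r //.
    by rewrite (FM z).
  by rewrite -fr setx_id.
rewrite DeltaD Delta_z ?add0r; first last.
- by move=> f w fr; rewrite opZE ltnNge fr mul0r.
- exact: reduced_opZ.
have comm k : (k <= r)%N -> Y (iter k T0 F0) = iter k T0 (Y F0).
  elim: k => //= k IHk kr; rewrite -IHk ?(ltnW kr) //.
  apply/esym/eqP; rewrite -subr_eq0; apply/eqP/Delta_z; first exact: iterM.
  by move=> f w fr; rewrite iter_opT0 ?(ltnW kr) // opZE gtn_eqF ?mul0r // (leq_trans kr).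
have CH G : reduced_series G ->
    T0 (iter r T0 G) = - \sum_(k < r.+1) P`_k *: iter k T0 G.
  move=> GM; have := opT0_Cayley_Hamilton (GM z).
  rewrite /opT0_eval big_ord_recr /= cyclotomic_poly_lead scale1r addrC => /eqP.
  by rewrite addr_eq0 => /eqP.
have YN G : Y (- G) = - Y G by rewrite /Y /T /T0 !linE.
have YZ a G : Y (a *: G) = a *: Y G by rewrite /Y /T /T0 !linE.
rewrite /Delta comm // !CH //; last exact: reduced_Y.
rewrite YN opprK addrC (big_morph Y (id1 := 0) (op1 := +%R) YD); last first.
  by apply: (addrI (Y 0)); rewrite -YD !addr0.
apply/eqP; rewrite subr_eq0; apply/eqP/eq_bigr => k _.
by rewrite YZ comm // -ltnS.
Qed.

End Braid4.

End CyclotomicOperator.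

(** * The representation and linear independence *)

Section Action.
Variables (R : comUnitRingType) (n r : nat) (q : R) (Q : 'I_r.+1 -> R).
Hypothesis q_unit : q \is a GRing.unit.
Let c : R := q - q^-1.
Local Notation H := (ariki_koike n q Q).
Local Notation T := (akT n q Q).
Local Notation L := (akL n q Q).
Local Notation Lmon := (Lmon n q Q).
Local Notation Tw := (ak_Tw n q Q).
Local Notation series := (series R n).
Local Notation opT := (opT c).
Local Notation opT0 := (opT0 Q).
Local Notation reduced_series := (@reduced_series R n r).
Implicit Types (i j : 'I_n) (F G : series) (f : 'I_n -> nat) (w : 'S_n) (h : H).

Definition ak_op i : series -> series := if i == 0%N :> nat then opT0 i else opT i.

Fixpoint ak_act (x : ak_term R n) : series -> series :=
  match x with
  | AKGen i => ak_op i
  | AKCst a => fun F => a *: F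
  | AKAdd x y => fun F => ak_act x F + ak_act y F
  | AKMul x y => fun F => ak_act x (ak_act y F)
  end.

Lemma ak_actP x a F G : ak_act x (a *: F + G) = a *: ak_act x F + ak_act x G.
Proof.
elim: x F G => [i|b|x IHx y IHy|x IHx y IHy] F G /=.
- by rewrite /ak_op; case: eqP => _; rewrite linearP.
- by rewrite scalerDr !scalerA mulrC.
- by rewrite IHx IHy scalerDr addrACA.
- by rewrite IHy IHx.
Qed.

Lemma ak_actD x F G : ak_act x (F + G) = ak_act x F + ak_act x G.
Proof. by have := ak_actP x 1 F G; rewrite !scale1r. Qed.

Lemma ak_act0 x : ak_act x 0 = 0.
Proof. by apply: (addrI (ak_act x 0)); rewrite -ak_actD !addr0. Qed.

Lemma ak_actZ x a F : ak_act x (a *: F) = a *: ak_act x F.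
Proof. by have := ak_actP x a F 0; rewrite ak_act0 !addr0. Qed.

Lemma reduced_ak_act x F : reduced_series F -> reduced_series (ak_act x F).
Proof.
elim: x F => [i|b|x IHx y IHy|x IHx y IHy] F FM /=.
- rewrite /ak_op; case: eqP => [_|/eqP]; first exact: reduced_opT0.
  by rewrite -lt0n => i0; exact: reduced_opT.
- by move=> j; apply: ltdegZ; exact: FM.
- by move=> j; apply: ltdegD; [exact: IHx | exact: IHy].
- exact/IHx/IHy.
Qed.

Lemma ak_act_rel x y F : ak_rel q Q x y -> reduced_series F -> ak_act x F = ak_act y F.
Proof.
have op0 i G : i = 0%N :> nat -> ak_op i G = opT0 i G by rewrite /ak_op => ->.
have opS i G : (0 < i)%N -> ak_op i G = opT i G by rewrite /ak_op; case: (i : nat).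
case=> {x y} [i i0|i i0|i j i0 j1|i j i0 ij|i j ij] FM /=.
- rewrite scale0r -(opT0_cyclotomic Q i FM).
  elim: (index_enum _) => [|k s IHs]; first by rewrite big_nil /= scale1r.
  by rewrite big_cons /= IHs scaleNr op0.
- rewrite !opS // opTD opTZ opT_quad // scale0r.
  apply/seriesP => f w; rewrite !seriesE /c.
  have -> : - q * (opT i F f w + q^-1 * F f w) = - q * opT i F f w - F f w.
    by rewrite !mulNr mulrDr mulrA mulrV // mul1r opprD.
  by ring.
- have ji : ord_pred j = i by apply: ord_inj; rewrite ord_predE ?j1 ?i0.
  have j0 : (0 < j)%N by rewrite j1.
  by rewrite !(op0 i) // !(opS j) // -ji; exact: opT_braid4.
- have j0 : (0 < j)%N by rewrite ij.
  by rewrite !opS //; apply: opT_braid3.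
wlog {ij} ij : i j / (i.+1 < j)%N.
  by move=> wl; case/orP: ij => ij; [|symmetry]; exact: wl.
have j0 : (0 < j)%N by lia.
rewrite !(opS j) //; have [i0|i0] := posnP i; last by rewrite !opS // opT_comm.
by rewrite !(op0 i) // opT_opT0 //; apply: ord_inj_neq; rewrite ?ord_predE; lia.
Qed.

Lemma ak_act_cong x y F : ak_cong q Q x y -> reduced_series F -> ak_act x F = ak_act y F.
Proof.
move=> xy; elim: xy F => {x y} [x y xy|x|x y _ IH|x y z _ IH1 _ IH2|x x' y y' _ IHx _ IHy|
  x x' y y' _ IHx _ IHy|x y z|x y|x|x y z|x|x|x y z|x y z|a b|a b|a x] F FM //=.
- exact: ak_act_rel.
- by rewrite IH.
- by rewrite IH1 // IH2.
- by rewrite IHx // IHy.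
- by rewrite IHy // IHx //; exact: reduced_ak_act.
- by rewrite addrA.
- by rewrite addrC.
- by rewrite scale0r add0r.
- by rewrite scale1r.
- by rewrite !scale0r.
- by rewrite ak_actD.
- by rewrite scalerDl.
- by rewrite scalerA.
- by rewrite ak_actZ.
Qed.

Definition hact h : series -> series := ak_act (repr h).

Lemma hact_pi x F : reduced_series F -> hact (\pi_H x)%qT F = ak_act x F.
Proof. by apply: ak_act_cong; exact: ak_repr. Qed.

Lemma hactD h h' F : reduced_series F -> hact (h + h') F = hact h F + hact h' F.
Proof. by move=> FM; rewrite [h + h']/(ak_add _ _) hact_pi. Qed.

Lemma hactM h h' F : reduced_series F -> hact (h * h') F = hact h (hact h' F).
Proof. by move=> FM; rewrite [h * h']/(ak_mul _ _) hact_pi. Qed.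

Lemma hactZ a h F : reduced_series F -> hact (a *: h) F = a *: hact h F.
Proof. by move=> FM; rewrite [a *: h]/(ak_scale _ _) hact_pi. Qed.

Lemma hact1 F : reduced_series F -> hact 1 F = F.
Proof. by move=> FM; rewrite -[1 : H]/(\pi_H (AKCst 1))%qT hact_pi //= scale1r. Qed.

Lemma hact0 F : reduced_series F -> hact 0 F = 0.
Proof. by move=> FM; rewrite -(scale0r (0 : H)) hactZ // scale0r. Qed.

Lemma hact_sum (I : Type) (s : seq I) (P : pred I) (h : I -> H) F : reduced_series F ->
  hact (\sum_(i <- s | P i) h i) F = \sum_(i <- s | P i) hact (h i) F.
Proof.
move=> FM; elim: s => [|i s IHs]; first by rewrite !big_nil hact0.
by rewrite !big_cons; case: (P i) => //; rewrite hactD // IHs.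
Qed.

Lemma reduced_hact h F : reduced_series F -> reduced_series (hact h F).
Proof. exact: reduced_ak_act. Qed.

Lemma hactT i F : reduced_series F -> hact (T i) F = ak_op i F.
Proof. by move=> FM; rewrite akT_gen /ak_gen hact_pi. Qed.

Lemma hactT_gt0 i F : (0 < i)%N -> reduced_series F -> hact (T i) F = opT i F.
Proof. by move=> i0 FM; rewrite hactT // /ak_op; case: (i : nat) i0. Qed.

(** As long as no exponent overflows, the Jucys-Murphy elements act by shifting
    exponents, exactly as the polynomial generators of the affine Hecke algebra. *)
Lemma hactL i F : reduced_series F -> ltdeg i r F -> hact (L i.+1) F = opX i F.
Proof.
move: {2}(i : nat) (erefl (i : nat)) => k; elim: k => [|k IHk] in i F *.
  move=> i0 FM Fi; rewrite i0 akL1 -i0 hactT // /ak_op i0 eqxx.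
  exact: opT0_ltdeg.
move=> ik FM Fi; have i0 : (0 < i)%N by rewrite ik.
have ipE := ord_predE i0.
have LE : L i.+1 = T i * L (ord_pred i).+1 * T i by rewrite akLS // ipE prednK.
have TM : reduced_series (opT i F) by exact: reduced_opT.
have LM : reduced_series (hact (L (ord_pred i).+1) (opT i F)) by exact: reduced_hact.
rewrite LE hactM // hactT_gt0 // hactM // hactT_gt0 //.
apply: opT_conj_X => // G Gp GM; apply: IHk => //.
by rewrite ipE ik.
Qed.

(** The second half of the conclusion bounds the degrees on the way, so that
    [hactL] applies to each factor. *)
Lemma hactLX i k b F : reduced_series F -> ltdeg i b F -> (b + k <= r.+1)%N ->
  hact (L i.+1 ^+ k) F = iter k (opX i) F /\ ltdeg i (b + k) (iter k (opX i) F).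
Proof.
move=> FM Fb; elim: k => [|k IHk] bk; first by rewrite addn0 expr0 hact1.
have {IHk}[|IH1 IH2] := IHk; first lia.
rewrite exprS hactM // IH1 hactL; first last.
- by apply: ltdeg_leq IH2; lia.
- by rewrite -IH1; exact: reduced_hact.
by split=> //; rewrite addnS; exact: ltdeg_opX.
Qed.

Definition mono f w : series :=
  Series (fun f' w' => ([forall j, f j == f' j] && (w == w'))%:R).

Lemma monoE f w f' w' : mono f w f' w' = ([forall j, f j == f' j] && (w == w'))%:R.
Proof. by []. Qed.

Lemma mono_ltdeg f w j b : (f j < b)%N -> ltdeg j b (mono f w).
Proof.
move=> fj f' w' bf'; rewrite monoE; case: forallP => // /(_ j) /eqP E.
by rewrite E ltnNge bf' in fj.
Qed.

Lemma mono_reduced f w : (forall j, f j <= r)%N -> reduced_series (mono f w).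
Proof. by move=> fr j; apply: mono_ltdeg; rewrite ltnS. Qed.

Lemma opX_mono j f w : opX j (mono f w) = mono (setx f j (f j).+1) w.
Proof.
apply/seriesP => f' w'; rewrite monoE; case E : (f' j) => [|a].
  rewrite opX0 //; case: forallP => // /(_ j); rewrite setxx E => /eqP //.
rewrite (opXS _ _ E) monoE; congr (_ && _)%:R.
apply/forallP/forallP => H' k; have /eqP := H' k; rewrite /setx.
  by case: (eqVneq k j) => [->|kj] ->; rewrite ?E.
by case: (eqVneq k j) => [->|kj] => [|->//]; rewrite E => -[->].
Qed.

Lemma iter_opX_mono j f w k : iter k (opX j) (mono f w) = mono (setx f j (f j + k)) w.
Proof.
elim: k => [|k IHk] /=; first by rewrite addn0 setx_id.
by rewrite IHk opX_mono setxx setx_setx addnS.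
Qed.

Lemma hact_Lmon_mono m (g : nat -> nat) f w : (m <= n)%N -> (forall j, f j <= r)%N ->
    (forall j : 'I_n, (j < m)%N -> f j = 0%N) -> (forall j : nat, (j < m)%N -> g j <= r)%N ->
  hact (Lmon m g) (mono f w) = mono (fun j => if (j < m)%N then g j else f j) w.
Proof.
elim: m f => [|m IHm] f mn fr f0 gr.
  by rewrite /Lmon big_ord0 hact1 //; exact: mono_reduced.
have fM : reduced_series (mono f w) by exact: mono_reduced.
pose j := Ordinal mn.
have f1 : ltdeg j 1 (mono f w) by apply: mono_ltdeg; rewrite f0.
have gm : (1 + g m <= r.+1)%N by rewrite add1n ltnS gr.
have [EL _] := hactLX fM f1 gm.
rewrite {1}/Lmon big_ord_recr /= -/(Lmon m g) hactM // [hact (_ ^+ _) _]EL.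
rewrite iter_opX_mono f0 ?ltnSn // add0n IHm.
- congr mono; apply/funext => k; rewrite ltnS [(k <= m)%N]leq_eqVlt /setx -val_eqE /=.
  by case: eqP => [->|_] //=; rewrite ?ltnn.
- exact: ltnW.
- by move=> k; rewrite /setx; case: eqP => // _; exact: gr.
- move=> k km; rewrite setx_neq ?f0 //; first exact: ltnW.
  by apply: ord_inj_neq => /= E; rewrite E ltnn in km.
- by move=> k km; apply/gr/ltnW.
Qed.

Definition vac : series := mono (fun=> 0%N) 1%g.

Lemma vac_reduced : reduced_series vac.
Proof. exact: mono_reduced. Qed.

(** Each letter of a reduced word lengthens the product of the letters after it, and
    in that case T_i acts on the regular representation as left multiplication by
    s_i. *)
Lemma hact_Tw_vac w : hact (Tw w) vac = mono (fun=> 0%N) w.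
Proof.
suff Ts s u : reduced u s -> hact (\prod_(i <- s) T i) vac = mono (fun=> 0%N) u.
  exact/Ts/reduced_wordP.
elim: s u => {w} [|i s IHs] w.
  by move=> [/andP[_ /eqP <-] _]; rewrite !big_nil hact1 //; exact: vac_reduced.
move=> /reduced_cons[i0 wi ws]; rewrite !big_cons hactM; last exact: vac_reduced.
rewrite (IHs _ ws) hactT_gt0 //; last exact: mono_reduced.
apply/seriesP => f u; rewrite opT_constE // => [|j]; last exact: mono_ltdeg.
rewrite !monoE (inj_eq (mulgI _)); case: ifP => ui; rewrite ?mul0r ?addr0 //.
suff /negPf -> : (simple_refl i * w != u)%g by rewrite andbF mulr0 addr0.
by apply: contraL ui => /eqP <-; rewrite left_descent_mul // wi.
Qed.

End Action.

Section Rebuild.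
Variables (R : comUnitRingType) (n r : nat) (q : R) (Q : 'I_r.+1 -> R).
Hypothesis q_unit : q \is a GRing.unit.
Local Notation H := (ariki_koike n q Q).
Local Notation Lmon := (Lmon n q Q).
Local Notation Tw := (ak_Tw n q Q).
Local Notation series := (series R n).
Local Notation vac := (vac R n).

(** The exponents in [Lmon] are indexed by all natural numbers. *)
Definition extend_exp (f : 'I_n -> nat) (k : nat) := oapp f 0%N (insub k).

Lemma Lmon_extend (f : nat -> nat) : Lmon n (extend_exp (fun j => f j)) = Lmon n f.
Proof. by apply: eq_bigr => j _; rewrite /extend_exp valK. Qed.

(** The linear map sending each monomial X^f at [w] to L^f T_w.  As a left inverse of
    the map sending [h] to [hact h vac], it gives the linear independence of the
    L^f T_w. *)
Definition rebuild (F : series) : H :=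
  \sum_(f : {ffun 'I_n -> 'I_r.+1}) \sum_(w : 'S_n)
     F (fun j => f j : nat) w *: (Lmon n (extend_exp (fun j => f j)) * Tw w).

Lemma rebuildD F G : rebuild (F + G) = rebuild F + rebuild G.
Proof.
rewrite -big_split; apply: eq_bigr => f _; rewrite -big_split.
by apply: eq_bigr => w _; rewrite seriesE scalerDl.
Qed.

Lemma rebuildZ a F : rebuild (a *: F) = a *: rebuild F.
Proof.
rewrite scaler_sumr; apply: eq_bigr => f _; rewrite scaler_sumr.
by apply: eq_bigr => w _; rewrite seriesE scalerA.
Qed.

Lemma rebuild0 : rebuild 0 = 0.
Proof. by rewrite -(scale0r (0 : series)) rebuildZ scale0r. Qed.

Lemma rebuild_mono f d : (forall j, f j <= r)%N ->
  rebuild (mono R f d) = Lmon n (extend_exp f) * Tw d.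
Proof.
move=> fr; pose f0 : {ffun 'I_n -> 'I_r.+1} := [ffun j => inord (f j)].
have f0E j : f0 j = f j :> nat by rewrite ffunE inordK // ltnS.
rewrite /rebuild (bigD1 f0) //= [X in _ + X]big1 => [|f1 f1f0]; last first.
  apply: big1 => w _; rewrite monoE; case: forallP => [E|]; rewrite ?scale0r //.
  case/eqP: f1f0; apply/ffunP => j; apply: ord_inj; rewrite f0E.
  by rewrite (eqP (E j)).
rewrite addr0 (bigD1 d) //= big1 => [|w wd]; last first.
  by rewrite monoE [d == w]eq_sym (negPf wd) andbF scale0r.
rewrite monoE eqxx andbT addr0 (_ : [forall j, _]); last first.
  by apply/forallP => j; rewrite f0E.
rewrite scale1r; congr (Lmon n _ * _); congr extend_exp.
by apply/funext => j; rewrite f0E.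
Qed.

Lemma hact_LTmon (f : nat -> nat) d : (forall j, (j < n)%N -> (f j <= r)%N) ->
  hact (Lmon n f * Tw d) vac = mono R (fun j => f j) d.
Proof.
move=> fr; rewrite hactM //; last exact: vac_reduced.
rewrite hact_Tw_vac // hact_Lmon_mono //.
by congr mono; apply/funext => j; rewrite ltn_ord.
Qed.

Lemma rebuild_hact (B : set H) h :
    (forall b, B b -> exists f d, (forall j, (j < n)%N -> (f j <= r)%N) /\
       b = Lmon n f * Tw d) ->
  lspan B h -> rebuild (hact h vac) = h.
Proof.
have vacM : @reduced_series R n r vac by exact: vac_reduced.
move=> BE; elim=> [|a b v /BE[f [d [fr ->]]] _ IH].
  by rewrite hact0 // rebuild0.
rewrite hactD // hactZ // rebuildD rebuildZ IH hact_LTmon // rebuild_mono.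
  by rewrite Lmon_extend.
by move=> j; exact: fr.
Qed.

End Rebuild.

(** * Parabolic subgroups and distinguished coset representatives *)

Section Parabolic.
Variables (n : nat) (blk : 'I_n -> nat).
Hypothesis blk_mono : forall x y : 'I_n, (x <= y)%N -> (blk x <= blk y)%N.
Implicit Types (w u d : 'S_n) (i x y : 'I_n).

Definition same_block i := (0 < i)%N && (blk (ord_pred i) == blk i).
Definition stabilizes w := forall x, blk (w x) = blk x.
Definition distinguished d := forall i, same_block i -> ~~ left_descent d i.

Lemma stabilizesM u w : stabilizes u -> stabilizes w -> stabilizes (u * w)%g.
Proof. by move=> su sw x; rewrite permM sw su. Qed.

Lemma stabilizes1 : stabilizes 1%g.
Proof. by move=> x; rewrite perm1. Qed.

Lemma stabilizesV u : stabilizes u -> stabilizes u^-1%g.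
Proof. by move=> su x; rewrite -[in RHS](permKV u x) su. Qed.

Lemma stabilizes_simple i : (0 < i)%N -> stabilizes (simple_refl i) <-> same_block i.
Proof.
move=> i0; rewrite /same_block i0; split=> [/(_ i)|/eqP E x].
  by rewrite simple_refl_self => /eqP.
rewrite /simple_refl; case: tpermP => [->|->|//]; by rewrite E.
Qed.

Lemma stabilizes_descent w i : (0 < i)%N -> stabilizes w -> left_descent w i ->
  same_block i.
Proof.
move=> i0 sw wi; rewrite /same_block i0 eqn_leq blk_mono ?ord_predE ?leq_pred //.
by rewrite -[blk i]sw -[blk (ord_pred i)]sw blk_mono // ltnW.
Qed.

Lemma reduced_same_block w s : stabilizes w -> reduced w s -> all same_block s.
Proof.
elim: s w => //= i s IHs w sw /reduced_cons[i0 wi ws].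
have Pi := stabilizes_descent i0 sw wi; rewrite Pi.
by apply: (IHs _ _ ws); apply: stabilizesM => //; apply/stabilizes_simple.
Qed.

Lemma stabilizes_word s : all same_block s -> stabilizes (\prod_(i <- s) simple_refl i)%g.
Proof.
elim: s => [_|i s IHs /= /andP[Pi Ps]]; first by rewrite big_nil; exact: stabilizes1.
rewrite big_cons; apply: stabilizesM; last exact: IHs.
by apply/stabilizes_simple => //; case/andP: Pi.
Qed.

(** Blocks are intervals since [blk] is monotone, so increasing at neighbours within
    blocks means increasing on blocks. *)
Lemma distinguished_lt d x y : distinguished d -> (x < y)%N -> blk x = blk y ->
  (d x < d y)%N.
Proof.
move=> dD; move: {2}(y : nat) (erefl (y : nat)) => k.
elim: k y => [|k IHk] y yk; rewrite yk // ltnS => xk E.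
have y0 : (0 < y)%N by rewrite yk.
have yp : ord_pred y = k :> nat by rewrite ord_predE // yk.
have Ep : blk (ord_pred y) = blk y.
  apply/eqP; rewrite eqn_leq blk_mono ?yp ?yk //.
  by rewrite -E blk_mono // yp.
have dy : (d (ord_pred y) < d y)%N.
  have : ~~ left_descent d y by apply: dD; rewrite /same_block y0 Ep eqxx.
  rewrite /left_descent -leqNgt leq_eqVlt => /orP[/eqP/ord_inj/perm_inj E'|//].
  by have := ord_pred_neq y0; rewrite E' eqxx.
move: xk; rewrite leq_eqVlt => /orP[/eqP xk|xk].
  by have -> : x = ord_pred y by apply: ord_inj; rewrite yp.
by apply: ltn_trans dy; apply: IHk => //; rewrite ?yp // E Ep.
Qed.

(** Distinguished elements are unique in their cosets: a descent of [u] would be one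
    of [u * d], since [d] preserves the order within blocks. *)
Lemma distinguished_uniq u d : stabilizes u -> distinguished d ->
  distinguished (u * d)%g -> u = 1%g.
Proof.
move=> su dD udD; apply/eqP/negPn/negP => /left_descent_exists[i i0 ui].
have Pi := stabilizes_descent i0 su ui; have := udD i Pi.
rewrite /left_descent !permM -leqNgt leqNgt => /negP; apply.
apply: distinguished_lt => //; rewrite !su.
by case/andP: Pi => _ /eqP.
Qed.

End Parabolic.

Lemma odd_perm_length n (w : 'S_n) : odd_perm w = odd (perm_length w).
Proof.
have /reducedE[/andP[wp /eqP wE] <-] := reduced_wordP w.
rewrite -[in LHS]wE; elim: (reduced_word w) wp => [_|i s IHs] /=.
  by rewrite big_nil odd_perm1.
by move=> /andP[i0 sp]; rewrite big_cons odd_mul_tperm ord_pred_neq // IHs.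
Qed.

(** The two lengths differ by at most one, and by their parity they are not equal. *)
Lemma perm_length_mulr n (w : 'S_n) (i : 'I_n) : (0 < i)%N ->
  perm_length (w * simple_refl i) = (perm_length w).+1 \/
  perm_length w = (perm_length (w * simple_refl i)).+1.
Proof.
move=> i0.
have le1 v : (perm_length (v * simple_refl i)%g <= (perm_length v).+1)%N.
  have /reducedE[ve <-] := reduced_wordP v.
  have ie : expression (simple_refl i) [:: i].
    by rewrite /expression /= i0 big_seq1 eqxx.
  by have := perm_length_le (expressionM ve ie); rewrite size_cat addn1.
have := le1 w; have := le1 (w * simple_refl i)%g.
rewrite -mulgA simple_reflK mulg1.
have : odd (perm_length (w * simple_refl i)%g) = ~~ odd (perm_length w).
  by rewrite -!odd_perm_length odd_permM odd_tperm ord_pred_neq // addbT.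
case: (ltngtP (perm_length w) (perm_length (w * simple_refl i)%g)) => [ab|ab|->].
- by move=> _ _ ba; left; apply/eqP; rewrite eqn_leq ba.
- by move=> _ ba _; right; apply/eqP; rewrite eqn_leq ba.
- by case: (odd _).
Qed.

(** * The annihilator of the generator of a parabolic module *)

Section Annihilator.
Variables (R : comUnitRingType) (n r : nat) (q : R) (Q : 'I_r.+1 -> R).
Hypothesis q_unit : q \is a GRing.unit.
Hypothesis Q_unit : forall k, Q k \is a GRing.unit.
Let c : R := q - q^-1.
Local Notation H := (ariki_koike n q Q).
Local Notation T := (akT n q Q).
Local Notation L := (akL n q Q).
Local Notation Lmon := (Lmon n q Q).
Local Notation Tw := (ak_Tw n q Q).
Local Notation series := (series R n).
Local Notation vac := (vac R n).
Local Notation comm := GRing.comm.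
Local Notation reduced_series := (@reduced_series R n r).
Implicit Types (u w d : 'S_n) (F G : series).

Variable blk : 'I_n -> nat.
Hypothesis blk_mono : forall x y : 'I_n, (x <= y)%N -> (blk x <= blk y)%N.
Variable W : {set 'S_n}.
Hypothesis WE : forall w, (w \in W) <-> stabilizes blk w.
Local Notation inP := (same_block blk).

(* [g j] is the bound for the exponent of L_(j+1). *)
Variable g : nat -> nat.
Hypothesis g_mono : forall i j, (i <= j)%N -> (j < n)%N -> (g i <= g j)%N.
Hypothesis g_bnd : forall j, (j < n)%N -> (0 < g j <= r.+1)%N.
Hypothesis g_blk : forall i, inP i -> g i.-1 = g i.

Definition parabolic_sum : H := \sum_(w in W) q ^+ perm_length w *: Tw w.

(** The parameters are extended by 0 to all natural numbers, which allows products
    over intervals to be split. *)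
Definition Lfactor k : H := \prod_(i < n | (g i <= k)%N) (L i.+1 - (oapp Q 0 (insub k))%:A).
Definition Lprod : H := \prod_(k < r.+1) Lfactor k.

(** The cosets {w, w s_i} with w s_i longer than w contribute
    q^l(w) T_w (1 + q T_i), and (1 + q T_i) (T_i - q) = 0. *)
Lemma parabolic_sum_mulT i : inP i -> parabolic_sum * (T i - q%:A) = 0.
Proof.
move=> Pi; have i0 : (0 < i)%N by case/andP: Pi.
have Wi w : (w * simple_refl i \in W)%g = (w \in W).
  have si : stabilizes blk (simple_refl i) by apply/stabilizes_simple.
  apply/idP/idP => /WE ws; apply/WE; last exact: stabilizesM.
  by rewrite -[w]mulg1 -(simple_reflK i) mulgA; exact: stabilizesM.
pose asc w := (perm_length w < perm_length (w * simple_refl i)%g)%N.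
have ascN w : asc (w * simple_refl i)%g = ~~ asc w.
  rewrite /asc -mulgA simple_reflK mulg1.
  by have := perm_length_mulr w i0; lia.
have TwT w : asc w -> Tw (w * simple_refl i)%g = Tw w * T i.
  move=> aw; have /reducedE[we wl] := reduced_wordP w.
  have ie : expression (simple_refl i) [:: i] by rewrite /expression /= i0 big_seq1 eqxx.
  rewrite (@ak_Tw_reduced R n r q Q _ (reduced_word w ++ [:: i])).
    by rewrite big_cat big_seq1.
  apply/reducedE; split; first exact: expressionM.
  by rewrite size_cat wl addn1; move: aw; have := perm_length_mulr w i0; rewrite /asc; lia.
have -> : parabolic_sum = \sum_(w in W | asc w)
    (q ^+ perm_length w *: Tw w * (1 + q *: T i)).
  rewrite /parabolic_sum (bigID asc) /=.
  rewrite [X in _ + X](reindex_inj (mulIg (simple_refl i))) /=.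
  rewrite [X in _ + X](eq_bigl (fun w => (w \in W) && asc w)); last first.
    by move=> w; rewrite Wi ascN negbK.
  rewrite -big_split; apply: eq_bigr => w /andP[_ aw] /=.
  have -> : perm_length (w * simple_refl i)%g = (perm_length w).+1.
    by move: aw; have := perm_length_mulr w i0; rewrite /asc; lia.
  by rewrite TwT // mulrDr mulr1 -scalerAl -scalerAr scalerA exprSr.
rewrite mulr_suml big1 // => w _; rewrite -mulrA.
suff -> : (1 + q *: T i) * (T i - q%:A) = 0 by rewrite mulr0.
have TT : T i * T i = 1 + c *: T i by apply: akT_quad; rewrite ?i0 ?ltn_ord.
have qc : q * c = q * q - 1 by rewrite /c mulrBr divrr.
rewrite mulrDl mul1r mulrBr -!scalerAl TT -scalerAr mulr1 scalerDr !scalerA qc.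
rewrite scalerBl scale1r; move: (T i) (_ *: T i) (q%:A) => t x a.
by rewrite (addrC x) !addrA addrK subrK subrr.
Qed.

Lemma comm_scalar (x : H) (a : R) : comm x a%:A.
Proof. by rewrite /comm -scalerAl -scalerAr mul1r mulr1. Qed.

Lemma comm_L_Lfactor k (j : nat) : (0 < j)%N -> comm (L j) (Lfactor k).
Proof.
move=> j0; apply: commr_prod => i _; apply: commrB; last exact: comm_scalar.
exact: comm_L.
Qed.

(** By the hypothesis on [g], the factor is symmetric in L_i and L_(i+1); such
    polynomials commute with T_i. *)
Lemma comm_T_Lfactor k (i : nat) : (0 < i < n)%N -> (g i.-1 <= k)%N = (g i <= k)%N ->
  comm (T i) (Lfactor k).
Proof.
case: i => // i /= lt_in Eg.
pose F (j : nat) : H := if (g j <= k)%N then L j.+1 - (oapp Q 0 (insub k))%:A else 1.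
have FE : Lfactor k = \prod_(0 <= j < n) F j.
  by rewrite /Lfactor big_mkcond big_mkord.
have FT j : j != i -> j != i.+1 -> comm (T i.+1) (F j).
  move=> ji jSi; rewrite /F; case: ifP => _; last exact: commr1.
  by apply: commrB; [apply: comm_T_L; lia | exact: comm_scalar].
rewrite FE (@big_cat_nat _ _ _ i) //=; last lia.
rewrite (@big_cat_nat _ _ _ i.+2 i) //=; last lia.
apply: commrM; first by rewrite big_nat; apply: commr_prod => j jb; apply: FT; lia.
apply: commrM; last by rewrite big_nat; apply: commr_prod => j jb; apply: FT; lia.
rewrite [\prod_(i <= _ < i.+2) _]big_ltn // big_nat1 /F -[(g i.+1 <= k)%N]Eg /=.
case: ifP => _; last by rewrite mul1r; exact: commr1.
set a := _%:A; have aC x : comm x a by exact: comm_scalar.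
have i0n : (0 < i.+1 < n)%N by [].
have T1 := T_L_self Q q_unit i0n; have T2 := T_L_succ Q q_unit i0n.
have LL : comm (L i.+1) (L i.+2) by exact: comm_L.
move: (L i.+1) (L i.+2) T1 T2 LL => x y tx ty xy.
have -> : (x - a) * (y - a) = x * y - a * (x + y) + a * a.
  by rewrite mulrBl !mulrBr mulrDr -(aC x) opprB opprD !addrA addrAC.
have tC z : comm (T i.+1) z -> comm (T i.+1) (a * z) by move=> tz; exact: commrM.
apply: commrD; last exact: tC; apply: commrB; last first.
  by apply: tC; rewrite /comm mulrDr mulrDl tx ty addrCA subrK.
rewrite /comm mulrA tx mulrBl -(mulrA y) ty mulrDr -scalerAl -scalerAr addrK.
by rewrite xy mulrA.
Qed.

Let Lf_ge k := \prod_(k <= l < r.+1) Lfactor l.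

Lemma Lprod_cat k : (k <= r.+1)%N -> exists x, Lprod = x * Lf_ge k.
Proof.
move=> kr; exists (\prod_(0 <= l < k) Lfactor l).
by rewrite /Lprod -(big_mkord xpredT Lfactor) (@big_cat_nat _ _ _ k).
Qed.

Lemma comm_Lf_ge x k : (forall l, (k <= l)%N -> comm x (Lfactor l)) -> comm x (Lf_ge k).
Proof. by move=> xL; rewrite /Lf_ge big_nat; apply: commr_prod => l /andP[/xL]. Qed.

(** Each [Lfactor l] with [k <= l] contains L_1 - Q_l = T_0 - Q_l; these factors
    complete [pQ k] to the cyclotomic relation. *)
Lemma Lf_ge_pQ k : (0 < n)%N -> (g 0%N <= k)%N -> (k <= r.+1)%N ->
  Lf_ge k * pQ n q Q k = 0.
Proof.
move=> n0; move: {2}(r.+1 - k)%N (erefl (r.+1 - k)%N) => e.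
elim: e k => [|e IHe] k ek gk kr.
  have -> : k = r.+1 by lia.
  by rewrite pQ_top // mulr0.
have kr' : (k < r.+1)%N by lia.
rewrite /Lf_ge big_ltn // -/(Lf_ge k.+1).
have -> : Lfactor k * Lf_ge k.+1 = Lf_ge k.+1 * Lfactor k.
  apply: comm_Lf_ge => l _; apply/commr_sym/commr_prod => i _.
  apply: commrB; last exact: comm_scalar.
  exact/commr_sym/comm_L_Lfactor.
have [x x0 ->] : exists2 x, comm x (T 0) &
    Lfactor k = x * (T 0 - (Q (Ordinal kr'))%:A).
  pose F (i : nat) : H := if (g i <= k)%N then L i.+1 - (oapp Q 0 (insub k))%:A else 1.
  exists (\prod_(1 <= i < n) F i).
    apply/commr_sym; rewrite big_nat; apply: commr_prod => i _; rewrite /F.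
    case: ifP => _; last exact: commr1.
    by apply: commrB; [exact: comm_T0_L | exact: comm_scalar].
  have -> : Lfactor k = \prod_(0 <= i < n) F i.
    by rewrite /Lfactor big_mkcond big_mkord.
  rewrite big_ltn // [F 0%N]/F gk akL1 insubT /=.
  apply/esym/commrB; last exact: comm_scalar.
  apply/commr_sym; rewrite big_nat; apply: commr_prod => i _; rewrite /F.
  case: ifP => _; last exact: commr1.
  by apply: commrB; [exact: comm_T0_L | exact: comm_scalar].
rewrite -!mulrA [_ * pQ _ _ _ _]comm_pQ; last first.
  by apply/commr_sym/commrB => //; exact: comm_scalar.
rewrite -pQS (comm_pQ _ x0) mulrA IHe ?mul0r //; first lia.
exact: leq_trans gk _.
Qed.

(** Each factor of [Lprod] of index at least [g j] contains the factors for
    L_1, ..., L_(j+1), hence commutes with [Tdown j.+1]. *)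
Lemma Lprod_akLk (j : nat) : (j < n)%N -> Lprod * akLk n q Q j.+1 (g j) = 0.
Proof.
move=> jn; have /andP[g0 gr] := g_bnd jn; have [x ->] := Lprod_cat gr.
have TL : comm (Lf_ge (g j)) (Tdown n q Q j.+1).
  rewrite /Tdown big_seq; apply: commr_prod => l; rewrite mem_rev mem_index_iota => lj.
  apply/commr_sym/comm_Lf_ge => k gk; apply: comm_T_Lfactor; first lia.
  by rewrite !(leq_trans (g_mono _ jn) gk) //; lia.
rewrite akLkE -(mulrA x) !(mulrA (Lf_ge _)) TL -(mulrA (Tdown _ _ _ _)).
by rewrite Lf_ge_pQ ?mulr0 ?mul0r ?mulr0 // ?g_mono //; lia.
Qed.

Lemma comm_T_Lprod i : inP i -> comm (T i) Lprod.
Proof.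
move=> Pi; apply: commr_prod => k _; apply: comm_T_Lfactor; last by rewrite g_blk.
by rewrite ltn_ord andbT; case/andP: Pi.
Qed.

Lemma annihilator_relations x :
    (exists2 i, inP i & x = T i - q%:A) \/
    (exists2 j : nat, (j < n)%N & x = akLk n q Q j.+1 (g j)) ->
  parabolic_sum * Lprod * x = 0.
Proof.
case=> [[i Pi ->]|[j jn ->]]; last by rewrite -mulrA Lprod_akLk // mulr0.
have TL : comm Lprod (T i - q%:A).
  by apply: commrB; [apply/commr_sym/comm_T_Lprod | exact: comm_scalar].
by rewrite -mulrA TL mulrA parabolic_sum_mulT // mul0r.
Qed.

(** Multiplication by X_i - Q_k, where [p] is the pair (k, i). *)
Definition shiftB (p : nat * 'I_n) F : series := opX p.2 F - oapp Q 0 (insub p.1) *: F.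

(** Each factor raises the degree in its variable by at most one, so no exponent
    overflows and every L_(i+1) acts as X_i. *)
Lemma hact_shiftB (ps : seq (nat * 'I_n)) b F : reduced_series F ->
    (forall i, ltdeg i (b i) F) ->
    (forall i, (b i + count (fun p => p.2 == i) ps <= r.+1)%N) ->
  hact (\prod_(p <- ps) (L p.2.+1 - (oapp Q 0 (insub p.1))%:A) : H) F =
    foldr shiftB F ps /\
  forall i, ltdeg i (b i + count (fun p => p.2 == i) ps) (foldr shiftB F ps).
Proof.
move=> FM Fb; elim: ps => [|p ps IHps] /= bps.
  by rewrite big_nil hact1 //; split=> // i; rewrite addn0.
have [|IH1 IH2] := IHps; first by move=> i; apply: leq_trans (bps i); rewrite leq_add2l leq_addl.
have GM : reduced_series (foldr shiftB F ps) by rewrite -IH1; exact: reduced_hact.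
rewrite big_cons hactM // IH1; split=> [|i].
  rewrite hactD // -scaleNr hactZ // hact1 // scaleNr hactL //.
  apply: ltdeg_leq (IH2 _); have := bps p.2.
  by rewrite eqxx add1n addnS ltnS.
apply: ltdegD; last by apply/ltdegN/ltdegZ; apply: ltdeg_leq (IH2 i); rewrite leq_add2l leq_addl.
have [<-|pi] := eqVneq p.2 i.
  by rewrite add1n addnS; apply: ltdeg_opX; exact: IH2.
by rewrite add0n; apply: ltdeg_opX_neq; [rewrite eq_sym | exact: IH2].
Qed.

(** The equation X_i F = a F with [a] invertible determines the coefficients of F to
    be 0, by induction on the exponent of X_i. *)
Lemma shiftB_inj p F w : (p.1 < r.+1)%N ->
  (forall f, shiftB p F f w = 0) -> forall f, F f w = 0.
Proof.
move=> pr F0 f; move: {2}(f p.2) (erefl (f p.2)) => a.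
have uQ : oapp Q 0 (insub p.1) \is a GRing.unit by rewrite insubT; exact: Q_unit.
have aI y : oapp Q 0 (insub p.1) * y = 0 -> y = 0.
  by move=> ay; apply: (mulrI uQ); rewrite ay mulr0.
elim: a f => [|a IHa] f fa; have := F0 f; rewrite /shiftB !seriesE.
  by rewrite opX0 // sub0r => /eqP; rewrite oppr_eq0 => /eqP/aI.
rewrite (opXS _ _ fa) IHa ?setxx // sub0r => /eqP.
by rewrite oppr_eq0 => /eqP/aI.
Qed.

Lemma foldr_shiftB_eq0 (ps : seq (nat * 'I_n)) F w :
  (forall f, F f w = 0) -> forall f, foldr shiftB F ps f w = 0.
Proof.
move=> F0; elim: ps => //= p ps IHps f.
rewrite /shiftB !seriesE IHps // mulr0 subr0; case E : (f p.2) => [|a].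
  by rewrite opX0.
by rewrite (opXS _ _ E) IHps.
Qed.

Lemma foldr_shiftB_inj (ps : seq (nat * 'I_n)) F w :
    all (fun p => p.1 < r.+1)%N ps ->
  (forall f, foldr shiftB F ps f w = 0) -> forall f, F f w = 0.
Proof.
elim: ps => //= p ps IHps /andP[pr psr] F0; apply: IHps => //.
exact: shiftB_inj F0.
Qed.

Definition Lprod_index : seq (nat * 'I_n) :=
  [seq (k, i) | k <- iota 0 r.+1, i <- [seq i : 'I_n <- index_enum 'I_n | (g i <= k)%N]].

Lemma LprodE :
  Lprod = \prod_(p <- Lprod_index) (L p.2.+1 - (oapp Q 0 (insub p.1))%:A).
Proof.
rewrite big_allpairs_dep /Lprod -(big_mkord xpredT Lfactor) /index_iota subn0.
by apply: eq_bigr => k _; rewrite big_filter.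
Qed.

Lemma Lprod_index_lt : all (fun p => p.1 < r.+1)%N Lprod_index.
Proof.
by apply/allP => _ /allpairsPdep[k [i [+ _ ->]]] /=; rewrite mem_iota.
Qed.

(** The variable X_i occurs r.+1 - g i times in [Lprod]: this is just enough not to
    exceed the largest exponent when the degree is less than [g i]. *)
Lemma count_Lprod_index (i : 'I_n) : (g i + count (fun p => p.2 == i) Lprod_index <= r.+1)%N.
Proof.
have /andP[_ gr] := g_bnd (ltn_ord i).
rewrite -sum1_count big_mkcond big_allpairs_dep.
rewrite (eq_bigr (fun k => (g i <= k : nat)%N)) => [|k _]; last first.
  rewrite big_filter big_mkcond (bigD1 i) //= eqxx big1 ?addn0; first by case: leqP.
  by move=> j ji; rewrite (negPf ji); case: ifP.
rewrite -[iota _ _]/(index_iota 0 r.+1).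
suff bnd m : (g i + \sum_(0 <= k < m) (g i <= k) <= maxn (g i) m)%N.
  by apply: leq_trans (bnd _) _; rewrite geq_max gr leqnn.
elim: m => [|m IHm]; first by rewrite big_geq // addn0 leq_max leqnn.
by rewrite big_nat_recr //=; case: (leqP (g i) m) IHm; lia.
Qed.

(** Expanding the letters of [s] one at a time, every term other than the product
    of all letters involves the values of [F] at [v^-1 * u] for a shorter [v]. *)
Lemma hact_word_top (s : seq 'I_n) u F : all inP s -> reduced_series F ->
    (forall t, all inP t -> (size t < size s)%N -> forall f,
       F f ((\prod_(i <- t) simple_refl i)^-1 * u)%g = 0) ->
  forall f, hact (\prod_(i <- s) T i) F f u =
    F (fun x => f ((\prod_(i <- s) simple_refl i)^-1%g x))
      ((\prod_(i <- s) simple_refl i)^-1 * u)%g.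
Proof.
elim: s u => [|i s IHs] u /=.
  move=> _ FM _ f; rewrite !big_nil hact1 // invg1 mul1g; congr (F _ u).
  by apply/funext => x; rewrite perm1.
move=> /andP[Pi Ps] FM F0 f; have i0 : (0 < i)%N by case/andP: Pi.
rewrite !big_cons hactM // hactT_gt0 //; last exact: reduced_hact.
set G := hact _ F; have Gu f' : G f' u = 0.
  rewrite /G IHs // => [|t Pt ts f'']; first by rewrite F0.
  by apply: F0 => //; exact: ltnW.
rewrite opTE !seriesE opSE opDE /demazure2 big1 => [|k _]; last by rewrite !Gu subrr.
rewrite Gu !mulr0 !addr0 /G IHs // => [|t Pt ts f'].
  rewrite invMg mulgA tpermV; congr (F _ _).
  by apply/funext => x; rewrite permM.
have := F0 (i :: t); rewrite /= Pi Pt big_cons invMg tpermV -mulgA.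
by apply.
Qed.

(** The coefficients at [w0 * d], with [w0] of maximal length in [W], are only
    reached from [d] through all letters of a reduced word of [w0]. *)
Lemma parabolic_sum_inj F : reduced_series F ->
    (forall f w, ~ distinguished blk w -> F f w = 0) ->
  hact parabolic_sum F = 0 -> F = 0.
Proof.
move=> FM Fd F0; have W1 : 1%g \in W by apply/WE; exact: stabilizes1.
case: (arg_maxnP (@perm_length n) W1) => w0 Ww0 w0max.
apply/seriesP => f d; rewrite seriesE.
have [dD|/Fd//] := pselect (distinguished blk d).
have sw0 : stabilizes blk w0 by apply/WE.
have Fv v f' : stabilizes blk v -> v != w0 -> F f' (v^-1 * (w0 * d))%g = 0.
  move=> sv vw0; apply: Fd => uD; case/eqP: vw0.
  have : (v^-1 * w0)%g = 1%g.
    apply: (distinguished_uniq blk_mono _ dD); last by rewrite -mulgA.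
    by apply: stabilizesM => //; exact: stabilizesV.
  by move=> /(congr1 (mulg v)); rewrite mulKVg mulg1.
have top w f' : w \in W -> hact (Tw w) F f' (w0 * d)%g =
    if w == w0 then F (fun x => f' (w0^-1%g x)) d else 0.
  move=> Ww; have sw : stabilizes blk w by apply/WE.
  have /reducedE[/andP[_ /eqP wE] wl] := reduced_wordP w.
  rewrite /ak_Tw hact_word_top // ?wE.
  - case: eqP => [->|/eqP ww0]; last exact: Fv.
    by rewrite mulKg.
  - exact: (reduced_same_block blk_mono sw (reduced_wordP w)).
  move=> t Pt tw f''; apply: Fv; first exact: stabilizes_word.
  apply/eqP => tE; have : (perm_length w0 <= size t)%N.
    apply: perm_length_le; rewrite /expression tE eqxx andbT.
    by apply: sub_all Pt => i /andP[].
  by rewrite leqNgt (leq_trans tw) // wl; exact: w0max.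
have := congr1 (fun G : series => G (fun x => f (w0 x)) (w0 * d)%g) F0.
rewrite /parabolic_sum hact_sum // series_sumE (bigD1 w0) //= big1 => [|w /andP[Ww ww0]].
  rewrite hactZ // !seriesE top // eqxx addr0 => E.
  have -> : f = (fun x => f (w0 (w0^-1%g x))) by apply/funext => x; rewrite permKV.
  by apply: (mulrI (unitrX (perm_length w0) q_unit)); rewrite E mulr0.
by rewrite hactZ // seriesE top // (negPf ww0) mulr0.
Qed.

Variable J : set H.
Hypothesis J_rideal : right_ideal J.
Hypothesis J_T : forall i : 'I_n, inP i -> J (T i - q%:A).
Hypothesis J_L : forall j, (j < n)%N -> J (akLk n q Q j.+1 (g j)).
Hypothesis J_ann : forall x, J x -> parabolic_sum * Lprod * x = 0.

(** Modulo [J], [h] may be taken to be a combination h' of the L^f T_d with f bounded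
    by [g] and [d] distinguished.  The series G = h' vac then has degree less than
    [g i] in X_i, so that [Lprod] acts on it by the injective multiplications by
    X_i - Q_k; the result is still supported on distinguished permutations, where
    [parabolic_sum] is injective too.  Hence G = 0, and h' = 0 by [rebuild_hact]. *)
Theorem annihilator_parabolic h : parabolic_sum * Lprod * h = 0 <-> J h.
Proof.
split=> [|/J_ann//].
have P0 i : inP i -> (0 < i)%N by case/andP.
have [y [h' [Jy Bh' ->]]] :=
  lspanU (rideal_LTmon q_unit J_rideal P0 J_T g_mono g_bnd J_L g_blk h).
have {}Jy : J y by exact: lspan_rideal Jy.
rewrite mulrDr J_ann // add0r => h0.
suff -> : h' = 0 by rewrite addr0.
have vacM : reduced_series vac by exact: vac_reduced.
have BE b : @LTmon R n r q Q inP g b -> exists f d,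
    (forall j, (j < n)%N -> (f j <= r)%N) /\ b = Lmon n f * Tw d.
  move=> [f [d [fg _ ->]]]; exists f, d; split=> // j jn.
  by have := fg j jn; have := g_bnd jn; lia.
rewrite -(rebuild_hact q_unit BE Bh'); set G := hact h' vac.
have GM : reduced_series G by exact: reduced_hact.
have [Gg Gd] : (forall i : 'I_n, ltdeg i (g i) G) /\
    (forall f w, ~ distinguished blk w -> G f w = 0).
  rewrite /G; elim: Bh' => [|a b v Bb _ [IH1 IH2]].
    by rewrite hact0 //; split=> [i|] f w _; rewrite seriesE.
  have [f [d [fg dD bE]]] := Bb.
  rewrite bE hactD // hactZ // hact_LTmon //; last first.
    by move=> j jn; have := fg j jn; have := g_bnd jn; lia.
  split=> [i|f' w wD].
    by apply: ltdegD; [apply/ltdegZ/mono_ltdeg/fg | exact: IH1].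
  rewrite !seriesE IH2 // monoE [d == w](_ : _ = false) ?andbF ?mulr0 ?addr0 //.
  by apply/eqP => dw; apply: wD; rewrite -dw.
have G0 : hact Lprod G = 0.
  have [LG _] := @hact_shiftB Lprod_index (fun i : 'I_n => g i) G GM Gg count_Lprod_index.
  apply: parabolic_sum_inj; first exact: reduced_hact.
    move=> f w wD; rewrite LprodE LG; apply: foldr_shiftB_eq0 => f'; exact: Gd.
  by rewrite -!hactM // h0 hact0.
suff -> : G = 0 by exact: rebuild0.
apply/seriesP => f w; rewrite seriesE; apply: foldr_shiftB_inj Lprod_index_lt _ f.
have [<- _] := @hact_shiftB Lprod_index (fun i : 'I_n => g i) G GM Gg count_Lprod_index.
by move=> f; rewrite -LprodE G0 seriesE.
Qed.

End Annihilator.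

(** * Multicompositions *)

Section Composition.
Implicit Types (sh : seq nat) (p t : nat).

Lemma reshape_index_lt sh p t : (t <= size sh)%N ->
  (reshape_index sh p < t)%N = (p < sumn (take t sh))%N.
Proof.
rewrite /reshape_index; elim: sh p t => [|k sh IHsh] p [|t] //= ts.
rewrite subn_eq0; case: (ltnP p k) => [pk|kp]; first by rewrite (leq_trans pk) // leq_addr.
by rewrite ltnS subSn // IHsh // -(ltn_subLR _ kp).
Qed.

Lemma reshape_index_mono sh p p' : (p <= p')%N ->
  (reshape_index sh p <= reshape_index sh p')%N.
Proof.
move=> pp'; have [ps|ps] := ltnP (reshape_index sh p') (size sh).
  rewrite -ltnS reshape_index_lt //; apply: leq_ltn_trans pp' _.
  by rewrite -reshape_index_lt.
apply: leq_trans ps; rewrite /reshape_index -[X in (_ <= X)%N](size_scanl subn p.+1).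
exact: find_size.
Qed.

Variables (n r : nat) (m : 'I_r.+1 -> nat) (mu : forall k : 'I_r.+1, (m k).-tuple nat).

Lemma mc_a_mono : {homo mc_a mu : k1 k2 / (k1 <= k2)%N}.
Proof.
move=> k1 k2 k12; rewrite /mc_a big_mkcond [leqRHS]big_mkcond leq_sum // => i _.
by case: ifP => // /leq_trans/(_ k12)->.
Qed.

(** As the components are unions of blocks, the bounds [mc_c mu j] will be constant on
    the blocks of the Young subgroup ([mc_c_block]). *)
Lemma mc_a_take k : (k <= r.+1)%N -> exists2 t,
  (t <= size (mc_concat mu))%N & mc_a mu k = sumn (take t (mc_concat mu)).
Proof.
move=> kr; pose s := flatten [seq tval (mu j) | j <- take k (enum 'I_r.+1)].
have E : mc_concat mu = s ++ flatten [seq tval (mu j) | j <- drop k (enum 'I_r.+1)].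
  by rewrite -flatten_cat -map_cat cat_take_drop.
exists (size s); first by rewrite E size_cat leq_addr.
rewrite E take_size_cat // sumn_flatten sumnE !big_map.
rewrite (big_nth ord0) size_takel ?size_enum_ord //.
pose F i := sumn (mu (nth ord0 (enum 'I_r.+1) i)).
rewrite (eq_big_nat _ _ (F2 := F)) => [|i /andP[_ ik]]; last by rewrite nth_take.
rewrite big_mkord (big_ord_widen _ F kr); apply: eq_bigr => i _.
by rewrite /F; congr (sumn (mu _)); apply: ord_inj; rewrite nth_enum_ord.
Qed.

Hypothesis mu_n : is_multicomposition n mu.

Lemma mc_a_top : mc_a mu r.+1 = n.
Proof. by rewrite -mu_n; apply: eq_bigl => i; rewrite ltn_ord. Qed.

Lemma mc_c_le j k : (1 <= j <= n)%N -> (mc_c mu j <= k)%N = (j <= mc_a mu k)%N.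
Proof.
move=> jn; have [[_ h1 h2] _] := (proj1 (mc_cP _ mu_n jn) (erefl (mc_c mu j)), I).
apply/idP/idP => [/mc_a_mono|jk]; first exact: leq_trans.
rewrite leqNgt; apply/negP => kc; move: h1; rewrite ltnNge.
by rewrite (leq_trans jk) // mc_a_mono //; case: (mc_c mu j) kc.
Qed.

Lemma mc_c_bounds j : (1 <= j <= n)%N -> (1 <= mc_c mu j <= r.+1)%N.
Proof. by move=> jn; have [] := proj1 (mc_cP _ mu_n jn) (erefl _). Qed.

Lemma mc_c_mono j1 j2 : (0 < j1)%N -> (j1 <= j2 <= n)%N -> (mc_c mu j1 <= mc_c mu j2)%N.
Proof.
move=> j1_gt0 /andP[j12 j2n]; have j1n : (1 <= j1 <= n)%N by rewrite j1_gt0 (leq_trans j12).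
rewrite mc_c_le //.
have j2n' : (1 <= j2 <= n)%N by rewrite j2n andbT (leq_trans j1_gt0).
by apply: leq_trans j12 _; rewrite -mc_c_le.
Qed.

Lemma mc_c_block i : (0 < i < n)%N ->
  reshape_index (mc_concat mu) i.-1 = reshape_index (mc_concat mu) i ->
  mc_c mu i = mc_c mu i.+1.
Proof.
move=> i0n E; have i1 : (1 <= i <= n)%N by lia.
apply/eqP; rewrite eqn_leq mc_c_mono //=; try lia.
rewrite mc_c_le; last lia.
have /andP[_ cr] := mc_c_bounds i1; have [t ts aE] := mc_a_take cr.
rewrite aE -reshape_index_lt // -E reshape_index_lt // -aE.
by have := mc_c_le (mc_c mu i) i1; rewrite leqnn => /esym; lia.
Qed.

End Composition.

(** The first isomorphism theorem for left multiplication by [x]. *)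
Lemma rquot_annihilator_iso (A : pzRingType) (x : A) (I : rideal A) :
    (forall h, x * h = 0 <-> rideal_set I h) ->
  exists f : {linear rquot I -> rideal_mod (rideal_principal x)}, bijective f.
Proof.
move=> annE.
have xP (y : A) : (x * y : A^c^o) \in rideal_pred (rideal_principal x).
  by apply/asboolP; exists y.
pose f (u : rquot I) : rideal_mod (rideal_principal x) :=
  exist (fun z : A^c^o => z \in rideal_pred (rideal_principal x)) (x * repr u) (xP (repr u)).
have fE (y : A^c^o) : \val (f (\pi_(rquot I) y)%qT) = x * y.
  have /pi_rquotE/asboolP/annE := reprK (\pi_(rquot I) y)%qT.
  by rewrite mulrBr => /subr0_eq.
have f_lin : linear f.
  move=> a u v; apply: val_inj; rewrite linearP.
  have -> : a *: u + v = (\pi_(rquot I) (a *: (repr u : A^c^o) + repr v))%qT.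
    by rewrite pi_rquotD -rquot_scale_pi !reprK.
  apply: (etrans (fE _)); apply: (etrans (mulrDr x _ _)).
  by congr (_ + _); exact: mulrA.
pose F : {linear rquot I -> rideal_mod (rideal_principal x)} :=
  HB.pack f (GRing.isLinear.Build A^c (rquot I) (rideal_mod (rideal_principal x)) *:%R f f_lin).
have f_inj : injective f.
  move=> u v /(congr1 val); rewrite -[u]reprK -[v]reprK !fE => E.
  by apply/pi_rquotE/asboolP/annE; rewrite mulrBr; apply/eqP; rewrite subr_eq0; exact/eqP.
have f_surj y : exists u, f u = y.
  have /asboolP[h _ hE] := valP y; exists (\pi_(rquot I) (h : A^c^o))%qT.
  by apply: val_inj; rewrite fE.
have [g gK] := choice f_surj.
by exists F, g => // u; apply: f_inj; rewrite gK.
Qed.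

(** The elements annihilated by [x] form a right ideal. *)
Lemma rideal_gen_ann (A : pzRingType) (x : A) (G : set A) :
  (forall y, G y -> x * y = 0) -> forall y, rideal_set (rideal_gen G) y -> x * y = 0.
Proof.
move=> GA y /(_ [set y | x * y = 0]); apply; split=> //; split=> [|a b|a b] /=.
- exact: mulr0.
- by rewrite mulrDr => -> ->; rewrite addr0.
- by rewrite mulrA => ->; rewrite mul0r.
Qed.

Lemma rideal_gen_sub (A : pzRingType) (G : set A) y : G y -> rideal_set (rideal_gen G) y.
Proof. by move=> Gy K [_]; exact. Qed.

Section Multicomposition.
Variables (R : comUnitRingType) (n r : nat) (q : R) (Q : 'I_r.+1 -> R).
Variables (m : 'I_r.+1 -> nat) (mu : forall k : 'I_r.+1, (m k).-tuple nat).
Hypothesis mu_n : is_multicomposition n mu.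

Let clvl (j : nat) := mc_c mu j.+1.

(** For the constant bound r.+1 the theorem on annihilators is about [ak_x]. *)
Lemma Lprod_const : Lprod n q Q (fun=> r.+1) = 1.
Proof.
apply: big1 => k _; apply: big_pred0 => i /=.
by rewrite leqNgt ltn_ord.
Qed.

Lemma ak_m_Lprod : ak_m n q Q mu = ak_x n q Q mu * Lprod n q Q clvl.
Proof.
congr (_ * _); rewrite big_mkcond; apply: eq_bigr => k _.
have an : (mc_a mu k <= n)%N by rewrite -(mc_a_top mu_n) mc_a_mono // ltnW.
rewrite /Lfactor (_ : oapp Q 0 (insub (k : nat)) = Q k); last by rewrite valK.
case: ifP => k0; last first.
  apply/esym/big_pred0 => i; rewrite leqNgt.
  have /andP[c0 _] : (1 <= clvl i <= r.+1)%N by apply: (mc_c_bounds mu_n); rewrite ltn_ord.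
  by rewrite (leq_ltn_trans _ c0) // leqNgt k0.
rewrite big_add1 /= big_mkord (big_ord_widen _ (fun i => akL n q Q i.+1 - (Q k)%:A) an).
apply: eq_bigl => i; rewrite /clvl. by rewrite (mc_c_le mu_n) ?ltn_ord.
Qed.

End Multicomposition.

Theorem theorem3p8 (R : comUnitRingType) (n r : nat)
  (q : R) (q_unit : q \is a GRing.unit)
  (Q : 'I_r.+1 -> R) (Q_unit : forall k, Q k \is a GRing.unit)
  (m : 'I_r.+1 -> nat) (m_gt0 : forall k, (0 < m k)%N)
  (mu : forall k : 'I_r.+1, (m k).-tuple nat)
  (mu_n : is_multicomposition n mu) :
  let x_mu := ak_x n q Q mu in
  let m_mu := ak_m n q Q mu in
  let Itilde := rideal_gen (young_relators n q Q mu) in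
  let I :=
    rideal_gen (young_relators n q Q mu `|` jucys_murphy_relators n q Q mu) in
  ((exists f : {linear rquot Itilde -> rideal_mod (rideal_principal x_mu)},
      bijective f) /\
   (forall h : ariki_koike n q Q, x_mu * h = 0 <-> rideal_set Itilde h)) /\
  ((exists f : {linear rquot I -> rideal_mod (rideal_principal m_mu)},
      bijective f) /\
   (forall h : ariki_koike n q Q, m_mu * h = 0 <-> rideal_set I h)).
Proof.
move=> x_mu m_mu Itilde I.
pose blk (p : 'I_n) := reshape_index (mc_concat mu) p.
have blk_mono (x y : 'I_n) : (x <= y)%N -> (blk x <= blk y)%N.
  exact: reshape_index_mono.
have WE w : w \in young n mu <-> stabilizes blk w.
  by rewrite inE; split=> [/forallP h x|h]; [exact/eqP/h | apply/forallP => x; apply/eqP/h].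
have blkE (i : 'I_n) : same_block blk i <-> (0 < i)%N /\ simple_refl i \in young n mu.
  split=> [Pi|[i0 /WE wi]]; last by apply/stabilizes_simple.
  have i0 : (0 < i)%N by case/andP: Pi.
  by split=> //; apply/WE/stabilizes_simple.
have annx h : x_mu * h = 0 <-> rideal_set Itilde h.
  have g_mono (i j : nat) : (i <= j)%N -> (j < n)%N -> (r.+1 <= r.+1)%N by [].
  have g_bnd (j : nat) : (j < n)%N -> (0 < r.+1 <= r.+1)%N by rewrite leqnn.
  have xE : x_mu = parabolic_sum q Q (young n mu) * Lprod n q Q (fun=> r.+1).
    by rewrite Lprod_const mulr1.
  rewrite xE; apply: (annihilator_parabolic q_unit Q_unit blk_mono WE g_mono g_bnd) => //.
  - exact: ridealP.
  - by move=> i /blkE[i0 iW]; apply: rideal_gen_sub; exists i; split.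
  - move=> j jn; rewrite akLkE pQ_top ?(leq_ltn_trans _ jn) // mulr0 mul0r.
    by case: (ridealP Itilde).
  apply: rideal_gen_ann => y [i [i0 iW ->]].
  apply: (annihilator_relations q_unit WE g_mono g_bnd) => //.
  by left; exists i => //; apply/blkE.
have annm h : m_mu * h = 0 <-> rideal_set I h.
  pose g (j : nat) := mc_c mu j.+1.
  have g_mono (i j : nat) : (i <= j)%N -> (j < n)%N -> (g i <= g j)%N.
    by move=> ij jn; apply: (mc_c_mono mu_n); rewrite // ltnS ij.
  have g_bnd (j : nat) : (j < n)%N -> (0 < g j <= r.+1)%N.
    by move=> jn; apply: (mc_c_bounds mu_n); rewrite jn.
  have g_blk (i : 'I_n) : same_block blk i -> g i.-1 = g i.
    move=> /andP[i0 /eqP iE]; rewrite /g prednK //; apply: (mc_c_block mu_n).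
      by rewrite i0 ltn_ord.
    by move: iE; rewrite /blk ord_predE.
  rewrite [m_mu]ak_m_Lprod //.
  apply: (annihilator_parabolic q_unit Q_unit blk_mono WE g_mono g_bnd g_blk).
  - exact: ridealP.
  - by move=> i /blkE[i0 iW]; apply: rideal_gen_sub; left; exists i; split.
  - by move=> j jn; apply: rideal_gen_sub; right; exists j.+1.
  apply: rideal_gen_ann => y yG.
  apply: (annihilator_relations q_unit WE g_mono g_bnd g_blk).
  case: yG => [[i [i0 iW ->]]|[[|j] //= jn <-]]; first by left; exists i => //; apply/blkE.
  by right; exists j.
by split; split=> //; exact: rquot_annihilator_iso.
Qed.
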